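(* Let $\mu\in\mathrm{dom}(\alpha)$ be critical with $\alpha\in(1,2]$, and assume that $\theta$ has finite moment of order $\delta$ for all $\delta<\frac{2\alpha}{\alpha-1}$. If $d<\frac{2\alpha}{\alpha-1}$, then a $\mathcal T_n$-walk in $\mathbb Z^d$ with $\theta$-jumps is recurrent: $$\frac{R^\theta(\mathcal T_n)}{n}\longrightarrow0\quad\text{in probability as }n\to+\infty.$$ Consequently, if $\mu\in\mathrm{dom}(\alpha)$ is critical with $\alpha\in(1,2]$, $\theta$ has finite moment of order $\delta$ for all $\delta<\frac{2\alpha}{\alpha-1}$, and $d<\frac{2\alpha}{\alpha-1}$, then $\mathbb P(\mathrm{Esc}_+)=\mathbb P(\mathrm{Esc})=0$.
   Context: Offspring distribution: $\mu$ is a probability distribution on $\mathbb N=\{0,1,2,\dots\}$, critical ($\sum_k k\mu(k)=1$, $\mu\neq\delta_1$); $\mu\in\mathrm{dom}(\alpha)$, $\alpha\in(1,2]$, means that $\mathrm{Gen}_\mu(s)=\sum_k\mu(k)s^k$ satisfies $\mathrm{Gen}_\mu(1-s)-(1-s)=s^\alpha L(1/s)$ for $s\in(0,1]$ with $L$ slowly varying at $+\infty$. Jump distribution: $\theta$ is a centered probability distribution on $\mathbb Z^d$ with invertible covariance matrix. $\mathcal T$ is a $\mu$-Bienaymé (Galton–Watson) tree, and $\mathcal T_n$ is $\mathcal T$ conditioned to have $n+1$ vertices ($n$ ranges over the integers for which this event has positive probability). A $T$-walk with $\theta$-jumps has, given the tree, i.i.d. increments with law $\theta$ along the edges (from parent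 to child) and starts from $0$ at the root (at $c_0$ for $\mathcal T_\infty$ below). Its range is $R^\theta(T)=\#\{W_T(u):u\in T\}$. Infinite tree $\mathcal T_\infty$: it has an infinite spine $(c_0,c_{-1},c_{-2},\dots)$ in which $c_{-i-1}$ is the parent of $c_{-i}$ for all $i\ge0$. Independently for $k\ge1$, $c_{-k}$ has a number of children distributed according to $\mu'(j)=j\mu(j)$, and $c_{-k+1}$ is placed uniformly among these (ordered) children. All other vertices, including $c_0$, have independent numbers of (ordered) children with law $\mu$. Depth-first order $\preceq$: $u\preceq v$ iff $u$ is $v$ or an ancestor of $v$, or, with $w$ the last common ancestor of $u,v$, the child of $w$ equal to or an ancestor of $u$ comes before the child of $w$ equal to or an ancestor of $v$. $\mathcal T_+=\{u\in\mathcal T_\infty:c_0\prec u\}$. With $W_{\mathcal T_\infty}$ the $\mathcal T_\infty$-walk started at $W_{\mathcal T_\infty}(c_0)=0$: $\mathrm{Esc}=(W_{\mathcal T_\infty}(u)\neq0\ \forall u\in\mathcal T_\infty\setminus\{c_0\})$ and $\mathrm{Esc}_+=(W_{\mathcal T_\infty}(u)\neq0\ \forall u\in\mathcal T_+)$. *)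

(* Defs.v *)
From HB Require Import structures.
From mathcomp Require Import all_boot all_order all_algebra.
From mathcomp Require Import finmap.
From mathcomp Require Import all_classical all_reals all_analysis.

Set Implicit Arguments.
Unset Strict Implicit.
Unset Printing Implicit Defensive.
Import Order.TTheory GRing.Theory Num.Theory.
Import numFieldNormedType.Exports.

Local Open Scope classical_set_scope.
Local Open Scope ring_scope.

(* The lattice Z^d, with its discrete sigma-algebra. *)
Definition Zd (d : nat) : Type := 'rV[int]_d.
HB.instance Definition _ d := GRing.Zmodule.on (Zd d).
HB.instance Definition _ d := isPointed.Build (Zd d) (0 : 'rV[int]_d).
HB.instance Definition _ d := @isMeasurable.Build default_measure_display
  (Zd d) discrete_measurable discrete_measurable0
  discrete_measurableC discrete_measurableU.

Section offspring.
Context {R : realType}.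
Implicit Types (mu : probability nat R) (L : R -> R).

Definition critical mu : Prop :=
  (\sum_(0 <= k <oo) k%:R%:E * mu [set k] = 1)%E /\
  (mu : set nat -> \bar R) <> \d_(1%N).

Definition Gen mu (s : R) : R :=
  fine (\sum_(0 <= k <oo) mu [set k] * (s ^+ k)%:E)%E.

Definition slowly_varying L : Prop :=
  (exists A : R, measurable_fun `[A, +oo[ L /\ forall x, A <= x -> 0 < L x) /\
  forall c : R, 0 < c -> L (c * x) / L x @[x --> +oo] --> (1 : R).

Definition in_dom (alpha : R) mu : Prop :=
  exists2 L, slowly_varying L &
    forall s : R, 0 < s <= 1 ->
      Gen mu (1 - s) - (1 - s) = s `^ alpha * L s^-1.

End offspring.

Section jumps.
Context {R : realType} {d : nat}.
Implicit Types theta : probability (Zd d) R.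

Definition coord (i : 'I_d) (x : Zd d) : R := ((x : 'rV[int]_d) 0 i)%:~R.

Definition enorm (x : Zd d) : R := Num.sqrt (\sum_i coord i x ^+ 2).

Definition finite_moment theta (delta : R) : Prop :=
  ('E_theta[fun x => (enorm x `^ delta)%R] < +oo)%E.

Definition centered theta : Prop :=
  forall i, theta.-integrable setT (EFin \o coord i) /\
            ('E_theta[coord i] = 0)%E.

Definition covariance_matrix theta : 'M[R]_d :=
  \matrix_(i, j) fine (covariance theta (coord i) (coord j)).

(* The second moment is required for the covariance matrix to make sense. *)
Definition jump_distribution theta : Prop :=
  [/\ centered theta, finite_moment theta 2 &
      covariance_matrix theta \in unitmx].

End jumps.

(* Independence of a family of sub-sigma-algebras (product rule over all finite
   subfamilies). *)
Definition mutually_independent {R : realType} {d0 : measure_display}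
    {Om : measurableType d0} (P : probability Om R) {I : eqType}
    (E : I -> set (set Om)) : Prop :=
  forall (s : seq I) (A : I -> set Om), uniq s ->
    (forall i, i \in s -> E i (A i)) ->
    P (\bigcap_(i in [set` s]) A i) = (\prod_(i <- s) P (A i))%E.

(* ** Finite trees: Ulam-Harris labels, the j-th child (j = 0, 1, ...) of u
   being rcons u j. *)

(* The plane tree in which a vertex u has k u children; the values of k outside
   the tree are irrelevant. *)
Definition tree_of (k : seq nat -> nat) : set (seq nat) :=
  [set u | forall i, (i < size u)%N -> (nth 0 u i < k (take i u))%N].

(* x v is the increment along the edge from the parent of v to v; the value of x
   at the root [::] is not used. *)
Definition walk {V : zmodType} (x : seq nat -> V) (u : seq nat) : V :=
  \sum_(1 <= i < (size u).+1) x (take i u).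

(* The set is finite whenever the tree is; otherwise fset_set gives the junk
   value fset0. *)
Definition range_size {V : zmodType} (T : set (seq nat)) (W : seq nat -> V) :
  nat := #|` fset_set (W @` T)|%fset.

Section finite_trees.
Context {R : realType} {d0 : measure_display} {Om : measurableType d0}.
Context (P : probability Om R) {d : nat}.

(* K : offspring numbers, X : increments; tree_of (K ^~ omega) is then a
   mu-Bienayme tree and walk (X ^~ omega) a walk on it with theta-jumps. *)
Definition branching_walk (mu : probability nat R)
    (theta : probability (Zd d) R)
    (K : seq nat -> {RV P >-> nat}) (X : seq nat -> {RV P >-> Zd d}) : Prop :=
  [/\ forall u, distribution P (K u) = mu :> (set nat -> \bar R),
      forall u, distribution P (X u) = theta :> (set (Zd d) -> \bar R) &
      mutually_independent P (fun i : seq nat + seq nat =>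
        match i with
        | inl u => g_sigma_algebra_preimage (K u)
        | inr u => g_sigma_algebra_preimage (X u)
        end)].

Definition tree_size_event (K : seq nat -> {RV P >-> nat}) (n : nat) : set Om :=
  [set omega | (tree_of (fun u => K u omega) #= `I_n.+1)%card].

Definition cond_prob (A B : set Om) : R := fine (P (A `&` B)) / fine (P B).

Definition range_gt (K : seq nat -> {RV P >-> nat})
    (X : seq nat -> {RV P >-> Zd d}) (n : nat) (eps : R) : set Om :=
  [set omega | eps < (range_size (tree_of (fun u => K u omega))
                       (walk (fun u => X u omega)))%:R / n%:R].

(* R(T_n) / n --> 0 in probability, T_n being the tree conditioned to have n + 1
   vertices and n ranging over the integers for which this makes sense. *)
Definition recurrent_walk (K : seq nat -> {RV P >-> nat})
    (X : seq nat -> {RV P >-> Zd d}) : Prop :=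
  forall eps : R, 0 < eps ->
    cond_prob (range_gt K X n eps) (tree_size_event K n)
      @[n --> within [set n | (0 < P (tree_size_event K n))%E] \oo]
      --> (0 : R).

End finite_trees.

(* ** The infinite tree. The label (m, u) denotes the vertex reached from the
   spine vertex c_{-m} by following the word u downwards. Each vertex has a
   unique such label in which u does not start along the spine, and only those
   are used; in particular c_{-m} is (m, [::]). *)
Definition vertex : Type := (nat * seq nat)%type.

Definition c0 : vertex := (0%N, [::]).

Definition parent (v : vertex) : vertex :=
  if v.2 is [::] then (v.1.+1, [::]) else (v.1, take (size v.2).-1 v.2).

Definition ancestor_eq (u v : vertex) : Prop := exists n, iter n parent v = u.

Section infinite_tree.
(* For m >= 1, N m is the number of children of c_{-m} and J m the rank
   (starting from 0) of c_{-m+1} among them; k v is the number of children of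
   the vertices v off the spine, and of c_0. *)
Context (N J : nat -> nat) (k : vertex -> nat).

Definition nchild (v : vertex) : nat :=
  if (0 < v.1)%N && (v.2 == [::]) then N v.1 else k v.

Definition Tinf : set vertex :=
  [set v | tree_of (fun w => nchild (v.1, w)) v.2 /\
           ((0 < v.1)%N -> v.2 != [::] -> head 0%N v.2 != J v.1)].

(* Rank among siblings. *)
Definition sib_rank (v : vertex) : nat :=
  if v.2 is [::] then J v.1.+1 else last 0%N v.2.

(* Depth-first order; in the second case the common parent of a and b is the
   last common ancestor of u and v. *)
Definition dfs_le (u v : vertex) : Prop :=
  ancestor_eq u v \/
  exists a b : vertex, [/\ parent a = parent b, (sib_rank a < sib_rank b)%N,
                           ancestor_eq a u & ancestor_eq b v].

Definition Tplus : set vertex :=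
  [set u | [/\ Tinf u, dfs_le c0 u & u <> c0]].

Definition walk_inf {V : zmodType} (x : vertex -> V) (v : vertex) : V :=
  - (\sum_(0 <= i < v.1) x (i, [::])) + walk (fun w => x (v.1, w)) v.2.

End infinite_tree.

Section infinite_tree_walk.
Context {R : realType} {d0 : measure_display} {Om : measurableType d0}.
Context (P : probability Om R) {d : nat}.
Implicit Types (N J : nat -> {RV P >-> nat}) (K : vertex -> {RV P >-> nat}).
Implicit Types X : vertex -> {RV P >-> Zd d}.

(* Only the N m and J m with m >= 1 matter; spine position m below stands for
   c_{-m-1}. *)
Definition infinite_tree_walk (mu : probability nat R)
    (theta : probability (Zd d) R) N J K X : Prop :=
  [/\ forall m j, (0 < m)%N ->
        P (N m @^-1` [set j]) = (j%:R%:E * mu [set j])%E,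
      forall m j i, (0 < m)%N -> (i < j)%N ->
        P (N m @^-1` [set j] `&` J m @^-1` [set i])
          = ((j%:R^-1)%:E * P (N m @^-1` [set j]))%E,
      forall v, distribution P (K v) = mu :> (set nat -> \bar R),
      forall v, distribution P (X v) = theta :> (set (Zd d) -> \bar R) &
      mutually_independent P (fun i : nat + (vertex + vertex) =>
        match i with
        | inl m => g_sigma_algebra_preimage
                     (fun omega => (N m.+1 omega, J m.+1 omega))
        | inr (inl v) => g_sigma_algebra_preimage (K v)
        | inr (inr v) => g_sigma_algebra_preimage (X v)
        end)].

Definition Esc N J K X : set Om :=
  [set omega | forall v,
     Tinf (fun m => N m omega) (fun m => J m omega) (fun v => K v omega) v ->
     v <> c0 -> walk_inf (fun v => X v omega) v <> 0].

Definition Esc_plus N J K X : set Om :=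
  [set omega | forall v,
     Tplus (fun m => N m omega) (fun m => J m omega) (fun v => K v omega) v ->
     walk_inf (fun v => X v omega) v <> 0].

End infinite_tree_walk.

(* Main.v *)
From HB Require Import structures.
Require Import Defs.
From mathcomp Require Import all_boot all_order all_algebra.
From mathcomp Require Import all_classical all_reals all_analysis.
From mathcomp Require Import ring lra zify.
Set Implicit Arguments.
Unset Strict Implicit.
Unset Printing Implicit Defensive.
Import Order.TTheory GRing.Theory Num.Theory.
Import numFieldNormedType.Exports.
Local Open Scope classical_set_scope.
Local Open Scope ring_scope.

(** The range is counted by last visits. In depth-first order, each site of the
    range is charged to the last vertex visiting it, a vertex whose site is avoided
    by all the vertices coming after it ([last_visits]). A tree with a marked vertex
    is cut along the line of ancestors of the mark into a chain of independent pieces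
    ([zipper], [weight_plug]). With [G] the generating function of [mu], [F z] that of
    the size of the tree, and [phi z = z * G'(F z)], trees marked at height [h] have
    generating function [phi z ^ h * F z] ([marked_mass_expr]), and whatever the size
    of the tree the mark is displaced by a sum of [h] independent centered jumps
    ([marked_disp]).

    The law [mu] enters through the gap [g s = G (1 - s) - (1 - s)]. Slow variation
    gives [g s = s^(alpha + o(1))] ([power_lower], [power_upper]). The equation
    [F = z * G(F)] turns this into [1 - F = w^(- 1/alpha + o(1))] at [z = 1 - 1/w], and
    by convexity [1 - phi] is at least [w^(- (1 - 1/alpha) + o(1))] there
    ([defect_upper], [defect_lower], [phi_upper]): in a tree with [w] vertices the
    heights are at most [w^(1 - 1/alpha + o(1))].

    Finite trees ([range_small]). Vertices of height at most [w^g], with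
    [g > 1 - 1/alpha], are at distance less than [w^(g'/2)] from the origin, [g' > g],
    up to a vanishing proportion, by Chebyshev's inequality. Higher vertices have a
    stretched exponentially small mass, while a size [w] of positive probability has
    probability at least [exp (- w^eps)] for every [eps > 0] ([size_prob_lower]): the
    probabilities of the sizes are supermultiplicative, by grafting trees on one
    another, and the growth of the truncated means forces a likely size in every
    window [(x^p, x]]. The range is thus at most the number of points of a ball, of
    order [w^(d g' / 2)], up to [o(w)]; and [d g' < 2] is possible exactly when
    [d (1 - 1/alpha) < 2], which is the condition on the dimension.

    Infinite tree ([escape_zero], [no_escape]). The part of the tree below the spine
    vertex at height [h], marked at [c0], is almost surely finite, and its law is the
    weight of the marked trees of height [h] ([prob_zrealized]): size biasing
    followed by a uniform choice of the child on the spine gives each rank the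
    probability it has in a finite tree. When the walk escapes, [c0] is a last visit
    in this marked tree. Hence the marks of height [h] that are last visits have mass
    at least [c = P Esc_plus]. Sum over [h < H]: in one tree there are at most as many
    last visits as vertices, and at most [M = (2 n + 1)^d] of them close to the origin,
    so that [H * c] is at most [E (min |T| M) + O(H^2 / n^2)], where the first term is
    [n^(d (1 - 1/alpha) + o(1))]. Taking [H = n^b] with [d (1 - 1/alpha) < b < 2]
    yields [c = 0]. *)

(** * Sums of nonnegative families *)

Section total_sums.
Context {R : realType}.
Local Open Scope ereal_scope.

(** Nonnegative families are summed in the extended reals, so that no
    summability has to be carried along. *)
Definition tot (T : choiceType) (f : T -> \bar R) : \bar R :=
  \esum_(x in [set: T]) f x.

Lemma tot_ge0 (T : choiceType) (f : T -> \bar R) :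
  (forall x, 0 <= f x) -> 0 <= tot f.
Proof. by move=> f0; apply: esum_ge0 => x _. Qed.

Lemma le_tot (T : choiceType) (f g : T -> \bar R) :
  (forall x, f x <= g x) -> tot f <= tot g.
Proof. by move=> fg; apply: le_esum => x _. Qed.

Lemma eq_tot (T : choiceType) (f g : T -> \bar R) :
  f =1 g -> tot f = tot g.
Proof. by move=> fg; apply: eq_esum => x _; apply: fg. Qed.

Lemma tot0 (T : choiceType) (f : T -> \bar R) :
  (forall x, f x = 0) -> tot f = 0.
Proof. by move=> f0; apply: esum1 => x _. Qed.

Lemma totD (T : choiceType) (f g : T -> \bar R) :
  (forall x, 0 <= f x) -> (forall x, 0 <= g x) ->
  tot (fun x => f x + g x) = tot f + tot g.
Proof. by move=> f0 g0; apply: esumD => x _. Qed.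

Lemma tot_ge (T : choiceType) (f : T -> \bar R) a :
  (forall x, 0 <= f x) -> f a <= tot f.
Proof.
move=> f0; apply: esum_ge; exists [set a]; last by rewrite fsbig_set1.
by split => //; exact: finite_set1.
Qed.

Lemma tot_single (T : choiceType) (f : T -> \bar R) a :
  (forall x, 0 <= f x) -> (forall x, x != a -> f x = 0) -> tot f = f a.
Proof.
move=> f0 fa; rewrite /tot -(esum_set1 (f0 a)) [RHS]esum_mkcond.
apply: eq_esum => x _; case: ifPn => //; rewrite notin_setE => /= /eqP.
exact: fa.
Qed.

Lemma tot_leZ (T : choiceType) (c : R) (f : T -> \bar R) : (0 < c)%R ->
  (forall x, 0 <= f x) -> tot (fun x => c%:E * f x) <= c%:E * tot f.
Proof.
move=> c0 f0; apply: ge_ereal_sup => _ [X [finX XI]] <-.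
rewrite fsbig_finite//= -ge0_sume_distrr; last by move=> *; exact: f0.
apply: lee_wpmul2l; first by rewrite lee_fin ltW.
by apply: esum_ge; exists X => //; rewrite fsbig_finite.
Qed.

Lemma totZ (T : choiceType) (c : \bar R) (f : T -> \bar R) : 0 <= c ->
  (forall x, 0 <= f x) -> tot (fun x => c * f x) = c * tot f.
Proof.
move: c => [c| |]// c0 f0; last first.
  have [/eqP sf|] := boolP (tot f == 0).
    rewrite sf mule0; apply: tot0 => x.
    have : f x <= 0 by rewrite -sf; exact: tot_ge.
    by move=> fx; rewrite (_ : f x = 0) ?mule0//; apply/eqP; rewrite eq_le fx f0.
  move=> sf0; have [x fx] : exists x, f x != 0.
    apply: contra_notP (negP sf0) => /forallNP fx.
    by apply/eqP/tot0 => x; apply/eqP/negPn/negP/fx.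
  have sf : 0 < tot f by rewrite lt_def sf0 tot_ge0.
  rewrite gt0_mulye//; apply/eqP; rewrite -leye_eq.
  have fxoo : +oo * f x = +oo by rewrite gt0_mulye// lt_def fx f0.
  rewrite -[leLHS]fxoo.
  by apply: (@tot_ge _ (fun x => +oo * f x)) => y; exact: mule_ge0.
move: c0; rewrite lee_fin le_eqVlt => /predU1P[<-|c0].
  by rewrite mul0e; apply: tot0 => x; rewrite mul0e.
apply/eqP; rewrite eq_le tot_leZ//=.
have cV0 : (0 < c^-1)%R by rewrite invr_gt0.
have cf0 x : 0 <= c%:E * f x by rewrite mule_ge0// lee_fin ltW.
rewrite -[leRHS]mul1e -(@divff _ c) ?gt_eqF// EFinM -muleA.
apply: lee_wpmul2l; first by rewrite lee_fin ltW.
apply: le_trans (tot_leZ cV0 cf0).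
apply: le_tot => x.
by rewrite muleA -EFinM mulVf ?gt_eqF// mul1e.
Qed.

Lemma totZr (T : choiceType) (c : \bar R) (f : T -> \bar R) : 0 <= c ->
  (forall x, 0 <= f x) -> tot (fun x => f x * c) = tot f * c.
Proof.
by move=> c0 f0; rewrite muleC -totZ//; apply: eq_tot => x; rewrite muleC.
Qed.

Lemma tot_pair (A B : choiceType) (f : A * B -> \bar R) :
  (forall x, 0 <= f x) -> tot f = tot (fun a => tot (fun b => f (a, b))).
Proof.
move=> f0; rewrite /tot [RHS]esum_esum//=.
rewrite (_ : _ `*`` _ = setT); last by apply/seteqP; split.
by apply: eq_esum => -[].
Qed.

Lemma tot_bij (A B : choiceType) (e : A -> B) (f : B -> \bar R) :
  bijective e -> tot f = tot (fun a => f (e a)).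
Proof.
move=> e_bij; apply: reindex_esum; split => //.
- by move=> x y _ _; exact: (bij_inj e_bij).
- by case: e_bij => e' _ e'K y _; exists (e' y).
Qed.

Lemma tot_exchange (A B : choiceType) (f : A -> B -> \bar R) :
  (forall x y, 0 <= f x y) ->
  tot (fun a => tot (f a)) = tot (fun b => tot (f^~ b)).
Proof.
move=> f0; rewrite -(@tot_pair _ _ (fun p => f p.1 p.2))//.
rewrite -(@tot_pair _ _ (fun p => f p.2 p.1))//.
rewrite (tot_bij (e := fun p : A * B => (p.2, p.1)))//.
by exists (fun p => (p.2, p.1)) => -[].
Qed.

Lemma tot_sum (T : choiceType) (I : choiceType) (r : seq I) (f : I -> T -> \bar R) :
  (forall i x, 0 <= f i x) ->
  tot (fun x => \sum_(i <- r) f i x) = \sum_(i <- r) tot (f i).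
Proof. by move=> f0; exact: esum_sum. Qed.

Lemma tot_key (A B : choiceType) (k : A -> B) (f : A -> \bar R) :
  (forall x, 0 <= f x) ->
  tot f = tot (fun b => tot (fun a => if k a == b then f a else 0)).
Proof.
move=> f0; rewrite tot_exchange; last by move=> b a; case: ifP.
apply: eq_tot => a; rewrite (@tot_single _ _ (k a)) ?eqxx// => [b|b].
  by case: ifP.
by rewrite eq_sym => /negbTE ->.
Qed.

Lemma tot_seq (T : choiceType) (f : seq T -> \bar R) :
  (forall s, 0 <= f s) ->
  tot f = f [::] + tot (fun x => tot (fun s => f (x :: s))).
Proof.
move=> f0.
rewrite -(@tot_pair _ _ (fun p => f (p.1 :: p.2)))//.
pose dec (s : seq T) := if s is x :: s' then Some (x, s') else None.
pose enc (o : option (T * seq T)) := if o is Some p then p.1 :: p.2 else [::].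
have encK : cancel enc dec by case=> [[]|].
have decK : cancel dec enc by case.
rewrite (tot_bij (e := enc)); last by exists dec.
rewrite /tot (esumID [set None])//= setTI esum_set1//=; congr (_ + _).
rewrite setTI (_ : ~` [set None] = @Some (T * seq T) @` setT); last first.
  apply/seteqP; split => [[p|]//= _|_ /= [p _ <-]//].
  by exists p.
by rewrite esum_image// => p q _ _ [].
Qed.

Lemma tot_seq_size (T : choiceType) (w : T -> \bar R) (k : nat) :
  (forall x, 0 <= w x) ->
  tot (fun s : seq T => if size s == k then \prod_(x <- s) w x else 0) =
  (tot w) ^+ k.
Proof.
move=> w0; have p0 s : 0 <= \prod_(x <- s) w x by exact: prode_ge0.
elim: k => [|k IHk]; rewrite tot_seq; do ?by move=> s; case: ifP.
- by rewrite /= big_nil [X in _ + X]tot0 ?adde0// => x; exact: tot0.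
- rewrite /= add0e.
  under eq_tot => x do under eq_tot => s do
    rewrite eqSS big_cons -[X in if _ then _ else X](mule0 (w x)) -fun_if.
  under eq_tot => x.
    rewrite totZ//; last by move=> s; case: ifP.
    rewrite IHk; over.
  by rewrite totZr ?expe_ge0 ?tot_ge0//; exact/esym/expeS.
Qed.

Lemma tot_seq_prod (T : choiceType) (a : nat -> \bar R) (w : T -> \bar R) :
  (forall k, 0 <= a k) -> (forall x, 0 <= w x) ->
  tot (fun s : seq T => a (size s) * \prod_(x <- s) w x) =
  tot (fun k => a k * (tot w) ^+ k).
Proof.
move=> a0 w0; have p0 s : 0 <= \prod_(x <- s) w x by exact: prode_ge0.
rewrite (tot_key (@size T)); last by move=> s; rewrite mule_ge0.
apply: eq_tot => k; rewrite -tot_seq_size// -totZ//; last first.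
  by move=> s; case: ifP.
by apply: eq_tot => s; case: eqP => [->|]; rewrite ?mule0.
Qed.

Lemma expeD (x : \bar R) a b : x ^+ (a + b) = x ^+ a * x ^+ b.
Proof.
elim: a => [|a IH]; first by rewrite add0n expe0 mul1e.
by rewrite addSn !expeS IH muleA.
Qed.

(** The diagonal [a + b = k] has [k.+1] points: the ranks a distinguished child can
    have among [k.+1] siblings. *)
Lemma tot_diagonals (f : nat -> \bar R) : (forall k, 0 <= f k) ->
  tot (fun a => tot (fun b => f (a + b)%N)) = tot (fun k => k.+1%:R%:E * f k).
Proof.
move=> f0; rewrite -(@tot_pair _ _ (fun p => f (p.1 + p.2)%N))//.
rewrite (tot_key (fun p => p.1 + p.2)%N)//; apply: eq_tot => k.
rewrite tot_pair/=; last by move=> p; case: ifP.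
transitivity (tot (fun a => if (a <= k)%N then f k else 0)).
  apply: eq_tot => a; case: ifPn => ak; last first.
    rewrite tot0// => b; case: eqP => // abk.
    by rewrite -abk leq_addr in ak.
  rewrite (@tot_single _ _ (k - a)%N) ?subnKC ?eqxx//.
    by move=> b; case: ifP.
  move=> b bka; case: eqP => // abk.
  by rewrite -abk addKn eqxx in bka.
elim: k (f k) (f0 k) => [|k IH] x x0.
  rewrite mul1e (@tot_single _ _ 0%N)//; first by move=> a; case: ifP.
  by case.
transitivity (tot (fun a => (if (a <= k)%N then x else 0) +
                            (if (a == k.+1)%N then x else 0))).
  apply: eq_tot => a; rewrite leq_eqVlt ltnS orbC.
  case: (leqP a k) => [ak|_] /=; last by rewrite add0e.
  by rewrite ifF ?adde0//; apply/negbTE; rewrite neq_ltn ltnS ak.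
rewrite totD; last 2 first.
- by move=> a; case: ifP.
- by move=> a; case: ifP.
rewrite IH// (@tot_single _ _ k.+1) ?eqxx//; last 2 first.
- by move=> a; case: ifP.
- by move=> a /negbTE ->.
by rewrite -(addn1 k.+1) natrD EFinD ge0_muleDl ?lee_fin// mul1e.
Qed.

Lemma tot_nat (f : nat -> \bar R) :
  (forall k, 0 <= f k) -> tot f = \sum_(0 <= k <oo) f k.
Proof. by move=> f0; rewrite nneseries_esumT. Qed.

End total_sums.


(** * Labelled trees and their marked vertices *)

(** Finite plane trees whose edges carry increments: the increment of an edge is
    stored with the child at its lower end, so that the root carries none. *)
Inductive ltree (V : Type) : Type := Node of seq (V * ltree V).

Section ltree_countable.
Context {V : countType}.

Lemma ltree_forest_ind (P : ltree V -> Prop) :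
  (forall s, foldr (fun p Q => P p.2 /\ Q) True s -> P (Node s)) ->
  forall t, P t.
Proof.
move=> H; fix IH 1 => -[s]; apply: H.
by elim: s => [|p s IHs] //=; split.
Qed.

Fixpoint ltree_encode (t : ltree V) : GenTree.tree V :=
  let: Node s := t in
  GenTree.Node 0 (map (fun p => GenTree.Node 0
    [:: GenTree.Leaf p.1; ltree_encode p.2]) s).

Fixpoint ltree_decode (g : GenTree.tree V) : ltree V :=
  if g is GenTree.Node _ gs then
    Node (pmap (fun g' => if g' is GenTree.Node _ [:: GenTree.Leaf x; c]
                          then Some (x, ltree_decode c) else None) gs)
  else Node [::].

Lemma ltree_encodeK : cancel ltree_encode ltree_decode.
Proof.
elim/ltree_forest_ind => s /= IH; congr Node.
by elim: s IH => [|[x c] s IHs] //= [-> /IHs ->].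
Qed.

HB.instance Definition _ := Countable.copy (ltree V) (can_type ltree_encodeK).

Lemma ltree_ind_in (P : ltree V -> Prop) :
  (forall s, (forall p, p \in s -> P p.2) -> P (Node s)) -> forall t, P t.
Proof.
move=> H; elim/ltree_forest_ind => s IH; apply: H.
elim: s IH => [|q s IHs] //= [Pq /IHs{}IHs] p.
by rewrite inE => /predU1P[->|/IHs].
Qed.

End ltree_countable.

Section zippers.
Context {V : countZmodType}.
Implicit Types (t c : ltree V) (s l r : seq (V * ltree V)).

Definition tchildren t := let: Node s := t in s.

Fixpoint nvert t : nat := let: Node s := t in (sumn (map (fun p => nvert p.2) s)).+1.

Definition fsize s := sumn (map (fun p => nvert p.2) s).

Fixpoint disp t : seq V :=
  let: Node s := t in
  0 :: flatten (map (fun p => map (fun y => p.1 + y) (disp p.2)) s).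

Definition fdisp s := flatten (map (fun p => map (fun y => p.1 + y) (disp p.2)) s).

Lemma size_disp t : size (disp t) = nvert t.
Proof.
elim/(@ltree_ind_in V): t => s IH /=; congr _.+1.
rewrite size_flatten /shape -map_comp; congr sumn.
by apply/eq_in_map => p /IH <-; rewrite /= size_map.
Qed.

(** A tree with a marked vertex is stored as a zipper: the subtree hanging from
    the mark together with, from the mark upwards, the elder siblings, the
    increment and the younger siblings met along the ancestral line. *)
Definition frame : Type := seq (V * ltree V) * V * seq (V * ltree V).
HB.instance Definition _ := Countable.on frame.

Definition zipper : Type := seq frame * ltree V.
HB.instance Definition _ := Countable.on zipper.

Implicit Types (fr : frame) (fs : seq frame) (z : zipper).

Definition plug1 fr t := Node (fr.1.1 ++ (fr.1.2, t) :: fr.2).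

Fixpoint plug fs t := if fs is fr :: fs' then plug fs' (plug1 fr t) else t.

Definition mark_disp fs : V := \sum_(fr <- fs) fr.1.2.

(** Walking up from the mark, the origin moves to the parent at each frame. *)
Fixpoint later_up fs : seq V :=
  if fs is fr :: fs' then map (fun y => y - fr.1.2) (fdisp fr.2 ++ later_up fs')
  else [::].

(** Displacements after the mark are relative to it, so that the mark is a last visit
    to its site when [0] is not among them. *)
Definition later z := behead (disp z.2) ++ later_up z.1.

(** The order is that of [disp], see [zippers_disp]. The inner fixpoint is
    [fzippers], inlined for the sake of structural recursion. *)
Fixpoint zippers t : seq zipper :=
  let: Node s := t in
  ([::], t) ::
  (fix zf l s := if s is p :: r then
     map (fun z => (rcons z.1 (l, p.1, r), z.2)) (zippers p.2) ++ zf (rcons l p) r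
   else [::]) [::] s.

Fixpoint fzippers l s : seq zipper :=
  if s is p :: r then
    map (fun z => (rcons z.1 (l, p.1, r), z.2)) (zippers p.2) ++
    fzippers (rcons l p) r
  else [::].

Lemma zippersE s : zippers (Node s) = ([::], Node s) :: fzippers [::] s.
Proof. by []. Qed.

Lemma plug_rcons fs fr t : plug (rcons fs fr) t = plug1 fr (plug fs t).
Proof. by elim: fs t => //= fr' fs IH t; rewrite IH. Qed.

Lemma fzippers_mem z l x c r l0 : z \in zippers c ->
  (rcons z.1 (l0 ++ l, x, r), z.2) \in fzippers l0 (l ++ (x, c) :: r).
Proof.
move=> zc; elim: l l0 => [|p l IH] l0 /=.
  by rewrite cats0 mem_cat; apply/orP; left; apply/mapP; exists z.
by rewrite mem_cat -cat_rcons IH orbT.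
Qed.

Lemma zippers_plug z : z \in zippers (plug z.1 z.2).
Proof.
case: z => fs t /=; elim/last_ind: fs => [|fs [[l x] r] IH].
  by case: t => s; rewrite /= inE eqxx.
rewrite plug_rcons /plug1 zippersE inE; apply/orP; right.
exact: (@fzippers_mem (fs, t) l x _ r [::] IH).
Qed.

Fixpoint tails (D : seq V) : seq (V * seq V) :=
  if D is a :: D' then (a, D') :: tails D' else [::].

Lemma tails_cat D E : tails (D ++ E) =
  map (fun p => (p.1, p.2 ++ E)) (tails D) ++ tails E.
Proof. by elim: D => //= a D ->. Qed.

Lemma tails_map (f : V -> V) D :
  tails (map f D) = map (fun p => (f p.1, map f p.2)) (tails D).
Proof. by elim: D => //= a D ->. Qed.

Lemma map_fst_tails D : map fst (tails D) = D.
Proof. by elim: D => //= a D ->. Qed.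

Lemma undup_tails D : map fst [seq p <- tails D | p.1 \notin p.2] = undup D.
Proof. by elim: D => //= a D IH; case: ifP => /= aD; rewrite IH -if_neg aD. Qed.

Definition abs_later z := map (fun y => mark_disp z.1 + y) (later z).

Lemma later_up_rcons fs fr : later_up (rcons fs fr) =
  later_up fs ++ map (fun y => y - fr.1.2 - mark_disp fs) (fdisp fr.2).
Proof.
rewrite /mark_disp; elim: fs => [|fr' fs IH] /=.
  by rewrite big_nil cats0; apply: eq_map => y; rewrite subr0.
rewrite IH big_cons !map_cat -catA -map_comp; congr (_ ++ (_ ++ _)).
by apply: eq_map => y /=; rewrite opprD [in RHS]addrA [RHS]addrAC.
Qed.

Lemma mark_disp_rcons fs fr : mark_disp (rcons fs fr) = fr.1.2 + mark_disp fs.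
Proof. by rewrite /mark_disp -cats1 big_cat big_seq1 addrC. Qed.

Lemma abs_later_rcons z fr : abs_later (rcons z.1 fr, z.2) =
  map (fun y => fr.1.2 + y) (abs_later z) ++ fdisp fr.2.
Proof.
rewrite /abs_later /later /= later_up_rcons mark_disp_rcons catA map_cat.
rewrite -!map_comp; congr (_ ++ _).
  by apply: eq_map => y /=; rewrite addrA.
rewrite -[RHS]map_id; apply: eq_map => y /=.
by rewrite -addrA [mark_disp _ + _]addrC subrK addrC subrK.
Qed.

(** Marking the vertices in depth-first order runs through the list of the
    displacements, the vertices coming after the mark forming the rest of it. *)
Lemma zippers_tails t :
  map (fun z => (mark_disp z.1, abs_later z)) (zippers t) = tails (disp t).
Proof.
elim/(@ltree_ind_in V): t => s IH; rewrite zippersE.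
have -> : disp (Node s) = 0 :: fdisp s by [].
rewrite [tails _]/= map_cons /=; congr (_ :: _).
  rewrite /mark_disp big_nil /abs_later /later /= cats0 /mark_disp big_nil.
  by congr (_, _); rewrite -[RHS]map_id; apply: eq_map => y; rewrite add0r.
elim: s [::] IH => [|[x c] s IHs] l IH //=.
rewrite map_cat IHs; last by move=> p ps; apply: IH; rewrite inE ps orbT.
have {}IH := IH (x, c) (mem_head _ _).
rewrite [fdisp _]/= tails_cat tails_map -IH -!map_comp.
congr (_ ++ _); apply: eq_map => z /=.
by rewrite mark_disp_rcons abs_later_rcons.
Qed.

Lemma zippers_disp t : map (fun z => mark_disp z.1) (zippers t) = disp t.
Proof.
rewrite -[RHS]map_fst_tails -zippers_tails -map_comp.
exact: eq_map.
Qed.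

Lemma size_zippers t : size (zippers t) = nvert t.
Proof. by rewrite -size_disp -zippers_disp size_map. Qed.

Lemma abs_laterE z : (mark_disp z.1 \notin abs_later z) = (0 \notin later z).
Proof.
rewrite /abs_later -{1}[mark_disp z.1]addr0 mem_map//.
Qed.

(** Keeping the last visit to each site counts the range. *)
Lemma last_visits t :
  [seq mark_disp z.1 | z <- zippers t & 0 \notin later z] =
  undup (disp t).
Proof.
rewrite -undup_tails -zippers_tails filter_map -map_comp.
rewrite (@eq_filter _ _ (fun z => 0 \notin later z))//.
by move=> z /=; rewrite abs_laterE.
Qed.

Lemma nvert_plug fs t :
  nvert (plug fs t) = (sumn (map (fun fr => (fsize fr.1.1 + fsize fr.2).+1) fs)
                       + nvert t)%N.
Proof.
elim: fs t => //= fr fs IH t; rewrite IH /plug1 /=.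
rewrite map_cat sumn_cat /= /fsize; lia.
Qed.

Lemma size_lt_nvert fs t : (size fs < nvert (plug fs t))%N.
Proof.
rewrite nvert_plug; elim: fs => [|fr fs IH] /=; first by case: t.
by rewrite !addSn ltnS; apply: (leq_trans IH); rewrite -addnA leq_addl.
Qed.

End zippers.


(** * The branching weight *)

Section branching_weight.
Context {R : realType} {V : countZmodType}.
Context (m : nat -> \bar R) (th : V -> \bar R).
Hypothesis m_ge0 : forall k, (0 <= m k)%E.
Hypothesis th_ge0 : forall x, (0 <= th x)%E.
Hypothesis th_mass : tot th = 1%E.
Local Open Scope ereal_scope.
Implicit Types (t c : ltree V) (s l r : seq (V * ltree V)).
Implicit Types (fr : frame (V := V)) (fs : seq (frame (V := V))).

(** The probability that a Bienayme tree with offspring law [m], with increments of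
    law [th] on its edges, is the finite tree [t]. *)
Fixpoint weight t : \bar R := let: Node s := t in
  m (size s) * foldr (fun p acc => th p.1 * weight p.2 * acc) 1 s.

Definition fweight s : \bar R := \prod_(p <- s) (th p.1 * weight p.2).

Lemma weightE s : weight (Node s) = m (size s) * fweight s.
Proof. by rewrite /fweight unlock. Qed.

Lemma weight_ge0 t : 0 <= weight t.
Proof.
elim/(@ltree_ind_in V): t => s IH; rewrite weightE mule_ge0//.
by rewrite /fweight big_seq; apply: prode_ge0 => p /IH pge0; rewrite mule_ge0.
Qed.

Lemma fweight_ge0 s : 0 <= fweight s.
Proof. by apply: prode_ge0 => p _; rewrite mule_ge0// weight_ge0. Qed.

Hint Resolve weight_ge0 fweight_ge0 : core.

Definition genfun (c : \bar R) : \bar R := tot (fun k => m k * c ^+ k).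

Lemma tot_tree (f : ltree V -> \bar R) : tot f = tot (fun s => f (Node s)).
Proof. by apply: tot_bij; exists tchildren => // -[]. Qed.

(** The branching property: a functional which is multiplicative over the
    subtrees of the root factorizes through the generating function. *)
Lemma tot_branching (q : ltree V -> \bar R) :
  (forall t, 0 <= q t) ->
  tot (fun s => weight (Node s) * \prod_(p <- s) q p.2) =
  genfun (tot (fun t => weight t * q t)).
Proof.
move=> q0; rewrite /genfun.
have -> : tot (fun t => weight t * q t) =
    tot (fun p : V * ltree V => th p.1 * (weight p.2 * q p.2)).
  rewrite tot_pair; last by move=> p; rewrite !mule_ge0.
  transitivity (tot (fun x => th x * tot (fun t => weight t * q t))).
    by rewrite totZr ?th_mass ?mul1e// tot_ge0// => t; rewrite mule_ge0.
  by apply: eq_tot => x; rewrite -totZ// => t; rewrite mule_ge0.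
rewrite -tot_seq_prod//; last by move=> p; rewrite !mule_ge0.
apply: eq_tot => s; rewrite weightE -muleA -big_split/=; congr (_ * _).
by apply: eq_bigr => p _; rewrite muleA.
Qed.

Definition mass_le n : \bar R :=
  tot (fun t => if (nvert t <= n)%N then weight t else 0).

(** The subtrees of the root of a tree with at most [n.+1] vertices have at most [n]
    vertices, and a generating function sends [[0, 1]] into itself. *)
Lemma mass_le_le1 n : tot m = 1 -> mass_le n <= 1.
Proof.
move=> m1; elim: n => [|n IHn].
  by rewrite /mass_le tot0// => -[s].
pose q t : \bar R := if (nvert t <= n)%N then 1 else 0.
have q0 t : 0 <= q t by rewrite /q; case: ifP.
apply: (@le_trans _ _ (genfun (tot (fun t => weight t * q t)))).
  rewrite -tot_branching// /mass_le tot_tree; apply: le_tot => s.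
  case: ifPn => [|_]; last by rewrite mule_ge0// prode_ge0.
  rewrite /= ltnS => sn; rewrite big_seq big1 ?mule1// => p ps.
  rewrite /q ifT//; apply: leq_trans sn; rewrite sumnE big_map.
  by rewrite (big_rem p)//= leq_addr.
have -> : tot (fun t => weight t * q t) = mass_le n.
  by apply: eq_tot => t; rewrite /q; case: ifP; rewrite ?mule1 ?mule0.
rewrite -[leRHS]m1; apply: le_tot => k.
rewrite -[leRHS]mule1; apply: lee_wpmul2l => //.
elim: k => [|k IHk]; first by rewrite expe0.
rewrite expeS -[leRHS]mule1; apply: lee_pmul => //.
  by apply: tot_ge0 => t; case: ifP.
by rewrite expe_ge0// tot_ge0// => t; case: ifP.
Qed.

(** Every finite set of trees has bounded size, so the bound passes to the
    limit. *)
Lemma mass_le1 : tot m = 1 -> tot weight <= 1.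
Proof.
move=> m1; apply: ge_ereal_sup => _ [X [finX _]] <-.
rewrite fsbig_finite//=.
pose n := \max_(t <- finmap.enum_fset (fset_set X)) nvert t.
apply: le_trans (mass_le_le1 n m1).
apply: (@le_trans _ _ (\sum_(t \in X) (if (nvert t <= n)%N then weight t else 0))).
  rewrite fsbig_finite//= [leLHS]big_seq [leRHS]big_seq; apply: lee_sum => t tX.
  by rewrite ifT// /n (big_rem t tX)/= leq_maxl.
by apply: esum_ge; exists X.
Qed.

(** The generating function of the number of vertices. *)
Definition Fgen (z : R) : \bar R := tot (fun t => weight t * (z ^+ nvert t)%:E).

Lemma Fgen_ge0 z : (0 <= z)%R -> 0 <= Fgen z.
Proof.
by move=> z0; apply: tot_ge0 => t; rewrite mule_ge0// lee_fin exprn_ge0.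
Qed.

Lemma prod_expr_nvert (z : R) s :
  \prod_(p <- s) ((z ^+ nvert p.2)%:E) = (z ^+ fsize s)%:E.
Proof.
elim: s => [|p s IH]; first by rewrite big_nil.
by rewrite big_cons IH -EFinM -exprD.
Qed.

Lemma Fgen_eq z : (0 <= z)%R -> Fgen z = z%:E * genfun (Fgen z).
Proof.
move=> z0; rewrite -tot_branching; last first.
  by move=> t; rewrite lee_fin exprn_ge0.
rewrite -totZ ?lee_fin//; last first.
  by move=> s; rewrite mule_ge0// prode_ge0// => p _; rewrite lee_fin exprn_ge0.
rewrite /Fgen tot_tree; apply: eq_tot => s; rewrite prod_expr_nvert.
by rewrite muleCA -EFinM -exprS.
Qed.

(** * Marked trees: the spine decomposition *)

(** What a frame contributes to the weight of the plugged tree: the offspring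
    number counts the elder siblings, the marked child and the younger ones. *)
Definition frame_weight fr : \bar R :=
  m (size fr.1.1 + size fr.2).+1 * (th fr.1.2 * (fweight fr.1.1 * fweight fr.2)).

Definition frame_size fr : nat := (fsize fr.1.1 + fsize fr.2).+1.

Lemma frame_weight_ge0 fr : 0 <= frame_weight fr.
Proof. by rewrite !mule_ge0. Qed.

Hint Resolve frame_weight_ge0 : core.

Lemma weight_plug fs t :
  weight (plug fs t) = (\prod_(fr <- fs) frame_weight fr) * weight t.
Proof.
elim: fs t => [|fr fs IH] t; first by rewrite big_nil mul1e.
rewrite big_cons /= IH muleAC -[RHS]muleC; congr (_ * _).
rewrite /plug1 weightE size_cat /= addnS /frame_weight -!muleA; congr (_ * _).
rewrite /fweight big_cat big_cons /= -!muleA.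
by rewrite muleCA; congr (_ * _); rewrite muleCA muleC -!muleA; congr (_ * _); rewrite muleC.
Qed.

(** For [s] depending on sizes only, the marked vertices at height [h] have the
    same total weight as a chain of [h] independent frames. *)
Definition chain h (s : nat -> \bar R) : \bar R :=
  tot (fun fs => if size fs == h then
    (\prod_(fr <- fs) frame_weight fr) * s (sumn (map frame_size fs)) else 0).

Lemma chain_ge0 h w : (forall n, 0 <= w n) -> 0 <= chain h w.
Proof.
by move=> w0; apply: tot_ge0 => fs; case: ifP => // _; rewrite mule_ge0// prode_ge0.
Qed.

Lemma chain0 w : (forall n, 0 <= w n) -> chain 0%N w = w 0%N.
Proof.
move=> w0; rewrite /chain (@tot_single _ _ _ [::]).
- by rewrite /= big_nil mul1e.
- by move=> fs; case: ifP => // _; rewrite mule_ge0// prode_ge0.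
- by move=> fs; case: fs.
Qed.

Lemma chainS h w : (forall n, 0 <= w n) ->
  chain h.+1 w =
  tot (fun fr => frame_weight fr * chain h (fun n => w (frame_size fr + n)%N)).
Proof.
move=> w0; rewrite /chain tot_seq; last first.
  by move=> fs; case: ifP => // _; rewrite mule_ge0// prode_ge0.
rewrite /= add0e; apply: eq_tot => fr; rewrite -totZ//; last first.
  by move=> fs; case: ifP => // _; rewrite mule_ge0// prode_ge0.
apply: eq_tot => fs; rewrite eqSS; case: ifP; last by rewrite mule0.
by rewrite big_cons muleA.
Qed.

(** Summing the increment out of a frame. *)
Lemma tot_frame (f : V -> \bar R) (g : seq (V * ltree V) -> seq (V * ltree V) -> \bar R) :
  (forall x, 0 <= f x) -> (forall l r, 0 <= g l r) ->
  tot (fun fr => frame_weight fr * (f fr.1.2 * g fr.1.1 fr.2)) =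
  tot (fun x => th x * f x) *
  tot (fun l => tot (fun r => m (size l + size r).+1 * (fweight l * fweight r) * g l r)).
Proof.
move=> f0 g0.
have fr0 fr : 0 <= frame_weight fr * (f fr.1.2 * g fr.1.1 fr.2) by rewrite !mule_ge0.
rewrite tot_pair//= tot_pair/=; last by move=> p; apply: tot_ge0 => r.
have h0 l r : 0 <= m (size l + size r).+1 * (fweight l * fweight r) * g l r.
  by rewrite !mule_ge0.
rewrite -totZ; last 2 first.
- by apply: tot_ge0 => x; rewrite mule_ge0.
- by move=> l; apply: tot_ge0 => r.
apply: eq_tot => l.
rewrite -totZr; last 2 first.
- by apply: tot_ge0 => r.
- by move=> x; rewrite mule_ge0.
apply: eq_tot => x; rewrite -totZ//; last by rewrite mule_ge0.
apply: eq_tot => r; rewrite /frame_weight /=.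
rewrite !muleA; congr (_ * _); rewrite -!muleA [LHS]muleCA; congr (_ * _).
by rewrite [RHS]muleC -!muleA.
Qed.

(** Along the ancestral line of a mark the increments are centered and
    independent of the sizes, so that a functional [N] such as the squared norm
    grows linearly with the height of the mark. *)
Lemma chain_disp (N : V -> \bar R) (sg : \bar R) h (w : nat -> \bar R) v :
  (forall x, 0 <= N x) -> 0 <= sg -> (forall n, 0 <= w n) ->
  (forall u, tot (fun x => th x * N (u + x)%R) = N u + sg) ->
  tot (fun fs => if size fs == h then
    (\prod_(fr <- fs) frame_weight fr) * w (sumn (map frame_size fs)) *
     N (v + mark_disp fs)%R else 0) =
  (N v + h%:R%:E * sg) * chain h w.
Proof.
move=> N0 sg0 w0 HN; elim: h w v w0 => [|h IH] w v w0.
  rewrite chain0// mul0e adde0 (@tot_single _ _ _ [::]).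
  - by rewrite /= /mark_disp !big_nil mul1e addr0 muleC.
  - by move=> fs; case: ifP => // _; rewrite !mule_ge0// prode_ge0.
  - by move=> fs; case: fs.
rewrite chainS// tot_seq; last first.
  by move=> fs; case: ifP => // _; rewrite !mule_ge0// prode_ge0.
rewrite /= add0e.
have hsg0 k : 0 <= k%:R%:E * sg by rewrite mule_ge0// lee_fin.
transitivity (tot (fun fr => frame_weight fr * ((N (v + fr.1.2)%R + h%:R%:E * sg) *
   chain h (fun n => w (frame_size (fr.1.1, 0%R, fr.2) + n)%N)))).
  apply: eq_tot => fr; rewrite -IH// -totZ//; last first.
    by move=> fs; case: ifP => // _; rewrite !mule_ge0// prode_ge0.
  apply: eq_tot => fs; rewrite eqSS; case: ifP; last by rewrite mule0.
  by rewrite /mark_disp !big_cons !muleA addrA.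
rewrite (@tot_frame (fun x => N (v + x)%R + h%:R%:E * sg)
  (fun l r => chain h (fun n => w (frame_size (l, 0%R, r) + n)%N))); last 2 first.
- by move=> x; rewrite adde_ge0.
- by move=> l r; rewrite chain_ge0.
have -> : tot (fun x => th x * (N (v + x)%R + h%:R%:E * sg)) = N v + h.+1%:R%:E * sg.
  under eq_tot => x do rewrite ge0_muleDr//.
  rewrite totD; last 2 first.
  - by move=> x; rewrite mule_ge0.
  - by move=> x; rewrite mule_ge0.
  rewrite HN totZr// th_mass mul1e -addeA; congr (_ + _).
  by rewrite -[h.+1]add1n natrD EFinD ge0_muleDl ?lee_fin// mul1e.
congr (_ * _).
have := @tot_frame (fun=> 1)
  (fun l r => chain h (fun n => w (frame_size (l, 0%R, r) + n)%N)).
have -> : tot (fun x => th x * 1) = 1 by under eq_tot do rewrite mule1.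
rewrite mul1e => <-//; last by move=> l r; rewrite chain_ge0.
by apply: eq_tot => fr; rewrite mul1e.
Qed.

(** The derivative of [genfun]. *)
Definition genfun' (c : \bar R) : \bar R := tot (fun k => m k.+1 * (k.+1%:R%:E * c ^+ k)).

Lemma fweight_tot k (z : R) : (0 <= z)%R ->
  tot (fun l => if size l == k then fweight l * (z ^+ fsize l)%:E else 0) = Fgen z ^+ k.
Proof.
move=> z0.
have -> : Fgen z = tot (fun p : V * ltree V => th p.1 * (weight p.2 * (z ^+ nvert p.2)%:E)).
  rewrite tot_pair; last by move=> p; rewrite !mule_ge0// lee_fin exprn_ge0.
  transitivity (tot (fun x => th x * Fgen z)).
    by rewrite totZr ?th_mass ?mul1e// Fgen_ge0.
  apply: eq_tot => x; rewrite -totZ// => t.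
  by rewrite !mule_ge0// lee_fin exprn_ge0.
rewrite -tot_seq_size; last by move=> p; rewrite !mule_ge0// lee_fin exprn_ge0.
apply: eq_tot => l; case: ifP => // _.
rewrite -prod_expr_nvert /fweight -big_split/=.
by apply: eq_bigr => p _; rewrite muleA.
Qed.

(** The generating function of the number of vertices contributed by one frame, see
    [tot_frame_weight]. *)
Definition phi (z : R) : \bar R := z%:E * genfun' (Fgen z).

Lemma phi_ge0 z : (0 <= z)%R -> 0 <= phi z.
Proof.
move=> z0; rewrite mule_ge0 ?lee_fin// tot_ge0// => k.
by rewrite !mule_ge0// ?lee_fin// expe_ge0// Fgen_ge0.
Qed.

(** With [k] siblings, the marked child has [k.+1] possible ranks: this is how the
    derivative of the generating function arises. *)
Lemma tot_frame_weight (z : R) : (0 <= z)%R ->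
  tot (fun fr => frame_weight fr * (z ^+ frame_size fr)%:E) = phi z.
Proof.
move=> z0.
have zn n : 0 <= (z ^+ n)%:E by rewrite lee_fin exprn_ge0.
have Fk k : 0 <= Fgen z ^+ k by rewrite expe_ge0// Fgen_ge0.
have := @tot_frame (fun=> 1) (fun l r => (z ^+ frame_size (l, 0%R, r))%:E).
have -> : tot (fun x => th x * 1) = 1 by under eq_tot do rewrite mule1.
rewrite mul1e => H.
transitivity (tot (fun fr => frame_weight fr * (1 * (z ^+ frame_size (fr.1.1, 0%R, fr.2))%:E))).
  by apply: eq_tot => fr; rewrite mul1e.
rewrite H//.
transitivity (tot (fun a => tot (fun b => z%:E * (m (a + b).+1 * Fgen z ^+ (a + b))))).
  transitivity (tot (fun l => tot (fun b => z%:E * (m (size l + b).+1 *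
      (fweight l * (z ^+ fsize l)%:E * Fgen z ^+ b))))).
    apply: eq_tot => l; rewrite (tot_key (@size _)); last by move=> r; rewrite !mule_ge0.
    apply: eq_tot => b; rewrite -fweight_tot//.
    have f0 r : 0 <= (if size r == b then fweight r * (z ^+ fsize r)%:E else 0).
      by case: ifP => // _; rewrite mule_ge0.
    rewrite -totZ ?mule_ge0// -totZ//; last by move=> r; rewrite !mule_ge0.
    rewrite -totZ//; last by move=> r; rewrite !mule_ge0.
    apply: eq_tot => r; case: eqP => [<-|]; last by rewrite !mule0.
    rewrite /frame_size /= exprS exprD !EFinM.
    by rewrite muleACA [X in _ * X = _]muleACA [RHS]muleA [z%:E * _]muleC.
  rewrite (tot_key (@size _)); last first.
    by move=> l; apply: tot_ge0 => b; rewrite !mule_ge0.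
  apply: eq_tot => a.
  transitivity (tot (fun l => tot (fun b => z%:E * (m (a + b).+1 * Fgen z ^+ b) *
     (if size l == a then fweight l * (z ^+ fsize l)%:E else 0)))).
    apply: eq_tot => l; case: eqP => [<-|]; last first.
      by rewrite tot0// => b; rewrite mule0.
    apply: eq_tot => b; rewrite -!muleA; congr (_ * _); congr (_ * _).
    by rewrite muleA muleC.
  rewrite tot_exchange; last first.
    by move=> l b; rewrite !mule_ge0//; case: ifP => // _; rewrite !mule_ge0.
  apply: eq_tot => b; rewrite totZ; last 2 first.
  - by rewrite !mule_ge0.
  - by move=> l; case: ifP => // _; rewrite !mule_ge0.
  by rewrite fweight_tot// expeD -!muleA; do 2!congr (_ * _); rewrite muleC.
rewrite (tot_diagonals (f := fun k => z%:E * (m k.+1 * Fgen z ^+ k))); last first.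
  by move=> k; rewrite !mule_ge0.
rewrite /phi /genfun' -totZ//; last first.
  by move=> k; rewrite !mule_ge0// lee_fin.
by apply: eq_tot => k; rewrite muleCA; congr (_ * _); rewrite muleCA.
Qed.

Lemma chain_expr h (z : R) : (0 <= z)%R ->
  chain h (fun n => (z ^+ n)%:E) = phi z ^+ h.
Proof.
move=> z0; rewrite -tot_frame_weight// -tot_seq_size; last first.
  by move=> fr; rewrite mule_ge0// lee_fin exprn_ge0.
apply: eq_tot => fs; case: ifP => // _.
rewrite [RHS]big_split/=; congr (_ * _).
elim: fs => [|fr fs IH]; first by rewrite big_nil.
by rewrite big_cons -IH -EFinM -exprD.
Qed.

End branching_weight.


(** * Marked trees of a given size *)

Section finite_sums.
Context {R : realType}.
Local Open Scope ereal_scope.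

Lemma tot_inj_in (A B : choiceType) (P : pred A) (e : A -> B) (f : B -> \bar R) :
  (forall x, 0 <= f x) -> {in P &, injective e} ->
  tot (fun a => if P a then f (e a) else 0) <= tot f.
Proof.
move=> f0 e_inj.
have -> : tot (fun a => if P a then f (e a) else 0) = \esum_(a in [set a | P a]) f (e a).
  rewrite [RHS]esum_mkcond; apply: eq_esum => a _.
  by congr (if _ then _ else _); apply/idP/idP; rewrite inE.
rewrite -(esum_image [set a | P a] e); last by move=> x y; rewrite !inE; exact: e_inj.
by rewrite [leLHS]esum_mkcond; apply: le_esum => x _; case: ifP.
Qed.

Lemma tot_mem (A : choiceType) (s : seq A) (f : A -> \bar R) :
  (forall x, 0 <= f x) -> uniq s ->
  tot (fun a => if a \in s then f a else 0) = \sum_(a <- s) f a.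
Proof.
move=> f0 us.
transitivity (tot (fun a => \sum_(b <- s) (if a == b then f b else 0))).
  apply: eq_tot => a; case: ifPn => [as_|as_].
    rewrite (bigD1_seq a)//= eqxx big1 ?adde0// => b.
    by rewrite eq_sym => /negbTE ->.
  rewrite big_seq big1// => b bs; case: eqP => // ab.
  by rewrite ab bs in as_.
rewrite tot_sum; last by move=> b a; case: ifP.
apply: eq_bigr => b _; rewrite (@tot_single _ _ _ b) ?eqxx//.
  by move=> a; case: ifP.
by move=> a /negbTE ->.
Qed.

Lemma sum_const_ge0 (I : Type) (r : seq I) (x : \bar R) : 0 <= x ->
  \sum_(i <- r) x = (size r)%:R%:E * x.
Proof.
move=> x0; elim: r => [|i r IH]; first by rewrite big_nil mul0e.
by rewrite big_cons IH /= -add1n natrD EFinD ge0_muleDl ?lee_fin// mul1e.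
Qed.

End finite_sums.

Section marks_and_grafts.
Context {V : countZmodType}.
Implicit Types (t c u : ltree V) (s l r : seq (V * ltree V)) (z : zipper (V := V)).

(** Two marks of a tree are told apart by the number of vertices after them. *)
Lemma zippers_uniq t : uniq (zippers t).
Proof.
apply: (@map_uniq _ _ (fun z => size (abs_later z))).
have -> : map (fun z => size (abs_later z)) (zippers t) =
    map (fun p => size p.2) (tails (disp t)).
  by rewrite -zippers_tails -map_comp; exact: eq_map.
elim: (disp t) => //= a D ->; rewrite andbT.
apply/mapP => -[p pD] /eqP.
suff : (size p.2 < size D)%N by rewrite ltn_neqAle eq_sym => /andP[/negbTE ->].
elim: D pD => //= b D IH; rewrite inE => /predU1P[->//|/IH]; exact: ltnW.
Qed.

Lemma plug_zippers t z : z \in zippers t -> plug z.1 z.2 = t.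
Proof.
elim/(@ltree_ind_in V): t z => s IH z; rewrite zippersE inE => /predU1P[->//|].
suff H l s' : (forall p, p \in s' -> forall z, z \in zippers p.2 -> plug z.1 z.2 = p.2) ->
    z \in fzippers l s' -> plug z.1 z.2 = Node (l ++ s').
  by move=> /H ->.
elim: s' l => [|[x c] s' IHs] l IH' //=.
rewrite mem_cat => /orP[/mapP[z' z'c ->]|zs]; last first.
  rewrite -cat_rcons; apply: IHs => // p ps; apply: IH'.
  by rewrite inE ps orbT.
by rewrite plug_rcons /plug1 /= (IH' _ (mem_head _ _)).
Qed.

Lemma mem_zippers t z : (z \in zippers t) = (plug z.1 z.2 == t).
Proof.
apply/idP/eqP => [/plug_zippers//|<-]; exact: zippers_plug.
Qed.

Fixpoint graft t u : ltree V :=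
  let: Node s := t in
  if s is (x, c) :: s' then Node ((x, graft c u) :: s') else u.

Lemma ltree_leftmost_ind (P : ltree V -> Prop) :
  P (Node [::]) -> (forall x c s, P c -> P (Node ((x, c) :: s))) -> forall t, P t.
Proof.
move=> P0 PS; elim/(@ltree_ind_in V) => -[|[x c] s] IH //.
by apply: PS; exact: (IH (x, c) (mem_head _ _)).
Qed.

Lemma nvert_graft t u : (nvert (graft t u)).+1 = (nvert t + nvert u)%N.
Proof.
elim/ltree_leftmost_ind: t => [//|x c s IH] /=.
by rewrite -addSn IH; lia.
Qed.

Lemma graft_inj t t' u u' : nvert t = nvert t' -> graft t u = graft t' u' ->
  t = t' /\ u = u'.
Proof.
elim/ltree_leftmost_ind: t t' => [|x c s IH] [[|[x' c'] s']] //=.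
- by case: c' => ? /= [].
- by case: c {IH} => ? /= [].
- move=> [] ncc [xx gg ss]; subst x' s'.
  have cc' : nvert c = nvert c' by move/eqP: ncc; rewrite eqn_add2r => /eqP.
  by have [-> ->] := IH _ cc' gg.
Qed.

End marks_and_grafts.

Section marked_weight.
Context {R : realType} {V : countZmodType}.
Context (m : nat -> \bar R) (th : V -> \bar R).
Hypothesis m_ge0 : forall k, (0 <= m k)%E.
Hypothesis th_ge0 : forall x, (0 <= th x)%E.
Hypothesis th_mass : tot th = 1%E.
Local Open Scope ereal_scope.
Implicit Types (t c u : ltree V) (s l r : seq (V * ltree V)) (z : zipper (V := V)).
Implicit Types (fr : frame (V := V)) (fs : seq (frame (V := V))).

Local Notation weight := (weight m th).
Local Notation chain := (chain m th).
Local Notation Fgen := (Fgen m th).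
Local Notation phi := (phi m th).

Let w_ge0 t : 0 <= weight t. Proof. exact: weight_ge0. Qed.
Let fw_ge0 fs : 0 <= \prod_(fr <- fs) frame_weight m th fr.
Proof. by apply: prode_ge0 => fr _; exact: frame_weight_ge0. Qed.
Hint Resolve w_ge0 fw_ge0 : core.

Lemma weight_graft t u : weight (graft t u) * m 0%N = weight t * weight u.
Proof.
elim/(@ltree_leftmost_ind V): t => [|x c s IH].
  by rewrite [graft _ _]/= [weight (Node _)]weightE /fweight big_nil mule1 muleC.
rewrite [graft _ _]/= !weightE /fweight !big_cons /= -!muleA; congr (_ * (_ * _)).
by rewrite [LHS]muleCA IH muleCA.
Qed.

Definition size_mass n : \bar R := tot (fun t => if nvert t == n then weight t else 0).

Lemma size_mass_ge0 n : 0 <= size_mass n.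
Proof. by apply: tot_ge0 => t; case: ifP. Qed.

(** Grafting is injective once the size of the first tree is known, and it
    destroys exactly one leaf. *)
Lemma size_mass_super a b :
  size_mass a.+1 * size_mass b.+1 <= m 0%N * size_mass (a + b).+1.
Proof.
rewrite /size_mass -[leRHS]totZ//; last by move=> t; case: ifP.
rewrite -[leLHS]totZr; last 2 first.
- exact: size_mass_ge0.
- by move=> t; case: ifP.
have -> : tot (fun t => (if nvert t == a.+1 then weight t else 0) *
      tot (fun u => if nvert u == b.+1 then weight u else 0)) =
    tot (fun t => tot (fun u => (if nvert t == a.+1 then weight t else 0) *
      (if nvert u == b.+1 then weight u else 0))).
  by apply: eq_tot => t; rewrite totZ// => [|u]; case: ifP.
rewrite -(@tot_pair _ _ _ (fun p => (if nvert p.1 == a.+1 then weight p.1 else 0) *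
   (if nvert p.2 == b.+1 then weight p.2 else 0))); last first.
  by move=> p; rewrite mule_ge0//; case: ifP.
apply: le_trans (@tot_inj_in _ _ _
   (fun p : ltree V * ltree V => (nvert p.1 == a.+1) && (nvert p.2 == b.+1))
   (fun p => graft p.1 p.2) _ _ _).
- apply: le_tot => p; case: eqP => /= pa; last by rewrite mul0e.
  case: eqP => /= pb; last by rewrite mule0.
  rewrite ifT; last by apply/eqP/succn_inj; rewrite nvert_graft pa pb addSn addnS.
  by rewrite -weight_graft muleC.
- by move=> t; rewrite mule_ge0//; case: ifP.
- move=> [t u] [t' u'] /= /andP[/eqP ta _] /andP[/eqP t'a _] /graft_inj.
  by rewrite ta t'a => /(_ erefl) [-> ->].
Qed.

(** Each tree can be marked once at each of its vertices. *)
Lemma tot_marked (f : zipper (V := V) -> \bar R) : (forall z, 0 <= f z) ->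
  tot (fun z : zipper (V := V) => weight (plug z.1 z.2) * f z) =
  tot (fun t => weight t * \sum_(z <- zippers t) f z).
Proof.
move=> f0; rewrite (tot_key (fun z : zipper (V := V) => plug z.1 z.2)); last first.
  by move=> z; rewrite mule_ge0.
apply: eq_tot => t; rewrite -tot_mem ?zippers_uniq// -totZ//; last first.
  by move=> z; case: ifP.
apply: eq_tot => z; rewrite mem_zippers; case: eqP => [->//|].
by rewrite mule0.
Qed.

Definition marked_mass h (w : nat -> \bar R) : \bar R :=
  tot (fun z : zipper (V := V) =>
    if size z.1 == h then weight (plug z.1 z.2) * w (nvert (plug z.1 z.2)) else 0).

Lemma marked_mass_ge0 h w : (forall n, 0 <= w n) -> 0 <= marked_mass h w.
Proof. by move=> w0; apply: tot_ge0 => z; case: ifP => // _; rewrite mule_ge0. Qed.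

(** The displacement of a mark at height [h] is that of [h] independent jumps,
    whatever the size of the tree. *)
Lemma marked_disp (N : V -> \bar R) (sg : \bar R) h (w : nat -> \bar R) :
  (forall x, 0 <= N x) -> 0 <= sg -> (forall n, 0 <= w n) ->
  (forall y, tot (fun x => th x * N (y + x)%R) = N y + sg) ->
  tot (fun z : zipper (V := V) => if size z.1 == h then
    weight (plug z.1 z.2) * (w (nvert (plug z.1 z.2)) * N (mark_disp z.1)) else 0) =
  (N 0%R + h%:R%:E * sg) * tot (fun t => weight t * chain h (fun n => w (n + nvert t)%N)).
Proof.
move=> N0 sg0 w0 HN; rewrite tot_pair/=; last first.
  by move=> z; case: ifP => // _; rewrite !mule_ge0.
rewrite tot_exchange; last by move=> fs t; case: ifP => // _; rewrite !mule_ge0.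
have Ns0 : 0 <= N 0%R + h%:R%:E * sg by rewrite adde_ge0// mule_ge0// lee_fin.
rewrite -totZ//; last by move=> t; rewrite mule_ge0// chain_ge0.
apply: eq_tot => t; rewrite muleCA -(@chain_disp _ _ m th m_ge0 th_ge0 th_mass N)//.
rewrite -totZ//; last by move=> fs; case: ifP => // _; rewrite !mule_ge0.
apply: eq_tot => fs; case: ifP; last by rewrite mule0.
rewrite nvert_plug weight_plug// add0r -/(frame_size _) => _.
by rewrite [X in X * _ = _]muleC -!muleA.
Qed.

Lemma marked_massE h w : (forall n, 0 <= w n) ->
  marked_mass h w = tot (fun t => weight t * chain h (fun n => w (n + nvert t)%N)).
Proof.
move=> w0; have := @marked_disp (fun=> 1) 0 h w.
rewrite mule0 adde0 mul1e => <- //.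
- by apply: eq_tot => z; rewrite mule1.
- by move=> _; rewrite ?adde0 -[RHS]th_mass; apply: eq_tot => x; rewrite mule1.
Qed.

Lemma marked_mass_expr h (z : R) : (0 <= z)%R ->
  marked_mass h (fun n => (z ^+ n)%:E) = phi z ^+ h * Fgen z.
Proof.
move=> z0; have zn n : 0 <= (z ^+ n)%:E by rewrite lee_fin exprn_ge0.
have p0 : 0 <= phi z ^+ h.
  by rewrite -chain_expr// chain_ge0.
rewrite marked_massE// /Fgen -totZ//; last by move=> t; rewrite mule_ge0.
apply: eq_tot => t; rewrite muleCA; congr (_ * _).
rewrite muleC -chain_expr// -totZ//; last first.
  by move=> fs; case: ifP => // _; rewrite mule_ge0.
apply: eq_tot => fs; case: ifP; last by rewrite mule0.
by rewrite exprD EFinM => _; rewrite [X in _ * X = _]muleC muleCA.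
Qed.

(** Markov's inequality for the displacement of a mark. *)
Lemma marked_far (far : pred V) (N : V -> \bar R) (sg : \bar R) (rr : R) h (w : nat -> \bar R) :
  (forall x, 0 <= N x) -> N 0%R = 0 -> 0 <= sg -> (forall n, 0 <= w n) -> (0 < rr)%R ->
  (forall x, far x -> rr%:E <= N x) ->
  (forall y, tot (fun x => th x * N (y + x)%R) = N y + sg) ->
  tot (fun z : zipper (V := V) => if size z.1 == h then
    weight (plug z.1 z.2) * (w (nvert (plug z.1 z.2)) * (far (mark_disp z.1))%:R%:E) else 0) <=
  (h%:R / rr)%:E * sg * marked_mass h w.
Proof.
move=> N0 N00 sg0 w0 rr0 farN HN.
have rV0 : 0 <= rr^-1%:E by rewrite lee_fin invr_ge0 ltW.
rewrite marked_massE// mulrC EFinM -!muleA [X in _ * X]muleA.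
rewrite -[X in _ * (X * _)]add0e -{2}N00 -(@marked_disp N)// -totZ//; last first.
  by move=> z; case: ifP => // _; rewrite !mule_ge0.
apply: le_tot => z; case: ifP => _; last by rewrite mule0.
rewrite [leRHS]muleCA; apply: lee_wpmul2l => //.
rewrite [leRHS]muleCA; apply: lee_wpmul2l => //.
case: (boolP (far _)) => [/farN HNx|_]; last by rewrite mule_ge0.
by rewrite -(@mulVf _ rr) ?gt_eqF// EFinM; apply: lee_wpmul2l.
Qed.

End marked_weight.


(** * Far vertices and last visits *)

Section range_bounds.
Context {R : realType} {V : countZmodType}.
Context (m : nat -> \bar R) (th : V -> \bar R).
Hypothesis m_ge0 : forall k, (0 <= m k)%E.
Hypothesis th_ge0 : forall x, (0 <= th x)%E.
Hypothesis th_mass : tot th = 1%E.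
Hypothesis m_mass : tot m = 1%E.
Context (far : pred V) (M : nat) (N : V -> \bar R) (sg : \bar R) (rr : R).
Hypothesis near_count : forall s : seq V, uniq s -> all (predC far) s -> (size s <= M)%N.
Hypothesis N_ge0 : forall x, (0 <= N x)%E.
Hypothesis N0 : N 0 = 0%E.
Hypothesis sg_ge0 : (0 <= sg)%E.
Hypothesis rr_gt0 : 0 < rr.
Hypothesis far_N : forall x, far x -> (rr%:E <= N x)%E.
Hypothesis N_drift : forall y, tot (fun x => (th x * N (y + x)%R)%E) = (N y + sg)%E.
Local Open Scope ereal_scope.
Implicit Types (t : ltree V) (z : zipper (V := V)).

Local Notation weight := (weight m th).
Local Notation Fgen := (Fgen m th).
Local Notation phi := (phi m th).
Local Notation size_mass := (size_mass m th).
Local Notation marked_mass := (marked_mass m th).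

Let w_ge0 t : 0 <= weight t. Proof. exact: weight_ge0. Qed.
Hint Resolve w_ge0 : core.

Lemma sum_count (A : eqType) (s : seq A) (p : pred A) :
  \sum_(a <- s) ((p a)%:R%:E : \bar R) = (count p s)%:R%:E.
Proof.
by rewrite sumEFin -natr_sum -big_mkcond /= sum1_count.
Qed.

Lemma Fgen_le1 (z : R) : (0 <= z <= 1)%R -> Fgen z <= 1.
Proof.
move=> /andP[z0 z1]; apply: le_trans (mass_le1 m_ge0 th_ge0 th_mass m_mass).
apply: le_tot => t; rewrite -[leRHS]mule1; apply: lee_wpmul2l => //.
by rewrite lee_fin exprn_ile1.
Qed.

(** The far vertices are counted as marks: those at height at most [H] are controlled
    by their displacement, the higher ones by their scarcity. *)
Lemma far_count_mass (n H : nat) (z : R) : (0 < z <= 1)%R -> phi z <= 1 ->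
  tot (fun t => if nvert t == n then weight t * (count far (disp t))%:R%:E else 0) <=
  (H%:R / rr)%:E * sg * (n%:R%:E * size_mass n) +
  n%:R%:E * ((z ^- n)%:E * phi z ^+ H).
Proof.
move=> /andP[z0 z1] phi1.
pose w k : \bar R := (k == n)%:R%:E.
have w0 k : 0 <= w k by rewrite lee_fin.
pose Y h := marked_mass h w.
have Y0 h : 0 <= Y h by exact: marked_mass_ge0.
pose f z' : \bar R := w (nvert (plug z'.1 z'.2)) * (far (mark_disp z'.1))%:R%:E.
have f0 z' : 0 <= f z' by rewrite mule_ge0// lee_fin.
pose X h := tot (fun z' : zipper (V := V) =>
  if size z'.1 == h then weight (plug z'.1 z'.2) * f z' else 0).
have z0' := ltW z0.
have phi0 : 0 <= phi z by exact: phi_ge0.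
apply: (@le_trans _ _ (\sum_(h < n) X h)).
  rewrite -(big_mkord xpredT X) /X -tot_sum; last first.
    by move=> h z'; case: ifP => // _; rewrite mule_ge0.
  apply: (@le_trans _ _ (tot (fun z' : zipper (V := V) => weight (plug z'.1 z'.2) * f z'))).
    rewrite tot_marked//; apply: le_tot => t; case: eqP => tn; last first.
      by rewrite mule_ge0// sume_ge0.
    apply: lee_wpmul2l => //.
    rewrite -zippers_disp count_map -sum_count big_seq [leRHS]big_seq.
    apply: lee_sum => z' zt; rewrite /f /w (plug_zippers zt) tn eqxx mul1e.
    by rewrite lee_fin.
  apply: le_tot => z'; rewrite /f /w; case: eqP => [pn|_]; last first.
    by rewrite mul0e mule0 sume_ge0// => h _; case: ifP => // _; rewrite mul0e mule0.
  rewrite mul1e (bigD1_seq (size z'.1)) ?iota_uniq//=; last first.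
    rewrite mem_index_iota -pn; exact: size_lt_nvert.
  by rewrite eqxx leeDl// sume_ge0// => h _; case: ifP => // _; rewrite mule_ge0// lee_fin.
have XY h : X h <= (h%:R / rr)%:E * sg * Y h by exact: (@marked_far _ _ m th _ _ _ far N).
have XY' h : X h <= Y h.
  apply: le_tot => z'; case: ifP => // _; rewrite /f; apply: lee_wpmul2l => //.
  by rewrite -[leRHS]mule1; apply: lee_wpmul2l => //; rewrite lee_fin lern1; case: (far _).
(* Exponential tilting: the indicator of size [n] is at most [z^size / z^n]. *)
have Yz h : (H <= h)%N -> Y h <= (z ^- n)%:E * phi z ^+ H.
  move=> Hh; apply: (@le_trans _ _ ((z ^- n)%:E * (phi z ^+ h * Fgen z))).
    have zn0 : 0 <= (z ^- n)%:E by rewrite lee_fin invr_ge0 exprn_ge0// ltW.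
    rewrite -marked_mass_expr// /marked_mass -totZ//; last first.
      by move=> z'; case: ifP => // _; rewrite mule_ge0// lee_fin exprn_ge0// ltW.
    apply: le_tot => z'; case: ifP => _; last by rewrite mule0.
    rewrite muleCA; apply: lee_wpmul2l => //; rewrite /w; case: eqP => [->|_].
      by rewrite -EFinM mulVf// gt_eqF// exprn_gt0.
    by rewrite mule_ge0// lee_fin exprn_ge0// ltW.
  apply: lee_wpmul2l; first by rewrite lee_fin invr_ge0 exprn_ge0// ltW.
  rewrite -(subnK Hh) expeD -[leRHS]mul1e -[leRHS]mule1.
  apply: lee_pmul => //.
  - by rewrite mule_ge0 ?expe_ge0.
  - by apply: Fgen_ge0 => //; exact: ltW.
  - apply: lee_wpmul2r; first exact: expe_ge0.
    elim: (h - H)%N => [|k IH]; first by rewrite expe0.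
    by rewrite expeS -[leRHS]mule1; apply: lee_pmul => //; exact: expe_ge0.
  - by apply: Fgen_le1; rewrite z1 ltW.
have sumY : \sum_(h < n) Y h <= n%:R%:E * size_mass n.
  rewrite -(big_mkord xpredT Y) /Y /marked_mass -tot_sum; last first.
    by move=> h z'; case: ifP => // _; rewrite mule_ge0.
  apply: (@le_trans _ _ (tot (fun z' : zipper (V := V) =>
      weight (plug z'.1 z'.2) * w (nvert (plug z'.1 z'.2))))).
    apply: le_tot => z'; case: (boolP (size z'.1 \in index_iota 0 n)) => zn.
      rewrite (bigD1_seq (size z'.1)) ?iota_uniq//= eqxx big1 ?adde0// => h.
      by rewrite eq_sym => /negbTE ->.
    rewrite big_seq big1 ?mule_ge0// => h hn; case: eqP => // zh.
    by rewrite zh hn in zn.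
  rewrite tot_marked//.
  rewrite /size_mass -totZ//; last by move=> t; case: ifP.
  apply: le_tot => t.
  rewrite big_seq (eq_bigr (fun=> w (nvert t))); last by move=> z' /plug_zippers ->.
  rewrite -big_seq sum_const_ge0// size_zippers /w.
  by case: eqP => [->|_]; rewrite ?mule0// mule1 muleC.
apply: (@le_trans _ _ (\sum_(h < n) ((H%:R / rr)%:E * sg * Y h + (z ^- n)%:E * phi z ^+ H))).
  apply: lee_sum => h _; have [hH|Hh] := leqP h H.
    rewrite -[leLHS]adde0; apply: leeD; last first.
      by rewrite mule_ge0 ?expe_ge0// lee_fin invr_ge0 exprn_ge0// ltW.
    apply: (le_trans (XY h)); apply: lee_wpmul2r => //; apply: lee_wpmul2r => //.
    by rewrite lee_fin ler_pM2r ?invr_gt0// ler_nat.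
  rewrite -[leLHS]add0e; apply: leeD; first by rewrite !mule_ge0// lee_fin divr_ge0// ltW.
  by apply: (le_trans (XY' h)); apply: Yz; exact: ltnW.
rewrite big_split/=; apply: leeD.
  rewrite -ge0_sume_distrr//; apply: lee_wpmul2l => //.
  by rewrite mule_ge0// lee_fin divr_ge0// ltW.
have p0 : 0 <= (z ^- n)%:E * phi z ^+ H.
  by rewrite mule_ge0 ?expe_ge0// lee_fin invr_ge0 exprn_ge0// ltW.
by rewrite -(big_mkord xpredT (fun=> _)) sum_const_ge0// size_iota subn0.
Qed.

(** Summed over the heights below [H], the masses of the marks that are last visits
    count last visits within single trees. These are at distinct sites, so that at
    most [M] of them are near the origin; the far ones are controlled by the
    displacement. *)
Lemma escape_mass (H : nat) : Fgen 1 <= 1 -> phi 1 <= 1 ->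
  \sum_(h < H) tot (fun z : zipper (V := V) => if size z.1 == h then
    weight (plug z.1 z.2) * (0%R \notin later z)%:R%:E else 0) <=
  tot (fun t => weight t * (minn (nvert t) M)%:R%:E) +
  (H%:R ^+ 2 / rr)%:E * sg.
Proof.
move=> F1 phi1.
pose sml z : \bar R := (size z.1 < H)%N%:R%:E.
have selE (f : zipper (V := V) -> \bar R) : (forall z, 0 <= f z) ->
    \sum_(h < H) tot (fun z : zipper (V := V) => if size z.1 == h then
    weight (plug z.1 z.2) * f z else 0) =
    tot (fun z : zipper (V := V) => weight (plug z.1 z.2) * (sml z * f z)).
  move=> f0.
  rewrite -(big_mkord xpredT (fun h => tot (fun z : zipper (V := V) => if size z.1 == h then
    weight (plug z.1 z.2) * f z else 0))) -tot_sum; last first.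
    by move=> h z'; case: ifP => // _; rewrite mule_ge0.
  apply: eq_tot => z; rewrite /sml; case: ltnP => zH.
    rewrite mul1e (bigD1_seq (size z.1)) ?iota_uniq ?mem_index_iota//= eqxx big1 ?adde0// => h.
    by rewrite eq_sym => /negbTE ->.
  rewrite mul0e mule0 big_seq big1// => h; rewrite mem_index_iota => hH.
  by case: eqP => // zh; move: zH; rewrite zh leqNgt; case/andP: hH => _ ->.
rewrite selE; last by move=> z; rewrite lee_fin.
rewrite tot_marked//; last by move=> z; rewrite mule_ge0// lee_fin.
apply: (@le_trans _ _ (tot (fun t => weight t * (minn (nvert t) M)%:R%:E +
   weight t * \sum_(z <- zippers t) (sml z * (far (mark_disp z.1))%:R%:E)))).
  apply: le_tot => t; rewrite -ge0_muleDr; last 2 first.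
  - by rewrite lee_fin.
  - by apply: sume_ge0 => z _; rewrite mule_ge0// lee_fin.
  apply: lee_wpmul2l => //.
  have smlE (p : pred (zipper (V := V))) : \sum_(z <- zippers t) (sml z * (p z)%:R%:E) =
      (count [pred z | (size z.1 < H)%N & p z] (zippers t))%:R%:E.
    rewrite -sum_count; apply: eq_bigr => z _ /=.
    by rewrite /sml -EFinM -natrM mulnb.
  rewrite (smlE (fun z => 0%R \notin later z)) (smlE (fun z => far (mark_disp z.1))).
  rewrite -EFinD lee_fin -natrD ler_nat.
  pose p z := (0%R \notin later z) && ~~ far (mark_disp z.1).
  apply: (@leq_trans (count p (zippers t) + count [pred z | (size z.1 < H)%N & far (mark_disp z.1)] (zippers t))).
    rewrite -count_predUI; apply: leq_trans (leq_addr _ _).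
    apply: sub_count => z /= /andP[zH z0]; rewrite /p z0 zH.
    by case: (far _); rewrite ?orbT.
  rewrite leq_add2r leq_min -{1}size_zippers count_size /=.
  rewrite -size_filter -(size_map (fun z => mark_disp z.1)).
  apply: near_count.
    apply: (@subseq_uniq _ _ (undup (disp t))); last exact: undup_uniq.
    rewrite -last_visits; apply: map_subseq.
    rewrite (_ : seq.filter p _ = seq.filter (fun z => ~~ far (mark_disp z.1))
      (seq.filter (fun z => 0%R \notin later z) (zippers t))).
      exact: filter_subseq.
    by rewrite -filter_predI; apply: eq_filter => z; rewrite /p /= andbC.
  by apply/allP => x /mapP[z]; rewrite mem_filter => /andP[/andP[_ zf] _] ->.
rewrite totD; last 2 first.
- by move=> t; rewrite mule_ge0// lee_fin.
- by move=> t; rewrite mule_ge0// sume_ge0// => z _; rewrite mule_ge0// lee_fin.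
apply: leeD => //.
rewrite -tot_marked//; last by move=> z; rewrite mule_ge0// lee_fin.
rewrite -selE; last by move=> z; rewrite lee_fin.
apply: (@le_trans _ _ (\sum_(h < H) ((H%:R / rr)%:E * sg))).
  apply: lee_sum => h _.
  have := @marked_far _ _ m th m_ge0 th_ge0 th_mass far N sg rr h (fun=> 1) N_ge0 N0 sg_ge0 _ rr_gt0 far_N N_drift.
  under eq_tot do rewrite mul1e.
  move=> /(_ (fun=> lee01)) /le_trans; apply.
  rewrite -[leRHS]mule1; apply: lee_pmul.
  - by rewrite mule_ge0// lee_fin divr_ge0// ltW.
  - exact: marked_mass_ge0.
  - by apply: lee_wpmul2r => //; rewrite lee_fin ler_pM2r ?invr_gt0// ler_nat ltnW.
  have -> : marked_mass h (fun=> 1) = phi 1 ^+ h * Fgen 1.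
    by rewrite -marked_mass_expr//; congr (marked_mass h _); apply/funext => k; rewrite expr1n.
  have phi0 : 0 <= phi 1 by exact: phi_ge0.
  rewrite -[leRHS]mule1; apply: lee_pmul => //.
  - exact: expe_ge0.
  - exact: Fgen_ge0.
  elim: (nat_of_ord h) => [|k IH]; first by rewrite expe0.
  by rewrite expeS -[leRHS]mule1; apply: lee_pmul => //; exact: expe_ge0.
have c0 : 0 <= (H%:R / rr)%:E * sg by rewrite mule_ge0// lee_fin divr_ge0// ltW.
rewrite -(big_mkord xpredT (fun=> (H%:R / rr)%:E * sg)) sum_const_ge0//.
by rewrite size_iota subn0 muleA -EFinM mulrA expr2.
Qed.

End range_bounds.


Section countable_sums.
Context {R : realType} {A : countType}.
Local Open Scope ereal_scope.

Lemma tot_pickle (f : A -> \bar R) : (forall a, 0 <= f a) ->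
  \sum_(0 <= n <oo) (if @pickle_inv A n is Some a then f a else 0) = tot f.
Proof.
move=> f0; rewrite -tot_nat; last by move=> n; case: pickle_inv.
transitivity (\esum_(n in range (@pickle A)) if @pickle_inv A n is Some a then f a else 0).
  rewrite [RHS]esum_mkcond; apply: eq_esum => n _; case: ifPn => // /negP nA.
  have := @pickle_invK A n; case: (@pickle_inv A n) => [a|] //= an.
  by exfalso; apply: nA; rewrite inE -an; exists a.
rewrite esum_image; last by move=> a b _ _; exact: (pcan_inj (@pickleK A)).
by apply: eq_esum => a _; rewrite pickleK_inv.
Qed.

Lemma pickle_fibers (T : Type) (E : A -> set T) :
  (forall a b, E a `&` E b !=set0 -> a = b) ->
  trivIset setT (fun n => if @pickle_inv A n is Some a then E a else set0).
Proof.
move=> dE; apply/trivIsetP => i j _ _ ij.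
have := @pickle_invK A i; have := @pickle_invK A j.
case: (@pickle_inv A i) => [a|] /=; last by rewrite set0I.
case: (@pickle_inv A j) => [b|] /=; last by rewrite setI0.
move=> bj ai; apply/eqP; apply/negPn/negP => /set0P/dE ab.
by move: ij; rewrite -ai -bj ab eqxx.
Qed.

End countable_sums.

Section measure_sums.
Context {R : realType} {d0 : measure_display} {T : measurableType d0}.
Context (P : {measure set T -> \bar R}).
Local Open Scope ereal_scope.

Lemma measure_tot (A : countType) (Q : pred A) (E : A -> set T) :
  (forall a, measurable (E a)) ->
  (forall a b, Q a -> Q b -> E a `&` E b !=set0 -> a = b) ->
  measurable (\bigcup_(a in [set a | Q a]) E a) /\
  P (\bigcup_(a in [set a | Q a]) E a) = tot (fun a => if Q a then P (E a) else 0).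
Proof.
move=> mE dE.
pose F n := if @pickle_inv A n is Some a then if Q a then E a else set0 else set0.
have mF n : measurable (F n).
  by rewrite /F; case: pickle_inv => [a|]//; case: ifP.
have UF : \bigcup_(a in [set a | Q a]) E a = \bigcup_n F n.
  apply/seteqP; split => [x [a /= Qa Eax]|x [n _]].
    by exists (pickle a) => //; rewrite /F pickleK_inv Qa.
  rewrite /F; case: pickle_inv => [a|]//; case: ifP => // Qa Ex.
  by exists a.
rewrite UF; split; first exact: bigcup_measurable.
rewrite measure_bigcup//; last first.
  apply: (@pickle_fibers A T (fun a => if Q a then E a else set0)) => a b.
  by case: ifP => Qa; case: ifP => Qb [x [Ex Ex']] //; apply: dE => //; exists x.
rewrite (eq_eseriesl (Q := xpredT)); last by move=> n; rewrite in_setT.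
rewrite -tot_pickle; last by move=> a; case: ifP.
apply: eq_eseriesr => n _; rewrite /F; case: pickle_inv => [a|]; last exact: measure0.
by case: ifP => // _; exact: measure0.
Qed.

End measure_sums.

Section nat_sums.
Context {R : realType}.
Local Open Scope ereal_scope.

Lemma tot_natS (f : nat -> \bar R) : (forall k, 0 <= f k) ->
  tot f = f 0%N + tot (fun k => f k.+1).
Proof.
move=> f0; rewrite /tot (esumID [set 0%N])//= setTI esum_set1//; congr (_ + _).
rewrite setTI (_ : ~` [set 0%N] = S @` setT); last first.
  by apply/seteqP; split => [[|k]//= _|_ /= [k _ <-]//]; exists k.
by rewrite esum_image// => i j _ _ [].
Qed.

Lemma mass_tot (mu : probability nat R) : tot (fun k => mu [set k]) = 1.
Proof.
have [//|a b _ _ [x [/= -> ->]]//|_] := @measure_tot _ _ _ mu nat xpredT (fun k => [set k]).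
have -> : \bigcup_(a in [set _ | true]) [set a] = [set: nat].
  by apply/seteqP; split => // x _; exists x.
by move=> <-; exact: probability_setT.
Qed.

End nat_sums.

(** * The generating function of a critical offspring law *)

Section critical_offspring.
Context {R : realType} (mu : probability nat R).
Hypothesis mu_crit : critical mu.
Local Open Scope ereal_scope.

Definition offs (k : nat) : \bar R := mu [set k].

Lemma offs_ge0 k : 0 <= offs k. Proof. exact: measure_ge0. Qed.
Hint Resolve offs_ge0 : core.

Lemma offs_mass : tot offs = 1. Proof. exact: mass_tot. Qed.

Lemma offs_mean : tot (fun k => k%:R%:E * offs k) = 1.
Proof.
rewrite tot_nat; last by move=> k; rewrite mule_ge0// lee_fin.
by case: mu_crit.
Qed.

Definition gap (s : R) : R := (Gen mu (1 - s) - (1 - s))%R.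

(** The contribution to [gap] of the atom at [k], once the linear terms have been
    removed by criticality. *)
Definition gapk (k : nat) (s : R) : R := ((1 - s) ^+ k - 1 + k%:R * s)%R.

Lemma gapkS k s : gapk k.+1 s = (gapk k s + s * (1 - (1 - s) ^+ k))%R.
Proof. by rewrite /gapk exprS -natr1; ring. Qed.

Lemma gapk_ge0 k (s : R) : (0 <= s <= 1)%R -> (0 <= gapk k s)%R.
Proof.
move=> /andP[s0 s1]; elim: k => [|k IH]; first by rewrite /gapk expr0 mul0r addr0 subrr.
rewrite gapkS addr_ge0// mulr_ge0// subr_ge0 exprn_ile1//; lra.
Qed.

Lemma le_gapk k (s t : R) : (0 <= s)%R -> (s <= t)%R -> (t <= 1)%R ->
  (gapk k s <= gapk k t)%R.
Proof.
move=> s0 st t1; elim: k => [|k IH]; first by rewrite /gapk !expr0 !mul0r.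
rewrite !gapkS lerD// ler_pM//.
  by rewrite subr_ge0 exprn_ile1//; lra.
by rewrite lerB// lerXn2r// ?nnegrE; lra.
Qed.

(** Convexity of the generating function, term by term. *)
Lemma gapk_slope k (s : R) : (0 <= s <= 1)%R ->
  (gapk k.+1 s + s * (k.+1%:R * (1 - s) ^+ k) <= k.+1%:R * s)%R.
Proof.
move=> /andP[s0 s1]; elim: k => [|k IH]; first by rewrite /gapk expr1 expr0; lra.
rewrite gapkS; apply: (@le_trans _ _ ((gapk k.+1 s + s * (k.+1%:R * (1 - s) ^+ k)) + s)%R).
  have -> : (k.+2%:R = k.+1%:R + 1 :> R)%R by rewrite natr1.
  set p := (k.+1%:R)%R; have p0 : (0 <= p)%R by rewrite /p.
  rewrite (exprS _ k); set q := ((1 - s) ^+ k)%R.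
  have q0 : (0 <= q)%R by rewrite /q exprn_ge0//; lra.
  have : (0 <= s * p * (s * q))%R by rewrite !mulr_ge0.
  nra.
by rewrite -[(k.+2%:R)%R]natr1 mulrDl mul1r lerD2r.
Qed.

(** The mean being one, the gap is a sum of the nonnegative nondecreasing functions
    [gapk k]. *)
Lemma Gen_gap (s : R) : (0 <= s <= 1)%R ->
  genfun offs (1 - s)%:E = (1 - s + gap s)%:E /\
  tot (fun k => offs k * (gapk k s)%:E) = (gap s)%:E.
Proof.
move=> s01; have /andP[s0 s1] := s01.
have GE : Gen mu (1 - s) = fine (genfun offs (1 - s)%:E).
  rewrite /Gen /genfun tot_nat; last by move=> k; rewrite mule_ge0// expe_ge0// lee_fin subr_ge0.
  by congr fine; apply: eq_eseriesr => k _; rewrite EFin_expe.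
have Gk0 k : 0 <= offs k * (1 - s)%:E ^+ k by rewrite mule_ge0// expe_ge0// lee_fin subr_ge0.
have key : genfun offs (1 - s)%:E + s%:E = tot (fun k => offs k * (gapk k s)%:E) + 1.
  rewrite -offs_mass -[s%:E]mule1 -[X in _ * X]offs_mean -totZ//; last first.
    by move=> k; rewrite mule_ge0// lee_fin.
  rewrite /genfun -totD//; last by move=> k; rewrite !mule_ge0// lee_fin.
  rewrite -totD//; last by move=> k; rewrite mule_ge0// lee_fin gapk_ge0.
  apply: eq_tot => k.
  have -> : s%:E * (k%:R%:E * offs k) = offs k * (k%:R * s)%:E.
    by rewrite muleA -EFinM muleC mulrC.
  rewrite -[X in _ = _ + X]mule1 -ge0_muleDr ?lee_fin ?gapk_ge0//.
  rewrite -EFin_expe -ge0_muleDr ?lee_fin ?exprn_ge0 ?subr_ge0// ?mulr_ge0//.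
  - by rewrite -!EFinD /gapk; congr (_ * _%:E); ring.
  - exact: gapk_ge0.
  - by rewrite -EFin_expe lee_fin exprn_ge0// subr_ge0.
  - exact: mulr_ge0.
have Gle : genfun offs (1 - s)%:E <= 1.
  rewrite -offs_mass; apply: le_tot => k; rewrite -[leRHS]mule1; apply: lee_wpmul2l => //.
  by rewrite -EFin_expe lee_fin exprn_ile1//; lra.
have Gfin : genfun offs (1 - s)%:E \is a fin_num.
  by rewrite ge0_fin_numE ?tot_ge0// (le_lt_trans Gle)// ltry.
have G1 : genfun offs (1 - s)%:E = (1 - s + gap s)%:E.
  by rewrite /gap GE subrKC fineK.
split => //; move: key; rewrite G1 -EFinD => /(congr1 (fun x => x - 1)).
rewrite addeK// -EFinB => <-; congr _%:E; ring.
Qed.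

Lemma gap_ge0 (s : R) : (0 <= s <= 1)%R -> (0 <= gap s)%R.
Proof.
move=> s01; rewrite -lee_fin -(Gen_gap s01).2; apply: tot_ge0 => k.
by rewrite mule_ge0// lee_fin gapk_ge0.
Qed.

Lemma le_gap (s t : R) : (0 <= s)%R -> (s <= t)%R -> (t <= 1)%R -> (gap s <= gap t)%R.
Proof.
move=> s0 st t1; rewrite -lee_fin -(Gen_gap _).2 ?s0 ?(le_trans st)//.
rewrite -(Gen_gap _).2 ?t1 ?(le_trans s0)//.
by apply: le_tot => k; apply: lee_wpmul2l => //; rewrite lee_fin le_gapk.
Qed.

Lemma offs_mean' : tot (fun k => offs k.+1 * k.+1%:R%:E) = 1.
Proof.
rewrite -[RHS]offs_mean [RHS]tot_natS; last by move=> k; rewrite mule_ge0// lee_fin.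
by rewrite mul0e add0e; apply: eq_tot => k; rewrite muleC.
Qed.

Lemma genfun'_le1 (c : R) : (0 <= c <= 1)%R -> genfun' offs c%:E <= 1.
Proof.
move=> /andP[c0 c1]; rewrite -offs_mean'; apply: le_tot => k.
apply: lee_wpmul2l => //; rewrite -[leRHS]mule1; apply: lee_wpmul2l; first by rewrite lee_fin.
by rewrite -EFin_expe lee_fin exprn_ile1.
Qed.

(** The graph of the generating function lies above its tangent at [1 - s]; at [1]
    this reads as an upper bound on the slope. *)
Lemma gap_slope (s : R) : (0 <= s <= 1)%R ->
  (gap s)%:E + s%:E * genfun' offs (1 - s)%:E <= s%:E.
Proof.
move=> s01; have /andP[s0 s1] := s01.
rewrite -(Gen_gap s01).2 tot_natS; last by move=> k; rewrite mule_ge0// lee_fin gapk_ge0.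
rewrite {1}/gapk expr0 subrr add0r mul0r mule0 add0e.
have c0 k : 0 <= (1 - s)%:E ^+ k by rewrite expe_ge0// lee_fin subr_ge0.
rewrite -totZ ?lee_fin//; last first.
  by move=> k; rewrite !mule_ge0// lee_fin.
rewrite -totD; last 2 first.
- by move=> k; rewrite mule_ge0// lee_fin gapk_ge0.
- by move=> k; rewrite !mule_ge0// lee_fin.
rewrite -[leRHS]mule1 -offs_mean' -totZ ?lee_fin//; last first.
  by move=> k; rewrite mule_ge0// lee_fin.
apply: le_tot => k; rewrite !(muleCA s%:E) -ge0_muleDr; last 2 first.
- by rewrite lee_fin gapk_ge0.
- by rewrite !mule_ge0// lee_fin.
apply: lee_wpmul2l => //; rewrite -EFin_expe -!EFinM -EFinD lee_fin.
by rewrite [leRHS]mulrC mulrCA gapk_slope.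
Qed.

End critical_offspring.


(** * Power bounds from slow variation *)

(** Finitely many doublings bring any point of [(0, s0]] above [s0 / 2]. *)
Lemma halving_ind (R : realType) (P : R -> Prop) (s0 : R) : 0 < s0 ->
  (forall s, s0 / 2 <= s <= s0 -> P s) ->
  (forall s, 0 < s -> s * 2 <= s0 -> P (s * 2) -> P s) ->
  forall s, 0 < s <= s0 -> P s.
Proof.
move=> s0_gt0 base half s /andP[s_gt0 s_le].
have step k x : s0 / 2 ^+ k.+1 <= x -> 0 < x <= s0 -> P x.
  elim: k x => [|k IH] x xk /andP[x_gt0 x_le].
    by apply: base; rewrite expr1 in xk; rewrite xk.
  have [x2|x2] := leP (s0 / 2) x; first by apply: base; rewrite x2.
  apply: half => //; first lra.
  apply: IH; last by lra.
  have -> : s0 / 2 ^+ k.+1 = 2 * (s0 / 2 ^+ k.+2).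
    by rewrite [2 ^+ k.+2]exprS; field; rewrite expf_neq0 ?pnatr_eq0.
  by lra.
have [k kk] : exists k : nat, s0 / s < k%:R.
  by exists (Num.bound (s0 / s)); rewrite archi_boundP// divr_ge0// ltW.
apply: (step k); last by rewrite s_gt0.
rewrite ler_pdivrMr ?exprn_gt0//.
move: kk; rewrite ltr_pdivrMr// => /ltW/le_trans; apply.
rewrite mulrC ler_pM2l// -natrX ler_nat.
by apply: ltnW; apply: (ltn_trans (ltn_expl k (ltnSn 1))); rewrite ltn_exp2l.
Qed.

Section power_bounds.
Context {R : realType}.
Context (alpha : R) (g L : R -> R).
Hypothesis L_slow : slowly_varying L.
Hypothesis g_mono : forall s t, 0 <= s -> s <= t -> t <= 1 -> g s <= g t.
Hypothesis gE : forall s : R, 0 < s <= 1 -> g s = s `^ alpha * L s^-1.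

Lemma slow_ratio (del : R) : 0 < del -> exists2 s0 : R, 0 < s0 <= 1 &
  forall s, 0 < s <= s0 -> 0 < L s^-1 /\ `|L (2 * s^-1) / L s^-1 - 1| < del.
Proof.
move=> del0; have [[A [_ LA]] Lc] := L_slow.
have /cvgrPdist_lt/(_ _ del0)[M [Mreal HM]] := Lc 2 (ltr0n R 2).
pose X := Num.max 1 (Num.max A (M + 1)).
have X1 : 1 <= X by rewrite /X le_max lexx.
have X0 : 0 < X by apply: lt_le_trans X1.
exists X^-1; first by rewrite invr_gt0 X0 invf_le1.
move=> s /andP[s0 sX].
have Xs : X <= s^-1 by rewrite -[X]invrK lef_pV2// posrE invr_gt0.
split; first by apply: LA; apply: le_trans Xs; rewrite /X !le_max lexx orbT.
rewrite distrC; apply: HM; apply: lt_le_trans Xs.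
by rewrite /X !lt_max ltrDl ltr01 !orbT.
Qed.

(** Slow variation bounds the ratio [g (s / 2) / g s] by powers of two with
    exponents as close to [- alpha] as wanted. *)
Lemma half_ratio (eta : R) : 0 < eta -> exists2 s0 : R, 0 < s0 <= 1 &
  forall s, 0 < s <= s0 -> [/\ 0 < g s, 2 `^ (- (alpha + eta)) * g s <= g (s / 2) &
    g (s / 2) <= 2 `^ (- (alpha - eta)) * g s].
Proof.
move=> eta0; (* With this tolerance both [1 - del >= 2^-eta] and [1 + del <= 2^eta]. *)
pose del : R := 1 - 2 `^ (- eta).
have two0 : (2 : R) != 0 by rewrite pnatr_eq0.
have p1 : 2 `^ (- eta) < 1 :> R.
  rewrite powRN invf_lt1 ?powR_gt0//.
  have := @gt0_ltr_powR R eta eta0 1 2; rewrite !nnegrE powR1.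
  by apply; rewrite ?ler01 ?ler0n ?ltr1n.
have del0 : 0 < del by rewrite subr_gt0.
have pp : 2 `^ eta * 2 `^ (- eta) = 1 :> R.
  by rewrite powRN mulfV// gt_eqF// powR_gt0.
have del1 : 1 + del <= 2 `^ eta.
  have p0 : 0 < 2 `^ (- eta) :> R by rewrite powR_gt0.
  have q0 : 0 < 2 `^ eta :> R by rewrite powR_gt0.
  rewrite /del; move: pp p0 q0; set p := 2 `^ (- eta); set q := 2 `^ eta => pp p0 q0.
  have : 0 <= (q - 1) ^+ 2 * p by rewrite mulr_ge0 ?sqr_ge0// ltW.
  by nra.
have [s0 s01 Hs0] := slow_ratio del0; exists s0 => // s ss0.
have [Lpos Lr] := Hs0 _ ss0.
have /andP[s_gt0 s_le] := ss0; have /andP[s0_gt0 s0_le] := s01.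
have s1 : s <= 1 by apply: le_trans s0_le.
have gs : g s = s `^ alpha * L s^-1 by apply: gE; rewrite s_gt0.
have sa0 : 0 < s `^ alpha by rewrite powR_gt0.
have gpos : 0 < g s by rewrite gs mulr_gt0.
have gh : g (s / 2) = 2 `^ (- alpha) * g s * (L (2 * s^-1) / L s^-1).
  rewrite gE; last by rewrite divr_gt0//=; lra.
  have e2 : 2^-1 `^ alpha = 2 `^ (- alpha) :> R.
    by rewrite -mulN1r powRrM powR_inv1.
  rewrite gs invfM invrK [s^-1 * 2]mulrC powRM ?ltW ?invr_gt0// e2.
  by field; rewrite gt_eqF.
have a0 : 0 < 2 `^ (- alpha) * g s by rewrite mulr_gt0// powR_gt0.
move: Lr; rewrite ltr_norml => /andP[Lr1 Lr2].
split=> //; rewrite gh.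
- rewrite opprD powRD ?two0 ?implybT// mulrAC; apply: ler_wpM2l; first exact: ltW.
  by rewrite /del in Lr1; lra.
- rewrite opprB addrC powRD ?two0 ?implybT// [leRHS]mulrAC; apply: ler_wpM2l; first exact: ltW.
  lra.
Qed.

Lemma g_gt0 s : 0 < s -> s <= 1 -> 0 < g s.
Proof.
move=> s0 s1; have [s2 /andP[s20 _] H] := half_ratio ltr01.
have m0 : 0 < Num.min s s2 by rewrite lt_min s0.
apply: lt_le_trans (g_mono (ltW m0) _ s1); last by rewrite ge_min lexx.
by have [] := H (Num.min s s2); rewrite // m0 ge_min lexx orbT.
Qed.

Lemma double_powR (a c s : R) : 0 < s -> 2 `^ (- a) * (c * (s * 2) `^ a) = c * s `^ a.
Proof.
move=> s0; rewrite powRM ?ltW// powRN.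
by field; rewrite gt_eqF// powR_gt0.
Qed.

(** The bound on an octave propagates downwards by [half_ratio]. *)
Lemma power_lower (a : R) : alpha < a -> 0 < a -> exists c s0 : R, [/\ 0 < c, 0 < s0 <= 1 &
  forall s, 0 < s <= s0 -> c * s `^ a <= g s].
Proof.
move=> alpha_a a0; have [|s0 s01 Hs0] := @half_ratio (a - alpha); first by rewrite subr_gt0.
have /andP[s0_gt0 s0_le] := s01.
have gh0 : 0 < g (s0 / 2) by apply: g_gt0; lra.
pose c := g (s0 / 2) / s0 `^ a.
have c0 : 0 < c by rewrite divr_gt0// powR_gt0.
exists c, s0; split => //.
have base s : s0 / 2 <= s <= s0 -> c * s `^ a <= g s.
  move=> /andP[s1 s2]; apply: (@le_trans _ _ (g (s0 / 2))); last by apply: g_mono; lra.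
  rewrite /c -mulrA ger_pMr// mulrC ler_pdivrMr ?powR_gt0// mul1r.
  by apply: ge0_ler_powR; rewrite ?nnegrE; lra.
apply: halving_ind => // s s_gt0 s_le IH.
have s2s : 0 < s * 2 <= s0 by lra.
have [_ H _] := Hs0 _ s2s; move: H; rewrite mulfK ?pnatr_eq0// subrKC; apply: le_trans.
rewrite -(double_powR a c s_gt0); apply: ler_wpM2l => //; exact: powR_ge0.
Qed.

Lemma power_upper (a : R) : a < alpha -> 0 < a -> exists c s0 : R, [/\ 0 < c, 0 < s0 <= 1 &
  forall s, 0 < s <= s0 -> g s <= c * s `^ a].
Proof.
move=> alpha_a a0; have [|s0 s01 Hs0] := @half_ratio (alpha - a); first by rewrite subr_gt0.
have /andP[s0_gt0 s0_le] := s01.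
have gh0 : 0 < g s0 by apply: g_gt0; lra.
have h0 : 0 < s0 / 2 by lra.
pose c := g s0 / (s0 / 2) `^ a.
have c0 : 0 < c by rewrite divr_gt0// powR_gt0.
exists c, s0; split => //.
have base s : s0 / 2 <= s <= s0 -> g s <= c * s `^ a.
  move=> /andP[s1 s2]; apply: (@le_trans _ _ (g s0)); first by apply: g_mono; lra.
  rewrite /c -mulrA ler_pMr// mulrC ler_pdivlMr ?powR_gt0// mul1r.
  by apply: ge0_ler_powR; rewrite ?nnegrE; lra.
apply: halving_ind => // s s_gt0 s_le IH.
have s2s : 0 < s * 2 <= s0 by lra.
have [_ _ H] := Hs0 _ s2s; move: H; rewrite mulfK ?pnatr_eq0// subKr => /le_trans; apply.
rewrite -(double_powR a c s_gt0); apply: ler_wpM2l => //; exact: powR_ge0.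
Qed.

End power_bounds.


(** * Comparing powers, logarithms and exponentials along the integers *)

Section growth.
Context {R : realType}.

Lemma natV_small (p del : R) : 0 < p -> 0 < del ->
  \forall n \near \oo, n%:R `^ (- p) <= del.
Proof.
move=> p0 del0; near=> n.
have n0 : 0 < n%:R :> R by rewrite ltr0n; near: n; exact: nbhs_infty_gt.
rewrite powRN -[del]invrK lef_pV2 ?posrE ?powR_gt0 ?invr_gt0//.
have -> : del^-1 = (del^-1 `^ p^-1) `^ p by rewrite -powRrM mulVf ?gt_eqF// powRr1// invr_ge0 ltW.
apply: ge0_ler_powR; rewrite ?nnegrE ?powR_ge0 ?ltW//.
by near: n; exact: nbhs_infty_gtr.
Unshelve. all: end_near. Qed.

Lemma powR_gap (x a b : R) : 0 < x -> x `^ a = x `^ (a - b) * x `^ b.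
Proof. by move=> x0; rewrite -powRD ?subrK// (gt_eqF x0) implybT. Qed.

Lemma natV_cmp (C a b : R) : a < b -> 0 < C ->
  \forall n \near \oo, C * n%:R `^ a <= n%:R `^ b.
Proof.
move=> ab C0; near=> n.
have n0 : 0 < n%:R :> R by rewrite ltr0n; near: n; exact: nbhs_infty_gt.
rewrite (powR_gap a b n0) mulrA ger_pMl ?powR_gt0// -ler_pdivlMl// mulr1.
have -> : a - b = - (b - a) by rewrite opprB.
by near: n; apply: natV_small; rewrite ?subr_gt0 ?invr_gt0.
Unshelve. all: end_near. Qed.

Lemma ln_le_powR (s y : R) : 0 < s -> 0 < y -> ln y <= y `^ s / s.
Proof.
move=> s0 y0; rewrite ler_pdivlMr// mulrC.
have <- : ln (y `^ s) = s * ln y by rewrite ln_powR.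
have := @le_ln1Dx R (y `^ s - 1); rewrite subrKC => H.
apply: (le_trans (H _)); last by rewrite gerBl.
by rewrite ltrBrDr addrC subrr powR_gt0.
Qed.

Lemma truncn_infty (p : R) : 0 < p ->
  Num.truncn (n%:R `^ p : R) @[n --> \oo] --> \oo.
Proof.
move=> p0; apply/cvgnyPge => A; near=> n.
rewrite truncn_ge_nat ?powR_ge0//.
have n0 : 0 < n%:R :> R by rewrite ltr0n; near: n; exact: nbhs_infty_gt.
apply: (@le_trans _ _ ((A%:R + 1) * n%:R `^ 0)); first by rewrite powRr0 mulr1 lerDl.
by near: n; apply: natV_cmp => //; rewrite ltr_wpDl.
Unshelve. all: end_near. Qed.

Lemma truncn_itvP (x : R) : 1 <= x -> x / 2 <= (Num.truncn x)%:R <= x.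
Proof.
move=> x1; have x0 : 0 <= x by lra.
have /andP[t1 t2] := truncn_itv x0; rewrite t1 andbT.
have : (1 <= Num.truncn x)%N by rewrite truncn_ge_nat.
by rewrite -(ler_nat R); move: t2; rewrite -natr1; lra.
Qed.

Lemma powR_nat_ge1 (n : nat) (p : R) : (0 < n)%N -> 0 <= p -> 1 <= n%:R `^ p.
Proof.
move=> n0 p0; rewrite -[leLHS](powRr0 n%:R).
by apply: ler_powR => //; rewrite ler1n.
Qed.

Lemma powR_root (c s a e : R) : 0 < a -> e = a^-1 -> 0 <= s -> 0 <= c ->
  s `^ a <= c -> s <= c `^ e.
Proof.
move=> a0 -> s0 c0 sc; have -> : s = (s `^ a) `^ a^-1.
  by rewrite -powRrM mulfV ?gt_eqF// powRr1.
by apply: ge0_ler_powR; rewrite ?nnegrE ?invr_ge0 ?powR_ge0// ltW.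
Qed.

Lemma powR_root_ge (c s a e : R) : 0 < a -> e = a^-1 -> 0 <= s -> 0 <= c ->
  c <= s `^ a -> c `^ e <= s.
Proof.
move=> a0 -> s0 c0 sc; have -> : s = (s `^ a) `^ a^-1.
  by rewrite -powRrM mulfV ?gt_eqF// powRr1.
by apply: ge0_ler_powR; rewrite ?nnegrE ?invr_ge0 ?powR_ge0// ltW.
Qed.

Lemma powR_inv (x e : R) : 0 <= x -> x^-1 `^ e = x `^ (- e).
Proof. by move=> x0; rewrite -mulN1r powRrM powR_inv1. Qed.

Lemma powR_div (b x e : R) : 0 <= b -> 0 <= x -> (b / x) `^ e = b `^ e * x `^ (- e).
Proof. by move=> b0 x0; rewrite powRM ?invr_ge0// powR_inv. Qed.

End growth.

(** * Supermultiplicative sequences without long gaps *)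

Section supermultiplicative.
Context {R : realType}.
Context (a : nat -> R).
Hypothesis a_itv : forall n, 0 <= a n <= 1.
Hypothesis a_super : forall i j, a i * a j <= a (i + j)%N.
Hypothesis a_window : forall p : R, 0 < p -> p < 1 -> \forall x \near \oo,
  exists m, [/\ (m < x)%N, x%:R `^ p <= 2 * m%:R & x%:R `^ (- 2) <= a m].

Lemma a_posD i j : 0 < a i -> 0 < a j -> 0 < a (i + j)%N.
Proof. by move=> ai aj; apply: lt_le_trans (a_super i j); rewrite mulr_gt0. Qed.

Lemma a_posM i j : 0 < a i -> (0 < j)%N -> 0 < a (j * i)%N.
Proof.
move=> ai; case: j => // j _; elim: j => [|j IH]; first by rewrite mul1n.
by rewrite mulSn a_posD.
Qed.

Lemma a_exp i j k : a i ^+ k * a j <= a (k * i + j)%N.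
Proof.
elim: k => [|k IH]; first by rewrite expr0 mul1r.
rewrite exprS mulSn -mulrA -addnA; apply: le_trans (a_super _ _).
by apply: ler_wpM2l IH; case/andP: (a_itv i).
Qed.

(** The support is a semigroup, so up to finitely many elements it consists of the
    multiples of its smallest difference [g]. *)
Lemma a_support : exists g N0 : nat, [/\ (0 < g)%N,
  forall n, 0 < a n -> (g %| n)%N & forall n, (N0 <= n)%N -> (g %| n)%N -> 0 < a n].
Proof.
pose D d := `[< (0 < d)%N /\ exists b, [/\ (0 < b)%N, 0 < a b & 0 < a (b + d)%N] >].
have exD : exists d, D d.
  have h1 : 0 < 2^-1 :> R by lra.
  have h2 : 2^-1 < 1 :> R by lra.
  have [N _ HN] := a_window h1 h2.
  have [|m [_ xm am]] := HN (maxn N 1); first exact: leq_maxl.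
  have x1 : (0 < maxn N 1)%N by rewrite leq_max orbT.
  have m0 : (0 < m)%N.
    rewrite lt0n; apply/eqP => m0.
    by have := powR_nat_ge1 (R := R) x1 (ltW h1); rewrite m0 in xm; lra.
  have am0 : 0 < a m by apply: lt_le_trans am; rewrite powR_gt0// ltr0n.
  exists m; apply/asboolP; split => //; exists m; split => //; exact: a_posD.
have [g /asboolP[g0 [b [b0 ab abg]]] gmin] := ex_minnP exD.
have gdvd n : 0 < a n -> (g %| n)%N.
  move=> an; have rg := ltn_pmod n g0.
  rewrite /dvdn; apply/negPn/negP; rewrite -lt0n => r0.
  have : (g <= n %% g)%N.
    apply: gmin; apply/asboolP; split => //.
    exists ((n %/ g) * (b + g) + b)%N; split; first by rewrite addn_gt0 b0 orbT.
      have [->|q0] := posnP (n %/ g)%N; first by rewrite mul0n.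
      by apply: a_posD => //; exact: a_posM.
    have -> : ((n %/ g) * (b + g) + b + n %% g = n + ((n %/ g).+1 * b))%N.
      by rewrite {3}(divn_eq n g); lia.
    by apply: a_posD => //; exact: a_posM.
  by rewrite leqNgt rg.
(* A multiple [k * g] with [k = q * B + r], [b = B * g] and [r < B <= q] is the sum
   of [q - r] copies of [b] and [r] copies of [b + g]. *)
exists g, (g * (b * b))%N; split => // n nN gn.
have gb : (g %| b)%N by exact: gdvd.
pose B := (b %/ g)%N; have bE : b = (B * g)%N by rewrite /B divnK.
have B0 : (0 < B)%N by rewrite /B divn_gt0// dvdn_leq.
pose k := (n %/ g)%N; have nE : n = (k * g)%N by rewrite /k divnK.
have kB : (B * B <= k)%N.
  have : (b * b <= k)%N by rewrite -(leq_pmul2l g0) [(g * k)%N]mulnC -nE.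
  apply: leq_trans; rewrite bE -mulnA [(g * _)%N]mulnC -mulnA mulnA leq_pmulr//.
  by rewrite muln_gt0 g0.
have rB := ltn_pmod k B0; have kE := divn_eq k B.
have qB : (B <= k %/ B)%N by rewrite leq_divRL.
have -> : n = ((k %/ B - k %% B) * b + (k %% B) * (b + g))%N.
  have rq : (k %% B <= k %/ B)%N by apply: ltnW; exact: leq_trans rB qB.
  by rewrite mulnDr addnA -mulnDl subnK// {1}nE {1}kE bE mulnDl mulnA.
have q0 : (0 < k %/ B - k %% B)%N by rewrite subn_gt0; exact: leq_trans qB.
have [r0|r0] := posnP (k %% B)%N; first by rewrite {2}r0 mul0n addn0 a_posM.
by apply: a_posD; exact: a_posM.
Qed.

(** A large admissible [n] is filled up with few pieces of size almost [n], each of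
    value at least [n^-2], up to an admissible remainder of size at most [n / 2]. *)
Lemma a_step (eps : R) : 0 < eps -> exists x0 : nat, forall n, (x0 <= n)%N -> 0 < a n ->
  exists r : nat, [/\ (0 < r)%N, r%:R <= n%:R / 2 :> R, 0 < a r &
    expR (- ((1 - 2 `^ (- eps)) * n%:R `^ eps)) * a r <= a n].
Proof.
move=> eps0; have [g [N0 [g0 gdvd gsup]]] := a_support.
(* The pieces have size about [n^(1 - e)] and each costs [n^-2], so that the total
   cost has exponent [n^e * ln n], which is below [n^(2 e)]. *)
pose e := Num.min eps 1 / 4.
have e0 : 0 < e by rewrite divr_gt0// lt_min eps0 ltr01.
have e1 : e < 1 by rewrite /e ltr_pdivrMr// gt_min; apply/orP; right; lra.
have ee : 2 * e < eps.
  have : Num.min eps 1 <= eps by rewrite ge_min lexx.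
  rewrite /e; lra.
pose kap := 1 - 2 `^ (- eps) : R.
have kap0 : 0 < kap.
  rewrite subr_gt0 powRN invf_lt1 ?powR_gt0//.
  have := @gt0_ltr_powR R eps eps0 1 2; rewrite !nnegrE powR1.
  by apply; rewrite ?ler01 ?ler0n ?ltr1n.
pose p := 1 - e; have p0 : 0 < p by rewrite subr_gt0.
have p1 : p < 1 by rewrite gtrBl.
have [x1 _ Hx1] := a_window p0 p1.
have C0 : 0 < (2 * N0.+1%:R : R) by rewrite mulr_gt0// ltr0n.
have [x2 _ Hx2] := natV_cmp p0 C0.
have C1 : 0 < 64 / e by rewrite divr_gt0.
have C2 : 0 < 64 / e / kap by rewrite divr_gt0.
have [x3 _ Hx3] := natV_cmp ee C2.
exists (maxn 8 (maxn x3 (4 * (maxn x1 x2)))) => n.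
rewrite !geq_max => /andP[n8 /andP[nx3 n12]] an.
pose x := (n %/ 4)%N.
have xx : (maxn x1 x2 <= x)%N by rewrite /x leq_divRL// mulnC.
move: xx; rewrite geq_max => /andP[xx1 xx2].
have x2' : (2 <= x)%N by rewrite /x leq_divRL.
have x0 : (0 < x)%N by apply: leq_trans x2'.
have x0' : 0 < x%:R :> R by rewrite ltr0n.
have [m [mx xm am]] := Hx1 x xx1.
have mN : (N0 < m)%N.
  have := Hx2 x xx2; rewrite powRr0 mulr1 => /le_trans/(_ xm).
  by rewrite ler_pM2l// ler_nat.
have m0 : (0 < m)%N by apply: leq_ltn_trans mN.
have m0' : 0 < m%:R :> R by rewrite ltr0n.
have am0 : 0 < a m by apply: lt_le_trans am; rewrite powR_gt0.
have n0' : 0 < n%:R :> R by rewrite ltr0n; apply: leq_trans n8.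
have xn : (x * 4 <= n)%N by rewrite /x leq_divM.
have nx : (n < x * 8)%N.
  apply: (@leq_trans (x.+1 * 4)%N); first by rewrite ltn_ceil.
  by move: x2'; clear; lia.
have m4 : (m * 4 <= n)%N by apply: leq_trans xn; rewrite leq_mul2r (ltnW mx).
have k1 : (1 <= n %/ m)%N by rewrite divn_gt0//; apply: leq_trans m4; rewrite leq_pmulr.
pose k := (n %/ m).-1.
pose r := (n %% m + m)%N.
have nE : n = (k * m + r)%N.
  by rewrite /k /r addnCA [(_ * m + m)%N]addnC -mulSn prednK// addnC -divn_eq.
have rm := ltn_pmod n m0.
have gr : (g %| r)%N.
  have gn := gdvd _ an; have gm := gdvd _ am0.
  by rewrite nE dvdn_addr// in gn; rewrite dvdn_mull.
exists r; split.
- by rewrite /r addn_gt0 m0 orbT.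
- rewrite ler_pdivlMr// -natrM ler_nat /r; apply: leq_trans m4.
  by move: rm; clear; lia.
- by apply: gsup => //; rewrite /r (leq_trans (ltnW mN))// leq_addl.
rewrite [X in _ <= a X]nE; apply: le_trans (a_exp _ _ _).
apply: ler_wpM2r; first by case/andP: (a_itv r).
apply: (@le_trans _ _ ((n%:R `^ (- 2)) ^+ k)); last first.
  apply: lerXn2r; rewrite ?nnegrE ?powR_ge0 ?(ltW am0)//.
  apply: le_trans am; rewrite !powRN lef_pV2 ?posrE ?powR_gt0//.
  by apply: ge0_ler_powR; rewrite ?nnegrE ?ler_nat// (leq_trans _ xn)// leq_pmulr.
rewrite -powR_mulrn ?powR_ge0// -powRrM.
have -> : n%:R `^ (- 2 * k%:R) = expR (- (2 * k%:R * ln n%:R)) :> R.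
  by rewrite /powR (gt_eqF n0') -!mulNr.
rewrite ler_expR lerN2.
have mlow : n%:R `^ p <= 16 * m%:R.
  apply: (@le_trans _ _ (8 * x%:R `^ p)); last by lra.
  apply: (@le_trans _ _ ((8 * x%:R) `^ p)).
    by apply: ge0_ler_powR; rewrite ?nnegrE ?(ltW p0) ?mulr_ge0// -natrM ler_nat mulnC ltnW.
  rewrite powRM//; apply: ler_wpM2r; first exact: powR_ge0.
  by rewrite -[leRHS]powRr1//; apply: ler_powR => //; [lra|exact: ltW].
have kle : k%:R <= n%:R / m%:R :> R.
  by rewrite ler_pdivlMr// -natrM ler_nat [leqRHS]nE leq_addr.
have lnn : ln n%:R <= n%:R `^ e / e by exact: ln_le_powR.
have ln0 : 0 <= ln n%:R :> R by rewrite ln_ge0// ler1n (leq_trans _ n8).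
have nm : n%:R / m%:R <= 16 * n%:R `^ e.
  rewrite ler_pdivrMr//.
  have nn : n%:R = n%:R `^ e * n%:R `^ p :> R.
    by rewrite -powRD ?(gt_eqF n0') ?implybT// /p subrKC powRr1// ltW.
  rewrite {1}nn mulrAC [leLHS]mulrC; apply: ler_wpM2r => //; exact: powR_ge0.
have H3 := Hx3 n nx3.
apply: (@le_trans _ _ (2 * (16 * n%:R `^ e) * (n%:R `^ e / e))).
  by apply: ler_pM => //; apply: ler_wpM2l => //; exact: le_trans nm.
have -> : 2 * (16 * n%:R `^ e) * (n%:R `^ e / e) = 32 / e * n%:R `^ (2 * e).
  have -> : 2 * e = e + e by ring.
  rewrite powRD ?(gt_eqF n0') ?implybT//; field; exact: lt0r_neq0.
rewrite -/kap -ler_pdivrMl//; apply: le_trans H3.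
rewrite mulrA [kap^-1 * _]mulrC; apply: ler_wpM2r; first exact: powR_ge0.
by rewrite ler_pM2r ?invr_gt0// ler_pM2r ?invr_gt0//; lra.
Qed.

(** Iterating [a_step]: since the remainder is at most [n / 2], the costs of the
    successive steps add up to a geometric series, which is what the factor
    [1 - 2^-eps] accounts for. *)
Lemma a_lower0 (eps : R) : 0 < eps -> exists C : R, forall n, (0 < n)%N -> 0 < a n ->
  expR (- (C * n%:R `^ eps)) <= a n.
Proof.
move=> eps0; have [x0 Hx0] := a_step eps0.
pose C := 1 + \sum_(i < x0) `|ln (a i)|.
have C1 : 1 <= C by rewrite lerDl sumr_ge0.
exists C => n; elim/ltn_ind: n => n IH n0 an.
have n0' : 0 < n%:R :> R by rewrite ltr0n.
have [nx|xn] := ltnP n x0.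
  rewrite -[leRHS]lnK ?posrE// ler_expR.
  have : `|ln (a n)| <= C.
    rewrite /C (bigD1 (Ordinal nx))//= addrCA lerDl addr_ge0// sumr_ge0//.
  have := powR_nat_ge1 (R := R) n0 (ltW eps0).
  have := ler_norm (- ln (a n)); rewrite normrN.
  set y := `|_|; set q := _ `^ _ => h1 h2 h3; nra.
have [r [r0 rn ar Har]] := Hx0 n xn an.
have rn' : (r < n)%N.
  by rewrite -(ltr_nat R); apply: (le_lt_trans rn); lra.
apply: le_trans Har.
apply: (@le_trans _ _ (expR (- ((1 - 2 `^ (- eps)) * n%:R `^ eps)) * expR (- (C * r%:R `^ eps)))); last first.
  by apply: ler_wpM2l (IH _ rn' r0 ar); exact: expR_ge0.
rewrite -expRD ler_expR.
have rq : r%:R `^ eps <= 2 `^ (- eps) * n%:R `^ eps.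
  apply: (@le_trans _ _ ((n%:R / 2) `^ eps)).
    by apply: ge0_ler_powR; rewrite ?nnegrE ?divr_ge0 ?(ltW eps0).
  by rewrite powR_div// mulrC.
have : 0 <= n%:R `^ eps :> R by exact: powR_ge0.
have : 0 <= r%:R `^ eps :> R by exact: powR_ge0.
have : 2 `^ (- eps) <= 1 :> R.
  rewrite -[leRHS](powRr0 2); apply: ler_powR; first by rewrite ler1n.
  by rewrite oppr_le0 ltW.
move: rq; set t := 2 `^ _; set q := n%:R `^ _; set q' := r%:R `^ _ => h1 h2 h3 h4.
have C0 : 0 <= C by apply: le_trans C1.
have h5 : 0 <= (C - 1) * ((1 - t) * q) by rewrite !mulr_ge0// subr_ge0.
have h6 : C * q' <= C * (t * q) by exact: ler_wpM2l.
lra.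
Qed.

(** Halving the exponent in [a_lower0] absorbs its constant. *)
Lemma a_lower (eps : R) : 0 < eps ->
  \forall n \near \oo, 0 < a n -> expR (- n%:R `^ eps) <= a n.
Proof.
move=> eps0; have e20 : 0 < eps / 2 by rewrite divr_gt0.
have [C HC] := a_lower0 e20.
near=> n => an; have n0 : (0 < n)%N by near: n; exact: nbhs_infty_gt.
apply: le_trans (HC n n0 an); rewrite ler_expR lerN2.
apply: (@le_trans _ _ ((`|C| + 1) * n%:R `^ (eps / 2))).
  apply: ler_wpM2r; first exact: powR_ge0.
  by apply: (le_trans (ler_norm C)); rewrite lerDl.
by near: n; apply: natV_cmp; [lra|rewrite ltr_wpDl].
Unshelve. all: end_near. Qed.

End supermultiplicative.


(** * The size of a critical tree *)

Section truncated_powers.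
Context {R : realType}.

Lemma onem_expr_le (x : R) n : 0 <= x <= 1 -> 1 - (1 - x) ^+ n <= n%:R * x.
Proof.
move=> /andP[x0 x1]; elim: n => [|n IH]; first by rewrite expr0 mul0r subrr.
rewrite exprS -natr1.
have : 0 <= (1 - x) ^+ n by rewrite exprn_ge0//; lra.
have : (1 - x) ^+ n <= 1 by rewrite exprn_ile1//; lra.
by set q := _ ^+ n in IH *; nra.
Qed.

Lemma onem_expr_ge (x : R) n : 0 <= x <= 1 ->
  Num.min (n%:R * x) 1 <= 2 * (1 - (1 - x) ^+ n).
Proof.
move=> /andP[x0 x1].
have H : (1 - x) ^+ n * (1 + n%:R * x) <= 1.
  elim: n => [|n IH]; first by rewrite expr0 mul0r addr0 mulr1.
  rewrite exprS -natr1.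
  have : 0 <= (1 - x) ^+ n by rewrite exprn_ge0//; lra.
  have : 0 <= n%:R :> R by [].
  set q := _ ^+ n in IH *; set k := n%:R in IH *; move=> k0 q0.
  have : 0 <= q * (x * x * (1 + k)) by rewrite !mulr_ge0//; lra.
  nra.
have : 0 <= n%:R * x by rewrite mulr_ge0.
have : 0 <= (1 - x) ^+ n by rewrite exprn_ge0//; lra.
set q := _ ^+ n in H *; set k := n%:R * x in H *; move=> q0 k0.
by have [k1|k1] := leP k 1; nra.
Qed.

Lemma powRN1_N2 (x : R) : 0 < x -> x `^ (- 1) = x `^ (- 2) * x.
Proof.
move=> x0; rewrite powR_inv1 ?ltW// powRN powR_mulrn ?ltW// expr2 invfM -mulrA.
by rewrite mulVf ?mulr1// gt_eqF.
Qed.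

End truncated_powers.

Section tree_size.
Context {R : realType} {V : countZmodType}.
Context (alpha : R) (mu : probability nat R) (th : V -> \bar R).
Hypothesis alpha_itv : 1 < alpha <= 2.
Hypothesis mu_crit : critical mu.
Hypothesis mu_dom : in_dom alpha mu.
Hypothesis th_ge0 : forall x, (0 <= th x)%E.
Hypothesis th_mass : tot th = 1%E.

Local Notation m := (offs mu).
Local Notation weight := (weight m th).
Local Notation Fgen := (Fgen m th).
Local Notation phi := (phi m th).
Local Notation size_mass := (size_mass m th).

Let m_ge0 k : (0 <= m k)%E. Proof. exact: offs_ge0. Qed.
Let w_ge0 t : (0 <= weight t)%E. Proof. exact: weight_ge0. Qed.
Hint Resolve m_ge0 w_ge0 : core.

(** [Fgen] as a real number, which makes sense on the unit interval. *)
Definition FR (z : R) : R := fine (Fgen z).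

Lemma FRE z : 0 <= z <= 1 -> Fgen z = (FR z)%:E.
Proof.
move=> z01; have /andP[z0 z1] := z01.
rewrite fineK// ge0_fin_numE ?Fgen_ge0//.
by apply: le_lt_trans (Fgen_le1 m_ge0 th_ge0 th_mass (offs_mass mu) z01) _; rewrite ltry.
Qed.

Lemma FR_itv z : 0 <= z <= 1 -> 0 <= FR z <= 1.
Proof.
move=> z01; have /andP[z0 z1] := z01.
rewrite -!lee_fin -FRE// Fgen_ge0//=.
exact: (Fgen_le1 m_ge0 th_ge0 th_mass (offs_mass mu)).
Qed.

(** The equation [F = z G(F)] of the total progeny, read at [1 - F]. *)
Lemma gap_FR z : 0 <= z <= 1 -> gap mu (1 - FR z) * z = FR z * (1 - z).
Proof.
move=> z01; have /andP[z0 z1] := z01.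
have := @Fgen_eq _ _ m th m_ge0 th_ge0 th_mass z z0.
have y01 : 0 <= 1 - FR z <= 1 by have := FR_itv z01; lra.
have [] := Gen_gap mu_crit y01; rewrite subKr -FRE// => -> _.
rewrite {1}FRE// -EFinM => -[]; lra.
Qed.

Lemma gap_mono s t : 0 <= s -> s <= t -> t <= 1 -> gap mu s <= gap mu t.
Proof. exact: le_gap. Qed.

Lemma gap_pos s : 0 < s -> s <= 1 -> 0 < gap mu s.
Proof.
have [L L_slow LE] := mu_dom.
apply: (@g_gt0 _ alpha (gap mu) L) => //; exact: gap_mono.
Qed.

(** A critical tree is almost surely finite: the gap does not vanish on [(0, 1]]. *)
Lemma FR1 : FR 1 = 1.
Proof.
have i1 : 0 <= (1 : R) <= 1 by rewrite ler01 lexx.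
have := gap_FR i1; rewrite subrr mulr0 mulr1 => g0.
have /andP[F0 F1] := FR_itv i1.
apply/eqP; rewrite eq_le F1 leNgt; apply/negP => FR_lt.
have : 0 < gap mu (1 - FR 1) by apply: gap_pos; lra.
by rewrite g0 ltxx.
Qed.

Lemma weight_mass : tot weight = 1%E.
Proof.
rewrite -[RHS]/(1%:E) -FR1 -FRE ?ler01 ?lexx//; apply: eq_tot => t.
by rewrite expr1n mule1.
Qed.

Lemma phi_le1 z : 0 <= z <= 1 -> (phi z <= 1)%E.
Proof.
move=> z01; have /andP[z0 z1] := z01.
rewrite /phi FRE// -[leRHS]mule1; apply: lee_pmul => //.
  by apply: tot_ge0 => k; rewrite !mule_ge0 ?lee_fin// expe_ge0// lee_fin; case/andP: (FR_itv z01).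
by apply: genfun'_le1 => //; exact: FR_itv.
Qed.

(** The defect [1 - E z^|T|] at [z = 1 - 1/w]: up to constants, the expectation
    of the size truncated at [w], divided by [w]. *)
Definition defect (w : nat) : R := 1 - FR (1 - w%:R^-1).

Lemma inv_nat_itv (w : nat) : (0 < w)%N -> 0 <= (1 - w%:R^-1 : R) <= 1.
Proof.
move=> w0; have w0' : 0 < w%:R :> R by rewrite ltr0n.
by rewrite subr_ge0 invf_le1// ler1n w0 /= gerBl invr_ge0 ltW.
Qed.

Lemma defect_itv w : (0 < w)%N -> 0 <= defect w <= 1.
Proof. by move=> /inv_nat_itv/FR_itv; rewrite /defect; lra. Qed.

Lemma gap_defect w : (0 < w)%N -> gap mu (defect w) * (w%:R - 1) = 1 - defect w.
Proof.
move=> w0; have w0' : (w%:R : R) != 0 by rewrite pnatr_eq0 -lt0n.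
have := gap_FR (inv_nat_itv w0); rewrite -/(defect w) subKr.
rewrite /defect subKr => /(congr1 (fun x => x * w%:R)).
have e : (1 - w%:R^-1) * w%:R = w%:R - 1 :> R by rewrite mulrBl mul1r mulVf.
by rewrite divfK// -mulrA e.
Qed.

Lemma defect_small (s0 : R) : 0 < s0 -> \forall w \near \oo, defect w <= s0.
Proof.
move=> s00; have [s1|/ltW s1] := leP s0 1; last first.
  exists 1%N => // w /= w0; have /andP[_ /le_trans] := defect_itv w0; exact.
have gs := gap_pos s00 s1.
near=> w.
have w0 : (0 < w)%N by near: w; exact: nbhs_infty_gt.
have /andP[d0 d1] := defect_itv w0.
rewrite leNgt; apply/negP => sd.
have gd : gap mu s0 <= gap mu (defect w) by apply: gap_mono => //; exact: ltW.
have := gap_defect w0.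
have : (gap mu s0)^-1 + 1 < w%:R by near: w; exact: nbhs_infty_gtr.
rewrite -ltrBrDr => wbig.
have : 1 < gap mu s0 * (w%:R - 1) by rewrite mulrC -ltr_pdivrMr// div1r.
have : gap mu s0 * (w%:R - 1) <= gap mu (defect w) * (w%:R - 1).
  by apply: ler_wpM2r => //; rewrite subr_ge0 ler1n.
lra.
Unshelve. all: end_near. Qed.

Lemma defect_gt0 w : (0 < w)%N -> 0 < defect w.
Proof.
move=> w0; have /andP[d0 d1] := defect_itv w0.
rewrite lt_def d0 andbT; apply/eqP => de.
have := gap_defect w0; rewrite de subr0.
have -> : gap mu 0 = 0.
  apply/eqP; rewrite eq_le gap_ge0 ?lexx ?ler01// andbT.
  have := gap_FR (_ : 0 <= 1 <= (1 : R)); rewrite FR1 !subrr mulr1 mulr0 => ->//.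
  by rewrite ler01 lexx.
by rewrite mul0r => /eqP; rewrite eq_sym oner_eq0.
Qed.

(** By [gap_defect] the gap of the defect is of order [1 / w], and the power bounds
    on the gap can be inverted. *)
Lemma defect_upper (e : R) : 0 < e -> e < alpha^-1 ->
  exists2 C : R, 0 < C & \forall w \near \oo, defect w <= C * w%:R `^ (- e).
Proof.
move=> e0 e_lt; have [L L_slow LE] := mu_dom.
have alpha0 : 0 < alpha by case/andP: alpha_itv => /(lt_trans ltr01).
have a_gt : alpha < e^-1 by rewrite -[alpha]invrK ltf_pV2// posrE invr_gt0.
have eV0 : 0 < e^-1 by rewrite invr_gt0.
have [c [s0 [c0 /andP[s00 s01] Hc]]] := power_lower L_slow gap_mono LE a_gt eV0.
exists ((2 / c) `^ e); first by rewrite powR_gt0// divr_gt0.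
near=> w.
have w2 : (2 <= w)%N by near: w; exact: nbhs_infty_ge.
have w0 : (0 < w)%N by apply: leq_trans w2.
have w0' : 0 < w%:R :> R by rewrite ltr0n.
have ds : defect w <= s0 by near: w; exact: defect_small.
have d0 := defect_gt0 w0.
have : c * defect w `^ e^-1 <= gap mu (defect w) by apply: Hc; rewrite d0.
have gd := gap_defect w0.
have w2' : 2 <= w%:R :> R by rewrite ler_nat.
have gle : gap mu (defect w) <= 2 / w%:R.
  rewrite ler_pdivlMr//.
  have : 0 <= gap mu (defect w) by apply: gap_ge0 => //; exact: defect_itv.
  nra.
move=> /le_trans/(_ gle); rewrite mulrC -ler_pdivlMr// => H.
rewrite -powR_div ?divr_ge0 ?(ltW c0)//.
apply: (powR_root eV0); rewrite ?invrK ?divr_ge0 ?(ltW c0) ?(ltW d0)//.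
by rewrite mulrAC.
Unshelve. all: end_near. Qed.

Lemma defect_lower (e : R) : alpha^-1 < e ->
  exists2 c : R, 0 < c & \forall w \near \oo, c * w%:R `^ (- e) <= defect w.
Proof.
move=> e_gt; have [L L_slow LE] := mu_dom.
have alpha0 : 0 < alpha by case/andP: alpha_itv => /(lt_trans ltr01).
have e0 : 0 < e by apply: lt_trans e_gt; rewrite invr_gt0.
have a_lt : e^-1 < alpha by rewrite -[alpha]invrK ltf_pV2// posrE invr_gt0.
have eV0 : 0 < e^-1 by rewrite invr_gt0.
have [c [s0 [c0 /andP[s00 s01] Hc]]] := power_upper L_slow gap_mono LE a_lt eV0.
have c20 : 0 < (2 * c)^-1 by rewrite invr_gt0 mulr_gt0.
exists ((2 * c)^-1 `^ e); first by rewrite powR_gt0.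
near=> w.
have w2 : (2 <= w)%N by near: w; exact: nbhs_infty_ge.
have w0 : (0 < w)%N by apply: leq_trans w2.
have w0' : 0 < w%:R :> R by rewrite ltr0n.
have ds : defect w <= s0 by near: w; exact: defect_small.
have dh : defect w <= 2^-1 by near: w; apply: defect_small; rewrite invr_gt0.
have d0 := defect_gt0 w0.
have : gap mu (defect w) <= c * defect w `^ e^-1 by apply: Hc; rewrite d0.
have gd := gap_defect w0.
have w2' : 2 <= w%:R :> R by rewrite ler_nat.
have gge : 2^-1 / w%:R <= gap mu (defect w).
  rewrite ler_pdivrMr//.
  have : 0 <= gap mu (defect w) by apply: gap_ge0 => //; exact: defect_itv.
  nra.
move=> /(le_trans gge); rewrite -ler_pdivrMl// => H.
rewrite -powR_div ?(ltW c20)//.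
apply: (powR_root_ge eV0); rewrite ?invrK ?divr_ge0 ?(ltW c20) ?(ltW d0)//.
by rewrite invfM [2^-1 * _]mulrC -mulrA.
Unshelve. all: end_near. Qed.

(** By convexity [1 - phi] is at least the ratio of the gap to the defect, of order
    [1 / w] over [w^(- 1 / alpha)]. *)
Lemma phi_upper (k : R) : 1 - alpha^-1 < k -> k < 1 ->
  exists2 c : R, 0 < c & \forall w \near \oo,
    (phi (1 - w%:R^-1) <= (1 - c * w%:R `^ (- k))%:E)%E.
Proof.
move=> k_gt k1; have [||C C0 HC] := @defect_upper (1 - k); do ?lra.
have C20 : 0 < (2 * C)^-1 by rewrite invr_gt0 mulr_gt0.
exists (2 * C)^-1 => //; near=> w.
have w2 : (2 <= w)%N by near: w; exact: nbhs_infty_ge.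
have w0 : (0 < w)%N by apply: leq_trans w2.
have w0' : 0 < w%:R :> R by rewrite ltr0n.
have dh : defect w <= 2^-1 by near: w; apply: defect_small; rewrite invr_gt0.
have dC : defect w <= C * w%:R `^ (- (1 - k)) by near: w.
have d0 := defect_gt0 w0; have d01 := defect_itv w0.
have z01 := inv_nat_itv w0; have F01 := FR_itv z01.
have D1 : (genfun' m (FR (1 - w%:R^-1))%:E <= 1)%E by exact: genfun'_le1.
have D0 : (0 <= genfun' m (FR (1 - w%:R^-1))%:E)%E.
  by apply: tot_ge0 => j; rewrite !mule_ge0 ?lee_fin// expe_ge0// lee_fin; case/andP: F01.
rewrite /phi FRE//.
have := gap_slope mu_crit d01; rewrite {2}/defect subKr.
have Dfin : genfun' m (FR (1 - w%:R^-1))%:E \is a fin_num.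
  by rewrite ge0_fin_numE// (le_lt_trans D1)// ltry.
rewrite -(fineK Dfin); set D := fine _ in D0 D1 *.
have D0' : 0 <= D by rewrite /D fine_ge0.
rewrite -!EFinM -EFinD !lee_fin => slope.
have {}slope : gap mu (defect w) + defect w * D <= defect w := slope.
apply: (@le_trans _ _ D); first by apply: ler_piMl => //; case/andP: z01.
have gd := gap_defect w0.
have w2' : 2 <= w%:R :> R by rewrite ler_nat.
have gge : 2^-1 / w%:R <= gap mu (defect w).
  rewrite ler_pdivrMr//.
  have : 0 <= gap mu (defect w) by apply: gap_ge0.
  nra.
have q0 : 0 < C * w%:R `^ (- (1 - k)) by rewrite mulr_gt0// powR_gt0.
have D1' : D <= 1 by rewrite -lee_fin /D fineK.
have H : 2^-1 / w%:R <= C * w%:R `^ (- (1 - k)) * (1 - D).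
  apply: (le_trans gge); apply: (@le_trans _ _ (defect w * (1 - D))); first by lra.
  by apply: ler_wpM2r => //; rewrite subr_ge0.
suff : (2 * C)^-1 * w%:R `^ (- k) <= 1 - D by lra.
rewrite -(ler_pM2l q0); apply: le_trans H; rewrite le_eqVlt; apply/orP; left; apply/eqP.
have -> : w%:R^-1 = w%:R `^ (- (1 - k)) * w%:R `^ (- k) :> R.
  rewrite -powRD; last by rewrite (gt_eqF w0') implybT.
  have -> : - (1 - k) + - k = -1 by ring.
  by rewrite powR_inv1 ?ltW.
by field; rewrite gt_eqF.
Unshelve. all: end_near. Qed.

Local Open Scope ereal_scope.

Lemma EFin_expr_ge0 (z : R) k : (0 <= z)%R -> 0 <= (z ^+ k)%:E.
Proof. by move=> z0; rewrite lee_fin exprn_ge0. Qed.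

Lemma tot_defect (w : nat) : (0 < w)%N ->
  tot (fun t => weight t * (1 - (1 - w%:R^-1) ^+ nvert t)%:E) = (defect w)%:E.
Proof.
move=> w0; have z01 := inv_nat_itv w0; have /andP[z0 z1] := z01.
set z : R := (1 - w%:R^-1)%R in z01 z0 z1 *.
have zk k : (0 <= 1 - z ^+ k)%R by rewrite subr_ge0 exprn_ile1.
have : tot (fun t => weight t * (1 - z ^+ nvert t)%:E) + Fgen z = 1.
  rewrite -weight_mass /Fgen -totD; last 2 first.
  - by move=> t; rewrite mule_ge0// lee_fin.
  - by move=> t; rewrite mule_ge0// EFin_expr_ge0.
  apply: eq_tot => t; rewrite -ge0_muleDr ?lee_fin ?exprn_ge0//.
  by rewrite -EFinD subrK mule1.
rewrite FRE// => /(congr1 (fun x => x - (FR z)%:E)).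
by rewrite addeK// -EFinB.
Qed.

Lemma truncated_mean (w : nat) : (0 < w)%N ->
  tot (fun t => weight t * (minn (nvert t) w)%:R%:E) <= (2 * w%:R * defect w)%:E.
Proof.
move=> w0; rewrite EFinM -tot_defect// -totZ; last 2 first.
- by rewrite lee_fin mulr_ge0.
- move=> t; have /andP[z0 z1] := inv_nat_itv w0.
  by rewrite mule_ge0// lee_fin subr_ge0 exprn_ile1.
apply: le_tot => t; rewrite muleCA; apply: lee_wpmul2l => //.
have w0' : (0 < w%:R :> R)%R by rewrite ltr0n.
have wV : (0 <= (w%:R^-1 : R) <= 1)%R by rewrite invr_ge0 ltW//= invf_le1// ler1n.
have H := onem_expr_ge (nvert t) wV; rewrite -EFinM lee_fin.
rewrite mulrAC -[leRHS]mulrC -ler_pdivrMl//.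
apply: le_trans H; rewrite le_min; apply/andP; split.
  by rewrite mulrC ler_pM2r ?invr_gt0// ler_nat geq_minl.
by rewrite mulrC ler_pdivrMr// mul1r ler_nat geq_minr.
Qed.

Lemma defect_truncated (w : nat) : (0 < w)%N ->
  (w%:R * defect w)%:E <= tot (fun t => weight t * (minn (nvert t) w)%:R%:E).
Proof.
move=> w0; rewrite EFinM -tot_defect// -totZ; last 2 first.
- by rewrite lee_fin.
- move=> t; have /andP[z0 z1] := inv_nat_itv w0.
  by rewrite mule_ge0// lee_fin subr_ge0 exprn_ile1.
apply: le_tot => t; rewrite muleCA; apply: lee_wpmul2l => //.
have w0' : (0 < w%:R :> R)%R by rewrite ltr0n.
have wV : (0 <= (w%:R^-1 : R) <= 1)%R by rewrite invr_ge0 ltW//= invf_le1// ler1n.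
have H := onem_expr_le (nvert t) wV.
have /andP[z0 z1] := inv_nat_itv w0.
have zk : (0 <= (1 - w%:R^-1 : R) ^+ nvert t)%R by rewrite exprn_ge0.
rewrite -EFinM lee_fin -ler_pdivlMl//.
rewrite /minn; case: ifP => _; first by rewrite mulrC.
by rewrite mulVf ?gt_eqF// gerBl.
Qed.

Definition size_prob (n : nat) : R := fine (size_mass n).

Lemma size_mass_le1 n : size_mass n <= 1.
Proof. by rewrite -weight_mass; apply: le_tot => t; case: ifP. Qed.

Lemma size_probE n : size_mass n = (size_prob n)%:E.
Proof.
have s0 := @size_mass_ge0 _ _ m th m_ge0 th_ge0 n.
by rewrite fineK// ge0_fin_numE// (le_lt_trans (size_mass_le1 n))// ltry.
Qed.

Lemma size_prob_itv n : (0 <= size_prob n <= 1)%R.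
Proof. by rewrite -!lee_fin -size_probE size_mass_le1 size_mass_ge0. Qed.

(** The mass of the sizes in a window, from the growth of the truncated means. *)
Lemma window_mass (A w x : nat) : (0 < A)%N -> (0 < w)%N -> (0 < x)%N ->
  (defect w <= 2 * (A%:R / w%:R) * defect A + \sum_(A.+1 <= n < x.+1) size_prob n
     + 2 * defect x)%R.
Proof.
move=> A0 w0 x0.
have w0' : (0 < w%:R :> R)%R by rewrite ltr0n.
have x0' : (0 < x%:R :> R)%R by rewrite ltr0n.
pose b1 (t : ltree V) : \bar R := (minn (nvert t) A)%:R%:E.
pose b2 (t : ltree V) : \bar R := ((A < nvert t) && (nvert t < x.+1))%N%:R%:E.
pose b3 (t : ltree V) : \bar R := (minn (nvert t) x)%:R%:E.
have b10 t : 0 <= b1 t by rewrite lee_fin.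
have b20 t : 0 <= b2 t by rewrite lee_fin.
have b30 t : 0 <= b3 t by rewrite lee_fin.
have wx0 : 0 <= (w%:R / x%:R)%:E :> \bar R by rewrite lee_fin divr_ge0.
have H : tot (fun t => weight t * (minn (nvert t) w)%:R%:E) <=
    tot (fun t => weight t * b1 t) + w%:R%:E * tot (fun t => weight t * b2 t) +
    (w%:R / x%:R)%:E * tot (fun t => weight t * b3 t).
  rewrite -!totZ ?lee_fin//; do ?by move=> t; rewrite mule_ge0.
  rewrite -!totD; do ?by move=> t; rewrite ?adde_ge0// !mule_ge0.
  apply: le_tot => t; rewrite muleCA [X in _ + X]muleCA -!ge0_muleDr//; last 3 first.
  - by rewrite adde_ge0// mule_ge0.
  - by rewrite mule_ge0.
  - by rewrite mule_ge0.
  apply: lee_wpmul2l => //; rewrite /b1 /b2 /b3 -!EFinM -!EFinD lee_fin.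
  have c0 : (0 <= w%:R / x%:R * (minn (nvert t) x)%:R :> R)%R by rewrite mulr_ge0// divr_ge0.
  have mw : ((minn (nvert t) w)%:R <= w%:R :> R)%R by rewrite ler_nat geq_minr.
  have A00 : (0 <= A%:R :> R)%R by [].
  case: (boolP (A < nvert t)%N) => [An|]; rewrite ?andbF /=; last first.
    rewrite -leqNgt => nA; rewrite mulr0 addr0 (minn_idPl nA) -[leLHS]addr0 lerD//.
    by rewrite ler_nat geq_minl.
  rewrite (minn_idPr (ltnW An)).
  case: (boolP (nvert t < x.+1)%N) => [nx|]; first by rewrite mulr1; lra.
  rewrite -leqNgt => xn; rewrite mulr0 addr0 (minn_idPr (ltnW xn)) divfK ?gt_eqF//.
  lra.
have B2 : tot (fun t => weight t * b2 t) = (\sum_(A.+1 <= n < x.+1) size_prob n)%:E.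
  rewrite -sumEFin; under eq_bigr do rewrite -size_probE.
  rewrite /size_mass -tot_sum; last by move=> n t; case: ifP.
  apply: eq_tot => t; rewrite /b2.
  case: (boolP (nvert t \in index_iota A.+1 x.+1)) => tn.
    rewrite (bigD1_seq (nvert t)) ?iota_uniq//= eqxx big1 ?adde0; last first.
      by move=> n; rewrite eq_sym => /negbTE ->.
    by move: tn; rewrite mem_index_iota => ->; rewrite mule1.
  rewrite big_seq big1; last first.
    by move=> n nA; case: eqP => // tnn; rewrite tnn nA in tn.
  by move: tn; rewrite mem_index_iota => /negbTE ->; rewrite mule0.
have := le_trans (defect_truncated w0) H; rewrite B2.
have H1 := truncated_mean A0; have H3 := truncated_mean x0.
move=> /le_trans/(_ (leeD (leeD H1 (lexx _)) (lee_wpmul2l wx0 H3))).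
rewrite -!EFinM -!EFinD lee_fin -ler_pdivlMl// => /le_trans; apply.
rewrite le_eqVlt; apply/orP; left; apply/eqP.
by field; rewrite !gt_eqF.
Qed.

Local Close Scope ereal_scope.

(** [m 0 <= 1] is the weight of the leaf destroyed by grafting. *)
Lemma size_prob_super i j :
  size_prob i.+1 * size_prob j.+1 <= size_prob (i + j).+1.
Proof.
have := @size_mass_super _ _ (offs mu) th m_ge0 th_ge0 i j.
rewrite !size_probE => H.
rewrite -lee_fin EFinM; apply: (le_trans H).
rewrite -[leRHS]mul1e; apply: lee_wpmul2r.
  by rewrite lee_fin; case/andP: (size_prob_itv (i + j).+1).
by rewrite -(offs_mass mu); apply: tot_ge => k; exact: offs_ge0.
Qed.

(** In [window_mass] with [A = x^p] and [w = x^rho], [p < rho < 1], the defect of [w]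
    dominates the other two terms, hence the sizes between [A] and [x] have a mass of
    at least [1 / x] and one of them has probability at least [x^-2]. *)
Lemma size_window (p : R) : 0 < p -> p < 1 -> \forall x \near \oo,
  exists m, [/\ (m < x)%N, x%:R `^ p <= 2 * m%:R & x%:R `^ (- 2) <= size_prob m.+1].
Proof.
move=> p0 p1; have /andP[alpha1 alpha2] := alpha_itv.
have alpha0 : 0 < alpha by apply: lt_trans alpha1.
pose ia := alpha^-1.
have ia1 : ia < 1 by rewrite invf_lt1.
have ia2 : 2^-1 <= ia by rewrite lef_pV2 ?posrE.
(* [eta] is the loss in the exponents of the defect; it has to be small in
   comparison with both gaps in the inequalities [c1] and [c2]. *)
pose eta := (1 - p) * (1 - ia) / 16.
have eta0 : 0 < eta by rewrite divr_gt0// mulr_gt0 ?subr_gt0.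
pose rho := (1 + p) / 2.
have rho1 : rho < 1 by rewrite /rho; lra.
have rho0 : p < rho by rewrite /rho; lra.
pose e1 := ia - eta; pose e2 := ia + eta.
have etaE : eta * 16 = (1 - p) * (1 - ia) by rewrite divfK// pnatr_eq0.
have eta1 : eta * 16 <= 1 - ia by rewrite etaE ger_pMl ?subr_gt0//; lra.
have eta2 : eta * 16 <= 1 - p by rewrite etaE ger_pMr ?subr_gt0//; lra.
have rhoE : rho * 2 = 1 + p by rewrite divfK// pnatr_eq0.
have pe1 : p * eta < eta by rewrite gtr_pMl.
have re1 : rho * eta < eta by rewrite gtr_pMl.
have c1 : - rho + p * (1 - e1) < - (rho * e2).
  rewrite /e1 /e2; have -> : rho = (1 + p) / 2 by [].
  have -> : - ((1 + p) / 2) + p * (1 - (ia - eta)) =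
    - ((1 + p) / 2 * (ia + eta)) - ((1 - p) * (1 - ia) / 2 - p * eta - (1 + p) / 2 * eta).
    by field.
  rewrite -etaE -/rho; lra.
have c2 : - e1 < - (rho * e2).
  rewrite /e1 /e2 ltrN2.
  have : 0 <= (1 - p) * (ia - 2^-1) by rewrite mulr_ge0// subr_ge0// ltW.
  have -> : rho * (ia + eta) = ia - (1 - p) / 2 * ia + rho * eta by rewrite /rho; field.
  lra.
have e10 : 0 < e1 by rewrite /e1; lra.
have e11 : 0 <= 1 - e1 by rewrite /e1; lra.
have e2lt : rho * e2 < 1.
  have e20 : 0 < e2 by rewrite /e2; lra.
  have : rho * e2 < e2 by rewrite gtr_pMl.
  rewrite /e2; lra.
have [C C0 HC] := @defect_upper e1 e10 (ltac:(by rewrite /e1 gtrBl)).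
have [c c0 Hc] := @defect_lower e2 (ltac:(by rewrite /e2 ltrDl)).
have HA := @truncn_infty R p p0.
have Hw := @truncn_infty R rho (lt_trans p0 rho0).
have nA : \forall x \near \oo, (0 < Num.truncn (x%:R `^ p : R))%N.
  exact: (HA _ (nbhs_infty_gt 0)).
have nw : \forall x \near \oo, (0 < Num.truncn (x%:R `^ rho : R))%N.
  exact: (Hw _ (nbhs_infty_gt 0)).
have nHC := HA _ HC; have nHc := Hw _ Hc; rewrite !near_simpl in nHC nHc.
near=> x.
have x0 : (0 < x)%N by near: x; exact: nbhs_infty_gt.
have x0' : 0 < x%:R :> R by rewrite ltr0n.
pose A := Num.truncn (x%:R `^ p : R); pose w := Num.truncn (x%:R `^ rho : R).
have A0 : (0 < A)%N by rewrite /A; near: x.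
have w0 : (0 < w)%N by rewrite /w; near: x.
have dA : defect A <= C * A%:R `^ (- e1) by rewrite /A; near: x.
have dx : defect x <= C * x%:R `^ (- e1) by near: x.
have dw : c * w%:R `^ (- e2) <= defect w by rewrite /w; near: x.
have /andP[Alow Aup] : x%:R `^ p / 2 <= A%:R <= x%:R `^ p.
  by apply: truncn_itvP; apply: powR_nat_ge1 => //; exact: ltW.
have /andP[wlow wup] : x%:R `^ rho / 2 <= w%:R <= x%:R `^ rho.
  by apply: truncn_itvP; apply: powR_nat_ge1 => //; apply/ltW/(lt_trans p0).
have A0' : 0 < A%:R :> R by rewrite ltr0n.
have w0' : 0 < w%:R :> R by rewrite ltr0n.
have W := window_mass A0 w0 x0.
set S := \sum_(_ <= n < _) _ in W.
have dw' : c * x%:R `^ (- (rho * e2)) <= defect w.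
  apply: le_trans dw; apply: ler_wpM2l; first exact: ltW.
  rewrite -mulrN powRrM !powRN lef_pV2 ?posrE ?powR_gt0//.
  by apply: ge0_ler_powR; rewrite ?nnegrE ?powR_ge0// /e2 addr_ge0// ltW// invr_gt0.
have AA : 2 * (A%:R / w%:R) * defect A <= 4 * C * x%:R `^ (- rho + p * (1 - e1)).
  apply: (@le_trans _ _ (2 * (A%:R / w%:R) * (C * A%:R `^ (- e1)))).
    by apply: ler_wpM2l => //; rewrite mulr_ge0// divr_ge0.
  have -> : 2 * (A%:R / w%:R) * (C * A%:R `^ (- e1)) =
      2 * C * (w%:R^-1 * A%:R `^ (1 - e1)).
    have -> : A%:R `^ (1 - e1) = A%:R * A%:R `^ (- e1).
      by rewrite (powR_gap (1 - e1) (- e1) A0') opprK subrK powRr1// ltW.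
    by ring.
  rewrite [x%:R `^ (- rho + _)]powRD ?(gt_eqF x0') ?implybT// powRrM.
  have -> : 4 * C * (x%:R `^ (- rho) * (x%:R `^ p) `^ (1 - e1)) =
      2 * C * (2 * x%:R `^ (- rho) * (x%:R `^ p) `^ (1 - e1)) by ring.
  apply: ler_wpM2l; first by rewrite mulr_ge0// ltW.
  apply: ler_pM; rewrite ?invr_ge0 ?powR_ge0//.
    by rewrite powRN -[2]invrK -invfM lef_pV2 ?posrE ?mulr_gt0 ?invr_gt0 ?powR_gt0// mulrC.
  by apply: ge0_ler_powR; rewrite ?nnegrE ?powR_ge0//.
have S1 : x%:R `^ (- 1) <= S.
  have h1 : 16 * C / c * x%:R `^ (- rho + p * (1 - e1)) <= x%:R `^ (- (rho * e2)).
    by near: x; apply: natV_cmp => //; rewrite divr_gt0// mulr_gt0.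
  have h2 : 8 * C / c * x%:R `^ (- e1) <= x%:R `^ (- (rho * e2)).
    by near: x; apply: natV_cmp => //; rewrite divr_gt0// mulr_gt0.
  have h3 : 2 / c * x%:R `^ (- 1) <= x%:R `^ (- (rho * e2)).
    by near: x; apply: natV_cmp; rewrite ?divr_gt0// ltrN2.
  move: h1 h2 h3 W dw' AA dx; rewrite ![_ / c * _]mulrAC !ler_pdivrMr//.
  set q1 := x%:R `^ (- rho + _); set q2 := x%:R `^ (- e1); set q3 := x%:R `^ (- (rho * _)).
  set q4 := x%:R `^ (- 1).
  move: (2 * _ * _) (defect w) (defect x) S q1 q2 q3 q4.
  by clear=> D1 D2 D3 S q1 q2 q3 q4; lra.
have [/hasP[n nI pn]|/hasPn none] := boolP (has (fun n => x%:R `^ (- 2) <= size_prob n) (index_iota A.+1 x.+1)).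
  move: nI pn; rewrite mem_index_iota; case: n => // n /andP[An nx] pn.
  exists n; split => //.
  apply: (@le_trans _ _ (2 * A%:R)); first by rewrite -ler_pdivrMl// mulrC.
  by rewrite ler_pM2l// ler_nat.
exfalso.
have : S < x%:R `^ (- 1).
  apply: (@le_lt_trans _ _ (\sum_(A.+1 <= n < x.+1) x%:R `^ (- 2))).
    rewrite /S big_seq [leRHS]big_seq; apply: ler_sum => n /none.
    by rewrite -ltNge => /ltW.
  rewrite sumr_const_nat subSS -[ltLHS]mulr_natr.
  have -> : x%:R `^ (- 1) = x%:R `^ (- 2) * x%:R :> R.
    exact: powRN1_N2.
  by rewrite ltr_pM2l ?powR_gt0// ltr_nat ltn_subrL A0.
by rewrite ltNge S1.
Unshelve. all: end_near. Qed.

Lemma size_prob_lower (eps : R) : 0 < eps -> \forall n \near \oo,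
  0 < size_prob n.+1 -> expR (- n%:R `^ eps) <= size_prob n.+1.
Proof.
apply: a_lower => [n|i j|].
- exact: size_prob_itv.
- exact: size_prob_super.
- exact: size_window.
Qed.

(** * Asymptotics of the range *)

Section asymptotics.
Context (d : nat) (far : nat -> pred V) (N : V -> \bar R) (s2 : R).
Hypothesis d_gt0 : (0 < d)%N.
Hypothesis d_lt : d%:R * (1 - alpha^-1) < 2.
Hypothesis near_count : forall r (s : seq V), uniq s -> all (predC (far r)) s ->
  (size s <= (2 * r).+1 ^ d)%N.
Hypothesis N_ge0 : forall x, (0 <= N x)%E.
Hypothesis N0 : N 0 = 0%E.
Hypothesis s2_ge0 : 0 <= s2.
Hypothesis far_N : forall r x, far r x -> ((r%:R ^+ 2)%:E <= N x)%E.
Hypothesis N_drift : forall y, tot (fun x => (th x * N (y + x)%R)%E) = (N y + s2%:E)%E.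

Lemma alphaV_itv : 0 < alpha^-1 < 1.
Proof.
have /andP[a1 a2] := alpha_itv; have a0 : 0 < alpha by apply: lt_trans a1.
by rewrite invr_gt0 a0 invf_lt1.
Qed.

(** Room between the exponent of the height and that of the square of the
    radius of a ball with few points. *)
Lemma exponents : exists k g g' : R,
  [/\ 1 - alpha^-1 < k, k < g, g < g', k < 1 & d%:R * g' < 2].
Proof.
have /andP[ia0 ia1] := alphaV_itv.
pose b := d%:R : R; have b0 : 0 <= b by [].
pose k0 := 1 - alpha^-1; have k00 : 0 < k0 by rewrite subr_gt0.
pose rho := Num.min 1 ((2 - b * k0) / (b + 1)).
have num0 : 0 < 2 - b * k0 by rewrite subr_gt0.
have b1 : 0 < b + 1 by lra.
have rho0 : 0 < rho by rewrite lt_min ltr01 divr_gt0.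
have br : b * rho < 2 - b * k0.
  have : rho * (b + 1) <= 2 - b * k0 by rewrite -ler_pdivlMr// ge_min lexx orbT.
  lra.
have rho1 : rho <= 1 by rewrite ge_min lexx.
pose u := Num.min rho alpha^-1.
have u0 : 0 < u by rewrite lt_min rho0.
have ur : u <= rho by rewrite ge_min lexx.
have ui : u <= alpha^-1 by rewrite ge_min lexx orbT.
(* Any three increasing points between [k0] and [k0 + u] would do. *)
exists (k0 + u / 4), (k0 + u / 3), (k0 + u / 2); split; rewrite /k0; try lra.
have : b * u <= b * rho by rewrite ler_wpM2l.
rewrite -/k0 -/b mulrDr => h.
have h0 : 0 <= b * u by rewrite mulr_ge0// ltW.
rewrite mulrA; lra.
Qed.

Lemma ball_size (r : nat) (p w : R) : (0 < r)%N -> r%:R <= w `^ (p / 2) -> 0 < w ->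
  ((2 * r).+1 ^ d)%:R <= 3 ^+ d * w `^ (d%:R * p / 2) :> R.
Proof.
move=> r0 rw w0; rewrite natrX.
have -> : d%:R * p / 2 = p / 2 * d%:R by rewrite -mulrA mulrC.
rewrite powRrM powR_mulrn ?powR_ge0// -exprMn; apply: lerXn2r; rewrite ?nnegrE//.
  by rewrite mulr_ge0 ?powR_ge0.
apply: (@le_trans _ _ (3 * r%:R)); last by rewrite ler_pM2l.
by rewrite -natrM ler_nat; move: r0; clear; lia.
Qed.

Lemma far_count (r : nat) (t : ltree V) :
  (size (undup (disp t)) <= (2 * r).+1 ^ d + count (far r) (disp t))%N.
Proof.
rewrite -(count_predC (far r) (undup _)) addnC leq_add//.
  rewrite -size_filter; apply: near_count; first by rewrite filter_uniq// undup_uniq.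
  by apply/allP => x; rewrite mem_filter => /andP[].
by apply: leq_count_subseq; exact: undup_subseq.
Qed.

Lemma expr_onem_low (w : nat) : (2 <= w)%N -> (1 - w%:R^-1) ^- w <= expR 2 :> R.
Proof.
move=> w2; have w0 : 0 < w%:R :> R by rewrite ltr0n; apply: leq_trans w2.
have w1 : 0 < w%:R - 1 :> R by rewrite subr_gt0 ltr1n.
have z0 : 0 < 1 - w%:R^-1 :> R by rewrite subr_gt0 invf_lt1// ltr1n.
rewrite -exprVn.
have -> : (1 - w%:R^-1)^-1 = 1 + (w%:R - 1)^-1 :> R.
  by field; rewrite !gt_eqF.
apply: (@le_trans _ _ (expR (w%:R - 1)^-1 ^+ w)).
  apply: lerXn2r; rewrite ?nnegrE ?expR_ge0//; last exact: expR_ge1Dx.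
  by rewrite addr_ge0// invr_ge0 ltW.
rewrite -expRM_natr ler_expR mulrC ler_pdivrMr//.
have : 2 <= w%:R :> R by rewrite ler_nat.
lra.
Qed.

Lemma expR_decay (y : R) : 0 < y -> expR (- y) <= y^-1.
Proof.
move=> y0; rewrite expRN lef_pV2 ?posrE ?expR_gt0//.
by apply: le_trans (expR_ge1Dx y); rewrite lerDr.
Qed.

Lemma size_prob_lowerS (eps : R) : 0 < eps -> \forall w \near \oo,
  0 < size_prob w -> expR (- w%:R `^ eps) <= size_prob w.
Proof.
move=> eps0; apply: near_inftyS; near=> n => pn.
apply: (@le_trans _ _ (expR (- n%:R `^ eps))).
  rewrite ler_expR lerN2; apply: ge0_ler_powR; rewrite ?nnegrE ?ler_nat//.
  exact: ltW.
by move: pn; near: n; exact: size_prob_lower.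
Unshelve. all: end_near. Qed.

(** The power of [phi] is at most [exp (- c * w^(g - k))], to be compared with the
    lower bound [exp (- w^e)] on [size_prob w] for [e] smaller than [g - k]; this
    makes high marks negligible even among the trees with exactly [w] vertices. *)
Lemma high_marks_negligible (k g del : R) : 1 - alpha^-1 < k -> k < g -> k < 1 -> 0 < del ->
  \forall w \near \oo, 0 < size_prob w ->
    (((1 - w%:R^-1) ^- w)%:E * phi (1 - w%:R^-1) ^+ Num.truncn (w%:R `^ g : R)
      <= (del * size_prob w)%:E)%E.
Proof.
move=> k0 kg k1 del0.
have [c c0 Hc] := phi_upper k0 k1.
have g0 : 0 < g by apply: lt_trans kg; apply: lt_trans k0; case/andP: alphaV_itv => _; rewrite subr_gt0.
pose e := (g - k) / 2; have e0 : 0 < e by rewrite divr_gt0// subr_gt0.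
have e2 : 2 * e = g - k by rewrite /e mulrCA mulfV ?mulr1// pnatr_eq0.
near=> w => pw.
have w2 : (2 <= w)%N by near: w; exact: nbhs_infty_gt.
have w0 : 0 < w%:R :> R by rewrite ltr0n; apply: leq_trans w2.
have phiw : (phi (1 - w%:R^-1) <= (1 - c * w%:R `^ (- k))%:E)%E by near: w.
have pwe : expR (- w%:R `^ e) <= size_prob w by move: pw; near: w; exact: size_prob_lowerS.
set H := Num.truncn _.
have wg1 : 1 <= w%:R `^ g :> R by apply: powR_nat_ge1; [exact: leq_trans w2|exact: ltW].
have /andP[Hlow _] := truncn_itvP wg1; rewrite -/H in Hlow.
have z01 : 0 <= (1 - w%:R^-1 : R) <= 1 by apply: inv_nat_itv; apply: leq_trans w2.
have phi0 : (0 <= phi (1 - w%:R^-1))%E by apply: phi_ge0 => //; case/andP: z01.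
have q0 : 0 <= 1 - c * w%:R `^ (- k) by rewrite -lee_fin; exact: le_trans phiw.
have phiH : (phi (1 - w%:R^-1) ^+ H <= (expR (- (c / 2) * w%:R `^ (2 * e)))%:E)%E.
  apply: (@le_trans _ _ ((1 - c * w%:R `^ (- k)) ^+ H)%:E).
    rewrite EFin_expe; elim: (H) => [|j IH]; first by rewrite !expe0.
    by rewrite !expeS; apply: lee_pmul => //; exact: expe_ge0.
  rewrite lee_fin; apply: (@le_trans _ _ (expR (- (c * w%:R `^ (- k))) ^+ H)).
    apply: lerXn2r; rewrite ?nnegrE ?expR_ge0//; exact: expR_ge1Dx.
  rewrite -expRM_natr ler_expR !mulNr lerN2 e2.
  rewrite powRD ?(gt_eqF w0) ?implybT// -!mulrA ler_pM2l//.
  by rewrite mulrA [leRHS]mulrC ler_pM2r ?powR_gt0// mulrC.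
have den : (1 - w%:R^-1) ^- w <= expR 2 :> R by exact: expr_onem_low.
apply: (@le_trans _ _ (expR 2 * expR (- (c / 2) * w%:R `^ (2 * e)))%:E).
  rewrite EFinM; apply: lee_pmul => //; rewrite ?lee_fin//.
  - by rewrite invr_ge0 exprn_ge0//; case/andP: z01.
  - exact: expe_ge0.
rewrite lee_fin; apply: (@le_trans _ _ (del * expR (- w%:R `^ e))); last by rewrite ler_pM2l.
have step : 4 / c * w%:R `^ e <= w%:R `^ (2 * e).
  by near: w; apply: natV_cmp; rewrite ?divr_gt0//; lra.
have small : expR 2 / del * w%:R `^ 0 <= w%:R `^ e.
  by near: w; apply: natV_cmp => //; rewrite divr_gt0// expR_gt0.
have we0 : 0 < w%:R `^ e by rewrite powR_gt0.
rewrite powRr0 mulr1 in small.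
apply: (@le_trans _ _ (expR 2 * (expR (- w%:R `^ e) * expR (- w%:R `^ e)))).
  rewrite ler_pM2l ?expR_gt0// -expRD ler_expR.
  by move: step; rewrite mulrAC ler_pdivrMr//; lra.
rewrite mulrA ler_pM2r ?expR_gt0//.
apply: (@le_trans _ _ (expR 2 * (w%:R `^ e)^-1)).
  by rewrite ler_pM2l ?expR_gt0//; exact: expR_decay.
by rewrite ler_pdivrMr// mulrC -ler_pdivrMr.
Unshelve. all: end_near. Qed.

(** At radius [r = w^(g' / 2)] the sites that are not far number at most
    [(2 r + 1)^d], which is [o(w)] as [d g' < 2]. The vertices at far sites are
    negligible: up to height [w^g] because [g < g'], above it because vertices of such
    a height are rare. *)
Lemma range_small (eps del : R) : 0 < eps -> 0 < del ->
  \forall w \near \oo, 0 < size_prob w ->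
  (tot (fun t => if (nvert t == w) && (eps * w%:R < (size (undup (disp t)))%:R)%R
    then weight t else 0) <= (del * size_prob w)%:E)%E.
Proof.
move=> eps0 del0.
have [k [g [g' [k0 kg gg k1 dg]]]] := exponents.
have kpos : 0 < k by apply: lt_trans k0; case/andP: alphaV_itv => _; rewrite subr_gt0.
have g0 : 0 < g by apply: lt_trans kg.
have g'0 : 0 < g' by apply: lt_trans gg.
have d20 : 0 < del * eps / 4 by rewrite !mulr_gt0.
have hmn := high_marks_negligible k0 kg k1 d20.
have s21 : 0 < 4 * s2 + 1 by rewrite ltr_wpDl// mulr_ge0.
near=> w => pw.
have w2 : (2 <= w)%N by near: w; exact: nbhs_infty_gt.
have w0 : 0 < w%:R :> R by rewrite ltr0n; apply: leq_trans w2.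
have z01 : 0 <= (1 - w%:R^-1 : R) <= 1 by apply: inv_nat_itv; apply: leq_trans w2.
have z0 : 0 < (1 - w%:R^-1 : R) <= 1.
  by rewrite subr_gt0 invf_lt1// ltr1n w2 gerBl invr_ge0 ltW.
pose H := Num.truncn (w%:R `^ g : R); pose r := Num.truncn (w%:R `^ (g' / 2) : R).
have w1 : (0 < w)%N by apply: leq_trans w2.
have /andP[rlow rup] : w%:R `^ (g' / 2) / 2 <= r%:R <= w%:R `^ (g' / 2).
  by apply: truncn_itvP; apply: powR_nat_ge1 => //; rewrite divr_ge0// ltW.
have Hup : H%:R <= w%:R `^ g.
  by have /andP[] : w%:R `^ g / 2 <= H%:R <= w%:R `^ g by apply: truncn_itvP; apply: powR_nat_ge1 => //; exact: ltW.
have r0' : 0 < r%:R :> R by apply: lt_le_trans rlow; rewrite divr_gt0// powR_gt0.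
have r0 : (0 < r)%N by rewrite -(ltr0n R).
have r20 : 0 < r%:R ^+ 2 :> R by rewrite exprn_gt0.
have s20 : (0 <= s2%:E)%E by rewrite lee_fin.
(* The tilt [1 - 1/w] costs only a constant on trees with [w] vertices. *)
have hm := far_count_mass m_ge0 th_ge0 th_mass (offs_mass mu) N_ge0 N0
  s20 r20 (@far_N r) N_drift w H z0 (phi_le1 z01).
have high : (((1 - w%:R^-1) ^- w)%:E * phi (1 - w%:R^-1) ^+ H
    <= (del * eps / 4 * size_prob w)%:E)%E.
  by move: pw; rewrite /H; near: w.
have low : H%:R / r%:R ^+ 2 * s2 <= del * eps / 4.
  have rr2 : w%:R `^ g' / 4 <= r%:R ^+ 2.
    have -> : w%:R `^ g' / 4 = (w%:R `^ (g' / 2) / 2) ^+ 2.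
      by rewrite expr_div_n -powR_mulrn ?powR_ge0// -powRrM divfK ?pnatr_eq0// -natrX.
    by apply: lerXn2r; rewrite ?nnegrE ?divr_ge0 ?powR_ge0.
  have v0 : 0 <= w%:R `^ (g - g') by exact: powR_ge0.
  have Hr : H%:R / r%:R ^+ 2 <= 4 * w%:R `^ (g - g').
    rewrite ler_pdivrMr//; apply: (le_trans Hup).
    rewrite (powR_gap g g' w0) [4 * _]mulrC -mulrA; apply: ler_wpM2l => //.
    by move: rr2; rewrite ler_pdivrMr// mulrC.
  have small : w%:R `^ (g - g') <= del * eps / 4 / (4 * s2 + 1).
    rewrite -opprB; near: w; apply: natV_small; first by rewrite subr_gt0.
    by rewrite divr_gt0.
  rewrite ler_pdivlMr// in small.
  apply: (@le_trans _ _ (4 * w%:R `^ (g - g') * s2)); first exact: ler_wpM2r.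
  apply: le_trans small; rewrite -mulrA mulrCA ler_wpM2l//; lra.
have ball : ((2 * r).+1 ^ d)%:R <= eps / 2 * w%:R.
  apply: (le_trans (ball_size r0 rup w0)).
  have : 3 ^+ d * 2 / eps * w%:R `^ (d%:R * g' / 2) <= w%:R `^ 1.
    near: w; apply: natV_cmp; first by lra.
    by rewrite divr_gt0// mulr_gt0// exprn_gt0.
  rewrite powRr1 ?(ltW w0)//; set q := w%:R `^ _ => h.
  have -> : 3 ^+ d * q = eps / 2 * (3 ^+ d * 2 / eps * q) by field; rewrite gt_eqF.
  by apply: ler_wpM2l => //; rewrite divr_ge0// ltW.
apply: (@le_trans _ _ ((2 / (eps * w%:R))%:E *
   tot (fun t => if nvert t == w then weight t * (count (far r) (disp t))%:R%:E else 0))%E).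
  rewrite -totZ; last 2 first.
  - by rewrite lee_fin divr_ge0// mulr_ge0// ltW.
  - by move=> t; case: ifP => // _; rewrite mule_ge0// lee_fin.
  apply: le_tot => t; case: eqP => [tw|] /=; last by rewrite mule0.
  case: ifPn => [big|_]; last by rewrite mule_ge0// ?mule_ge0// lee_fin// divr_ge0// mulr_ge0// ltW.
  rewrite muleCA -[leLHS]mule1; apply: lee_wpmul2l => //.
  rewrite -EFinM lee_fin mulrAC ler_pdivlMr ?mulr_gt0// mul1r.
  have : (size (undup (disp t)))%:R <= ((2 * r).+1 ^ d)%:R + (count (far r) (disp t))%:R :> R.
    by rewrite -natrD ler_nat far_count.
  lra.
apply: (@le_trans _ _ ((2 / (eps * w%:R))%:E * (w%:R * (del * eps / 2 * size_prob w))%:E)%E); last first.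
  rewrite -EFinM lee_fin le_eqVlt; apply/orP; left; apply/eqP.
  by field; rewrite !gt_eqF.
apply: lee_wpmul2l; first by rewrite lee_fin divr_ge0// mulr_ge0// ltW.
apply: (le_trans hm); rewrite size_probE.
have -> : (w%:R * (del * eps / 2 * size_prob w))%:E =
  ((del * eps / 4 * (w%:R * size_prob w))%:E + w%:R%:E * (del * eps / 4 * size_prob w)%:E)%E.
  by rewrite -EFinM -EFinD; congr EFin; field.
apply: leeD; last by apply: lee_wpmul2l => //; rewrite lee_fin.
rewrite -!EFinM lee_fin; apply: ler_wpM2r => //.
by rewrite mulr_ge0// ltW.
Unshelve. all: end_near. Qed.

(** By [escape_mass] at radius [n], with [M = (2 n + 1)^d] and [H = n^b], the product
    [H * c] is at most [M^(1 - 1/alpha)], up to a small loss in the exponent, plus a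
    multiple of [H^2 / n^2]; both are [o(H)] when [d (1 - 1/alpha) < b < 2]. *)
Lemma escape_zero (c : R) :
  (forall H : nat, ((H%:R * c)%:E <= \sum_(h < H)
     tot (fun z : zipper (V := V) => if size z.1 == h then
       weight (plug z.1 z.2) * (0%R \notin later z)%:R%:E else 0))%E) -> c <= 0.
Proof.
move=> Hc; rewrite leNgt; apply/negP => c0.
have [k [g [g' [k0 kg gg k1 dg]]]] := exponents.
have kpos : 0 < k by apply: lt_trans k0; case/andP: alphaV_itv => _; rewrite subr_gt0.
have dk : d%:R * k < 2.
  by apply: le_lt_trans dg; apply: ler_wpM2l => //; apply/ltW/(lt_trans kg).
pose b := (d%:R * k + 2) / 2.
have dk0 : 0 <= d%:R * k by rewrite mulr_ge0// ltW.
have b0 : 0 < b by rewrite /b; lra.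
have bdk : d%:R * k < b by rewrite /b; lra.
have b2 : b < 2 by rewrite /b; lra.
have e0 : 0 < 1 - k by rewrite subr_gt0.
have e1 : 1 - k < alpha^-1 by lra.
have [C C0 HC] := defect_upper e0 e1.
pose M (n : nat) := ((2 * n).+1 ^ d)%N.
have MC : \forall n \near \oo, defect (M n) <= C * (M n)%:R `^ (- (1 - k)).
  have [n0 _ Hn0] := HC; exists n0 => // n /= n0n; apply: Hn0 => /=.
  apply: (leq_trans n0n); apply: (@leq_trans ((2 * n).+1 ^ 1)%N).
    by rewrite expn1 ltnW// ltnS leq_pmull.
  by apply: leq_pexp2l.
pose K := (3 ^+ d : R) `^ k; have K0 : 0 < K by rewrite powR_gt0// exprn_gt0.
have s21 : 0 < s2 + 1 by rewrite ltr_wpDl.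
have small1 : \forall n \near \oo, n%:R `^ (d%:R * k - b) <= c / 16 / (C * K).
  have -> : d%:R * k - b = - (b - d%:R * k) by rewrite opprB.
  by apply: natV_small; rewrite ?subr_gt0// !divr_gt0// mulr_gt0.
have small2 : \forall n \near \oo, n%:R `^ (b - 2) <= c / 4 / (s2 + 1).
  have -> : b - 2 = - (2 - b) by rewrite opprB.
  by apply: natV_small; rewrite ?subr_gt0// !divr_gt0.
have [n [n0 dM sm1 sm2]] : exists n : nat, [/\ (0 < n)%N,
    defect (M n) <= C * (M n)%:R `^ (- (1 - k)),
    n%:R `^ (d%:R * k - b) <= c / 16 / (C * K) & n%:R `^ (b - 2) <= c / 4 / (s2 + 1)].
  apply: (@filter_ex _ \oo).
  by apply: filterS (filterI (filterI (nbhs_infty_gt 0) MC) (filterI small1 small2)) => n [[? ?] [? ?]].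
have n0' : 0 < n%:R :> R by rewrite ltr0n.
pose H := Num.truncn (n%:R `^ b : R).
have /andP[Hlow Hup] : n%:R `^ b / 2 <= H%:R <= n%:R `^ b.
  by apply: truncn_itvP; apply: powR_nat_ge1 => //; exact: ltW.
have n20 : 0 < n%:R ^+ 2 :> R by rewrite exprn_gt0.
have M0 : (0 < M n)%N by rewrite /M expn_gt0.
have M0' : 0 < (M n)%:R :> R by rewrite ltr0n.
have s20 : (0 <= s2%:E)%E by rewrite lee_fin.
have i1 : 0 <= (1 : R) <= 1 by rewrite ler01 lexx.
have F1 : (Fgen 1 <= 1)%E by rewrite FRE// FR1.
have := escape_mass m_ge0 th_ge0 th_mass (@near_count n) N_ge0 N0 s20 n20 (@far_N n) N_drift H F1 (phi_le1 i1).
move=> /(le_trans (Hc H)) main.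
have := le_trans main (leeD (truncated_mean M0) (lexx _)).
rewrite -EFinM -EFinD lee_fin => {}main.
have MK : (M n)%:R * (M n)%:R `^ (- (1 - k)) <= K * n%:R `^ (d%:R * k).
  have -> : (M n)%:R * (M n)%:R `^ (- (1 - k)) = (M n)%:R `^ k :> R.
    rewrite -{1}(powRr1 (ltW M0')) -powRD; last by rewrite (gt_eqF M0') implybT.
    by congr powR; ring.
  rewrite /K mulrC powRrM powR_mulrn ?ler0n// -powRM ?exprn_ge0// -exprMn.
  apply: ge0_ler_powR; rewrite ?nnegrE ?exprn_ge0 ?(ltW kpos)//.
  rewrite /M natrX; apply: lerXn2r; rewrite ?nnegrE// ?mulr_ge0//.
  by rewrite -natrM ler_nat; move: n0; clear; lia.
set q := n%:R `^ b in Hlow Hup; have q0 : 0 < q by rewrite powR_gt0.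
have A1 : 2 * (M n)%:R * defect (M n) <= c / 8 * q.
  apply: (@le_trans _ _ (2 * (C * (K * n%:R `^ (d%:R * k))))).
    rewrite -mulrA ler_pM2l//; apply: (@le_trans _ _ ((M n)%:R * (C * (M n)%:R `^ (- (1 - k))))).
      by rewrite ler_pM2l.
    by rewrite mulrCA ler_pM2l.
  rewrite (powR_gap (d%:R * k) b n0') -/q.
  rewrite ler_pdivlMr ?mulr_gt0// in sm1.
  rewrite !mulrA ler_pM2r//; move: sm1; set v := n%:R `^ _; lra.
have A2 : H%:R ^+ 2 / n%:R ^+ 2 * s2 <= c / 4 * q.
  apply: (@le_trans _ _ (q ^+ 2 / n%:R ^+ 2 * s2)).
    apply: ler_wpM2r => //; apply: ler_wpM2r; first by rewrite invr_ge0 ltW.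
    by apply: lerXn2r; rewrite ?nnegrE// ltW.
  have -> : q ^+ 2 / n%:R ^+ 2 = q * n%:R `^ (b - 2).
    rewrite expr2 -mulrA; congr (_ * _).
    by rewrite powRD ?(gt_eqF n0') ?implybT// -/q powRN powR_mulrn ?ltW.
  rewrite ler_pdivlMr// in sm2.
  have v0 : 0 <= n%:R `^ (b - 2) by exact: powR_ge0.
  rewrite -mulrA [leRHS]mulrC ler_pM2l//; apply: le_trans sm2.
  by apply: ler_wpM2l => //; lra.
have A3 : q / 2 * c <= H%:R * c by rewrite ler_pM2r.
have : 0 < c * q by rewrite mulr_gt0.
move: main A1 A2 A3; set x1 := 2 * _ * _; set x2 := _ / _ * s2; set x3 := H%:R * c.
move=> ? ? ? ? ?; lra.
Qed.

End asymptotics.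

End tree_size.


(** * Sums over the lattice *)

HB.instance Definition _ d := Countable.copy (Zd d) 'rV[int]_d.

Section lattice.
Context {R : realType} {d : nat}.
Implicit Types (x y : Zd d).
Local Notation coord := Defs.coord.

Definition far (r : nat) (x : Zd d) : bool :=
  [exists i : 'I_d, (r < `|(x : 'rV[int]_d) 0%R i|)%N].

(** A site which is not far has each of its coordinates in [[- r, r]]. *)
Lemma near_count r (s : seq (Zd d)) : uniq s -> all (predC (far r)) s ->
  (size s <= (2 * r).+1 ^ d)%N.
Proof.
move=> us /allP ns.
pose f (x : Zd d) : {ffun 'I_d -> 'I_(2 * r).+1} :=
  [ffun i => inord `|((x : 'rV[int]_d) 0 i + r%:Z)%R|%N].
have small x i : x \in s -> (`|(x : 'rV[int]_d) 0%R i| <= r)%N.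
  by move=> /ns /=; rewrite /far negb_exists => /forallP/(_ i); rewrite -leqNgt.
have uf : uniq (map f s).
  rewrite map_inj_in_uniq// => x y xs ys /ffunP fxy; apply/rowP => i.
  have := fxy i; rewrite !ffunE => /(congr1 val).
  have := small _ i xs; have := small _ i ys.
  set a := (x : 'rV[int]_d) 0 i; set b := (y : 'rV[int]_d) 0 i => ? ?.
  by rewrite /= !inordK; lia.
rewrite -(size_map f) -(card_uniqP uf); apply: leq_trans (max_card _) _.
by rewrite card_ffun !card_ord.
Qed.

Definition sqnorm x : R := \sum_i coord i x ^+ 2.

Lemma sqnorm_ge0 x : 0 <= sqnorm x.
Proof. by apply: sumr_ge0 => i _; exact: sqr_ge0. Qed.

Lemma sqnorm0 : sqnorm 0 = 0.
Proof. by apply: big1 => i _; rewrite /coord mxE expr0n. Qed.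

Lemma far_sqnorm r x : far r x -> r%:R ^+ 2 <= sqnorm x.
Proof.
case/existsP => i ri; rewrite /sqnorm (bigD1 i)//=.
apply: ler_wpDr; first by apply: sumr_ge0 => j _; exact: sqr_ge0.
rewrite /coord -[leRHS]real_normK ?num_real//.
apply: lerXn2r; rewrite ?nnegrE// -intr_norm.
by rewrite -[r%:R]/(r%:Z%:~R) ler_int; move: ri; clear; lia.
Qed.

Section sums.
Context (theta : probability (Zd d) R).
Local Open Scope ereal_scope.

Definition atom x : \bar R := theta [set x].

Lemma atom_ge0 x : 0 <= atom x. Proof. exact: measure_ge0. Qed.

Lemma tot_integral (f : Zd d -> \bar R) : (forall x, 0 <= f x) ->
  tot (fun x => atom x * f x) = \int[theta]_x f x.
Proof.
move=> f0.
pose F n := if @pickle_inv (Zd d) n is Some a then [set a] else set0.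
have UF : \bigcup_n F n = setT.
  by apply/seteqP; split => // x _; exists (pickle x) => //; rewrite /F pickleK_inv.
rewrite -UF ge0_integral_bigcup//; last first.
  by apply: pickle_fibers => a b [x [/= -> ->]].
rewrite -tot_pickle; last by move=> a; rewrite mule_ge0.
apply: eq_eseriesr => n _; rewrite /F; case: pickle_inv => [a|]; last by rewrite integral_set0.
rewrite (eq_integral (cst (f a))); last by move=> x /[!inE] ->.
by rewrite integral_cst// muleC.
Qed.

Lemma atom_mass : tot atom = 1.
Proof.
rewrite (@eq_tot _ _ _ (fun x => atom x * 1)); last by move=> x; rewrite mule1.
rewrite tot_integral// integral_cst// mul1e; exact: probability_setT.
Qed.

Hypothesis theta_jump : jump_distribution theta.

Definition jump_variance : R := fine (\int[theta]_x (sqnorm x)%:E).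

Lemma integrable_sq i : theta.-integrable setT (fun x => (coord i x ^+ 2)%:E).
Proof.
apply/integrableP; split => //.
have [_ + _] := theta_jump; rewrite /finite_moment unlock; apply: le_lt_trans.
apply: ge0_le_integral => //= x _.
rewrite ger0_norm ?sqr_ge0// lee_fin powR_mulrn ?sqrtr_ge0// /enorm sqr_sqrtr ?sqnorm_ge0//.
by rewrite (bigD1 i)//= lerDl sumr_ge0// => j _; exact: sqr_ge0.
Qed.

Lemma integral_sq_shift (i : 'I_d) (y : Zd d) :
  \int[theta]_x ((coord i (y + x)%R ^+ 2)%:E) =
  (coord i y ^+ 2)%:E + \int[theta]_x ((coord i x ^+ 2)%:E).
Proof.
have [/(_ i) [ic Ec] _ _] := theta_jump.
rewrite (eq_integral (fun x => (coord i y ^+ 2)%:E +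
   ((2 * coord i y)%:E * (coord i x)%:E + (coord i x ^+ 2)%:E))); last first.
  move=> x _; rewrite -EFinM -!EFinD /coord mxE rmorphD/=; congr EFin; ring.
have i1 : theta.-integrable setT (fun x => (2 * coord i y)%:E * (coord i x)%:E).
  exact: integrableZl.
rewrite integralD//; last 2 first.
- exact: finite_measure_integrable_cst.
- by apply: integrableD => //; exact: integrable_sq.
rewrite integral_cst//; congr (_ + _).
  by rewrite -[RHS]mule1; congr (_ * _); exact: probability_setT.
rewrite integralD//; last exact: integrable_sq.
move: Ec; rewrite unlock => Ec.
by rewrite integralZl// Ec mule0 add0e.
Qed.

(** Expanding the square, the cross terms vanish since the jumps are centered. *)
Lemma sqnorm_drift y :
  tot (fun x => atom x * (sqnorm (y + x))%:E) = (sqnorm y)%:E + jump_variance%:E.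
Proof.
have sumE z : \int[theta]_x ((sqnorm (z + x))%:E) =
    \sum_(i < d) ((coord i z ^+ 2)%:E + \int[theta]_x ((coord i x ^+ 2)%:E)).
  under eq_integral do rewrite /sqnorm -sumEFin.
  rewrite ge0_integral_sum//; last by move=> i x _; rewrite lee_fin sqr_ge0.
  by apply: eq_bigr => i _; exact: integral_sq_shift.
rewrite tot_integral; last by move=> x; rewrite lee_fin sqnorm_ge0.
rewrite sumE big_split/= sumEFin; congr (_ + _).
have := sumE 0%R; under eq_integral do rewrite add0r.
rewrite big_split/= big1 ?add0e => [E|i _]; last by rewrite /coord mxE expr0n.
rewrite /jump_variance E fineK//; apply/sum_fin_numP => i _ _.
exact/integrable_fin_num/integrable_sq.
Qed.

Lemma jump_variance_ge0 : (0 <= jump_variance)%R.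
Proof. by apply/fine_ge0/integral_ge0 => x _; rewrite lee_fin sqnorm_ge0. Qed.

End sums.

Lemma dimension_lt (alpha : R) : 1 < alpha <= 2 ->
  d%:R < 2 * alpha / (alpha - 1) -> d%:R * (1 - alpha^-1) < 2.
Proof.
move=> /andP[a1 _]; have a0 : 0 < alpha by apply: lt_trans a1.
rewrite ltr_pdivlMr ?subr_gt0// => H.
by rewrite -(ltr_pM2r a0) -mulrA mulrBl mulVf ?gt_eqF// mul1r.
Qed.

End lattice.

Section lattice_walk.
Context {R : realType} {d : nat} (alpha : R) (mu : probability nat R).
Context (theta : probability (Zd d) R).
Hypothesis alpha_itv : 1 < alpha <= 2.
Hypothesis mu_crit : critical mu.
Hypothesis mu_dom : in_dom alpha mu.
Hypothesis theta_jump : jump_distribution theta.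
Hypothesis d_gt0 : (0 < d)%N.
Hypothesis d_lt : d%:R < 2 * alpha / (alpha - 1).

Local Notation m := (offs mu).
Local Notation th := (atom theta).

Let sqnormE_ge0 (x : Zd d) : (0 <= (sqnorm x)%:E :> \bar R)%E.
Proof. by rewrite lee_fin sqnorm_ge0. Qed.
Let sqnormE0 : (sqnorm (0 : Zd d))%:E = 0%E :> \bar R.
Proof. by rewrite sqnorm0. Qed.
Let far_sqnormE r (x : Zd d) : far r x -> ((r%:R ^+ 2)%:E <= (sqnorm x)%:E :> \bar R)%E.
Proof. by move=> rx; rewrite lee_fin far_sqnorm. Qed.

Lemma lattice_range_small (eps del : R) : 0 < eps -> 0 < del ->
  \forall w \near \oo, 0 < size_prob mu th w ->
  (tot (fun t => if (nvert t == w) && (eps * w%:R < (size (undup (disp t)))%:R)%R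
    then weight m th t else 0) <= (del * size_prob mu th w)%:E)%E.
Proof.
exact: (range_small alpha_itv mu_crit mu_dom (atom_ge0 theta) (atom_mass theta)
  (dimension_lt alpha_itv d_lt) (@near_count d) sqnormE_ge0 sqnormE0
  (jump_variance_ge0 theta) far_sqnormE (sqnorm_drift theta_jump)).
Qed.

Lemma lattice_escape_zero (c : R) :
  (forall H : nat, ((H%:R * c)%:E <= \sum_(h < H)
     tot (fun z : zipper (V := Zd d) => if size z.1 == h then
       weight m th (plug z.1 z.2) * (0%R \notin later z)%:R%:E else 0))%E) -> c <= 0.
Proof.
exact: (escape_zero alpha_itv mu_crit mu_dom (atom_ge0 theta) (atom_mass theta)
  d_gt0 (dimension_lt alpha_itv d_lt) (@near_count d) sqnormE_ge0 sqnormE0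
  (jump_variance_ge0 theta) far_sqnormE (sqnorm_drift theta_jump)).
Qed.

(** The two fixed points [F 1 = 1] and [phi 1 = 1] express criticality. *)
Lemma zipper_mass h :
  tot (fun z : zipper (V := Zd d) =>
    if size z.1 == h then weight m th (plug z.1 z.2) else 0%E) = 1%E.
Proof.
have F1 : (Fgen m th 1 = 1)%E.
  rewrite (FRE mu (atom_ge0 theta) (atom_mass theta)) ?ler01 ?lexx//.
  by rewrite (FR1 mu_crit mu_dom (atom_ge0 theta) (atom_mass theta)).
have p1 : (phi m th 1 = 1)%E.
  rewrite /phi F1 mul1e /genfun' -[RHS](offs_mean' mu_crit); apply: eq_tot => k.
  by rewrite -EFin_expe expr1n mule1.
transitivity (marked_mass m th h (fun n => (1 ^+ n)%:E)).
  by apply: eq_tot => z; rewrite expr1n mule1.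
rewrite (marked_mass_expr (offs_ge0 mu) (atom_ge0 theta) (atom_mass theta))//.
by rewrite p1 F1 -EFin_expe expr1n mule1.
Qed.

End lattice_walk.


(** * Reading off a finite tree from offspring numbers and increments *)

Section realization.
Context {V : countZmodType}.
Implicit Types (t : ltree V) (s l r : seq (V * ltree V)) (w : seq nat).
Implicit Types (k : seq nat -> nat) (x : seq nat -> V).
Local Notation tree_of := Defs.tree_of.

(** Requirements on the offspring number of a vertex, respectively on the increment
    along the edge leading to it, vertices being given by their labels. *)
Definition constr : Type := ((seq nat * nat) + (seq nat * V))%type.

Definition cindex (c : constr) : seq nat + seq nat :=
  match c with inl a => inl a.1 | inr a => inr a.1 end.

Definition csat k x (c : constr) : bool :=
  match c with inl a => k a.1 == a.2 | inr a => x a.1 == a.2 end.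

Definition cdown (i : nat) (c : constr) : constr :=
  match c with inl a => inl (i :: a.1, a.2) | inr a => inr (i :: a.1, a.2) end.

(** The requirements that single out [t]. The inner fixpoint is [fconstraints 0],
    inlined for the sake of structural recursion; all the labels are relative to the
    root of [t], which makes the subtrees independent of their position. *)
Fixpoint constraints t : seq constr := let: Node s := t in
  inl ([::], size s) ::
  (fix fc i s := if s is p :: r then
     inr ([:: i], p.1) :: map (cdown i) (constraints p.2) ++ fc i.+1 r
   else [::]) 0 s.

Fixpoint fconstraints (i : nat) s : seq constr :=
  if s is p :: r then
    inr ([:: i], p.1) :: map (cdown i) (constraints p.2) ++ fconstraints i.+1 r
  else [::].

Lemma constraintsE s : constraints (Node s) = inl ([::], size s) :: fconstraints 0 s.
Proof. by []. Qed.

Definition realizes k x t : bool := all (csat k x) (constraints t).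

Definition frealizes k x i s : bool := all (csat k x) (fconstraints i s).

Lemma csat_down k x i c :
  csat k x (cdown i c) = csat (fun w => k (i :: w)) (fun w => x (i :: w)) c.
Proof. by case: c. Qed.

Lemma realizesE k x s : realizes k x (Node s) = (k [::] == size s) && frealizes k x 0 s.
Proof. by []. Qed.

Lemma frealizes_cons k x i p s : frealizes k x i (p :: s) =
  [&& x [:: i] == p.1, realizes (fun w => k (i :: w)) (fun w => x (i :: w)) p.2 &
      frealizes k x i.+1 s].
Proof.
rewrite /frealizes /= all_cat all_map; congr [&& _, _ & _].
by apply: eq_all => c /=; rewrite csat_down.
Qed.

Lemma frealizes_inj k x i s s' : (forall p, p \in s -> forall k x t',
    realizes k x p.2 -> realizes k x t' -> p.2 = t') -> size s = size s' ->
  frealizes k x i s -> frealizes k x i s' -> s = s'.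
Proof.
elim: s s' i => [|p s IHs] [|p' s'] i //= IH [ss'].
rewrite !frealizes_cons => /and3P[/eqP xp rp rs] /and3P[/eqP xp' rp' rs'].
have -> : s = s' by apply: IHs rs rs' => // q qs; apply: IH; rewrite inE qs orbT.
congr (_ :: _); rewrite [p]surjective_pairing [p']surjective_pairing -xp -xp'.
by rewrite (IH p (mem_head _ _) _ _ _ rp rp').
Qed.

(** Distinct trees are thus realized on disjoint events. *)
Lemma realizes_inj k x t t' : realizes k x t -> realizes k x t' -> t = t'.
Proof.
elim/(@ltree_ind_in V): t k x t' => s IH k x [s'].
rewrite !realizesE => /andP[/eqP ks rs] /andP[/eqP ks' rs'].
by rewrite (frealizes_inj _ _ rs rs') -?ks -?ks'// => p ps k' x' t'; exact: IH.
Qed.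

(** The order is that of [disp]: reading the walk along the labels gives the
    displacements, see [labels_walk]. *)
Fixpoint labels t : seq (seq nat) := let: Node s := t in
  [::] :: (fix fl i s := if s is p :: r then
     map (cons i) (labels p.2) ++ fl i.+1 r else [::]) 0 s.

Fixpoint flabels i s : seq (seq nat) :=
  if s is p :: r then map (cons i) (labels p.2) ++ flabels i.+1 r else [::].

Lemma tree_of_cons k i w :
  tree_of k (i :: w) <-> (i < k [::])%N /\ tree_of (fun v => k (i :: v)) w.
Proof.
split=> [H|[ik H] [|j]//= /H//]; split; first exact: (H 0).
by move=> j jw; exact: (H j.+1).
Qed.

Lemma walk_nil x : walk x [::] = 0.
Proof. by rewrite /walk big_geq. Qed.

Lemma walk_cons x i w : walk x (i :: w) = x [:: i] + walk (fun v => x (i :: v)) w.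
Proof. by rewrite /walk big_nat_recl//= take0. Qed.

Lemma flabels_walk k x i s :
  (forall p, p \in s -> forall k x, realizes k x p.2 ->
     map (walk x) (labels p.2) = disp p.2) ->
  frealizes k x i s -> map (walk x) (flabels i s) = fdisp s.
Proof.
elim: s i => [|p s IHs] i //= IH; rewrite frealizes_cons => /and3P[/eqP xp rp rs].
rewrite map_cat (IHs _ _ rs); last by move=> q qs; apply: IH; rewrite inE qs orbT.
rewrite /fdisp /= -(IH p (mem_head _ _) _ _ rp) -!map_comp; congr (_ ++ _).
by apply: eq_map => w /=; rewrite walk_cons xp.
Qed.

Lemma labels_walk k x t : realizes k x t -> map (walk x) (labels t) = disp t.
Proof.
elim/(@ltree_ind_in V): t k x => s IH k x; rewrite realizesE => /andP[_ rs].
rewrite -[labels _]/([::] :: flabels 0 s) -[disp _]/(0 :: fdisp s) /= walk_nil.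
by rewrite (flabels_walk IH rs).
Qed.

Lemma mem_flabels k x i s w :
  (forall p, p \in s -> forall k x w, realizes k x p.2 ->
     (w \in labels p.2) <-> tree_of k w) ->
  frealizes k x i s ->
  w \in flabels i s <-> (exists j v, [/\ w = j :: v, (i <= j < i + size s)%N &
                           tree_of (fun v => k (j :: v)) v]).
Proof.
elim: s i => [|p s IHs] i /=.
  move=> _ _; split=> // -[j [v [_]]]; lia.
move=> IH; rewrite frealizes_cons => /and3P[_ rp rs].
have {}IHs := IHs i.+1 (fun q qs => IH q (@mem_behead _ (p :: s) q qs)) rs.
have {}IH := IH p (mem_head _ _) _ _ _ rp.
rewrite mem_cat; split=> [/orP[/mapP[v vp ->]|/IHs[j [v [-> ij kv]]]]|].
- by exists i, v; split; [|lia|exact/IH].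
- by exists j, v; split => //; lia.
- move=> [j [v [wjv ij kv]]]; apply/orP.
  case: (eqVneq j i) wjv kv => [->|ji] wjv kv.
    by left; rewrite wjv; apply/mapP; exists v => //; exact/IH.
  by right; apply/IHs; exists j, v; split => //; lia.
Qed.

Lemma mem_labels k x t w : realizes k x t -> (w \in labels t) <-> tree_of k w.
Proof.
elim/(@ltree_ind_in V): t k x w => s IH k x w; rewrite realizesE => /andP[/eqP ks rs].
rewrite -[labels _]/([::] :: flabels 0 s) inE.
case: w => [|i w]; first by split.
rewrite /= tree_of_cons (mem_flabels _ IH rs); split.
  by move=> [j [v [[<- <-]]]]; rewrite ks.
by rewrite ks => -[? ?]; exists i, w.
Qed.

Lemma flabels_head i s w : w \in flabels i s ->
  exists j v, w = j :: v /\ (i <= j)%N.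
Proof.
elim: s i => //= p s IH i; rewrite mem_cat => /orP[/mapP[v _ ->]|/IH[j [v [-> ij]]]].
  by exists i, v.
by exists j, v; split => //; lia.
Qed.

Lemma uniq_labels t : uniq (labels t).
Proof.
elim/(@ltree_ind_in V): t => s IH.
rewrite -[labels _]/([::] :: flabels 0 s) /=; apply/andP; split.
  by apply/negP => /flabels_head[j [v []]].
elim: s 0%N IH => //= p s IHs i IH.
rewrite cat_uniq map_inj_uniq; last by move=> ? ? [].
rewrite IH ?mem_head//= IHs ?andbT; last by move=> q qs; rewrite IH// inE qs orbT.
apply/hasPn => w /flabels_head[j [v [-> ij]]]; apply/mapP => -[? _ [ji]].
by rewrite ji ltnn in ij.
Qed.

Lemma card_seq_set (T : choiceType) (s : seq T) :
  size (finmap.enum_fset (fset_set [set` s])) = size (undup s).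
Proof.
rewrite -(finmap.size_seq_fset tt); congr size; congr finmap.enum_fset.
apply/finmap.fsetP => y; rewrite in_fset_set// finmap.seq_fsetE.
by apply/idP/idP; rewrite inE.
Qed.

Lemma realizes_card k x t : realizes k x t -> (tree_of k #= `I_(nvert t))%card.
Proof.
move=> rt; have -> : tree_of k = [set` labels t].
  by apply/seteqP; split => w /= /(mem_labels _ rt).
rewrite -size_disp -(labels_walk rt) size_map.
rewrite -[X in (X #= _)%card](fset_setK (finite_seq (labels t))).
by apply/card_eq_fsetP; rewrite card_seq_set undup_id ?uniq_labels.
Qed.

Lemma realizes_range k x t : realizes k x t ->
  range_size (tree_of k) (walk x) = size (undup (disp t)).
Proof.
move=> rt; have -> : tree_of k = [set` labels t].
  by apply/seteqP; split => w /= /(mem_labels _ rt).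
rewrite /range_size -(labels_walk rt).
have -> : walk x @` [set` labels t] = [set` map (walk x) (labels t)].
  apply/seteqP; split => [_ /= [w wt <-]|y /= /mapP[w wt ->]]; last by exists w.
  exact: map_f.
exact: card_seq_set.
Qed.

(** The tree read off from [k] and [x], cut at height [D]. *)
Fixpoint explore (D : nat) k x : ltree V :=
  if D is D'.+1 then
    Node [seq (x [:: i], explore D' (fun w => k (i :: w)) (fun w => x (i :: w)))
         | i <- iota 0 (k [::])]
  else Node [::].

Lemma explore_realizes D k x : (forall w, tree_of k w -> (size w <= D)%N) ->
  realizes k x (explore D k x).
Proof.
elim: D k x => [|D IH] k x H; rewrite [explore _ _ _]/= realizesE.
  case E: (k [::]) => [|n] //=.
  suff /H : tree_of k [:: 0] by [].
  by apply/tree_of_cons; rewrite E; split => // -[].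
rewrite size_map size_iota eqxx /=.
have : forall i, (i < 0 + k [::])%N -> realizes (fun w => k (i :: w)) (fun w => x (i :: w))
   (explore D (fun w => k (i :: w)) (fun w => x (i :: w))).
  move=> i ik; apply: IH => w kw; rewrite -ltnS; apply: (H (i :: w)).
  by apply/tree_of_cons.
elim: (k [::]) 0%N => [|n IHn] i Hi //=.
rewrite frealizes_cons eqxx Hi ?addnS ?ltnS ?leq_addr//=.
by apply: IHn => j; rewrite addSnnS; exact: Hi.
Qed.

Lemma finite_realized k x : finite_set (tree_of k) -> exists t, realizes k x t.
Proof.
move=> /finite_seqP[r kr]; exists (explore (\max_(w <- r) size w) k x).
by apply: explore_realizes => w; rewrite kr /= => wr; exact: leq_bigmax_seq.
Qed.

Definition cword (i : seq nat + seq nat) : seq nat :=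
  match i with inl w => w | inr w => w end.

Definition ishift (j : nat) (i : seq nat + seq nat) : seq nat + seq nat :=
  match i with inl w => inl (j :: w) | inr w => inr (j :: w) end.

Lemma cindex_down j c : cindex (cdown j c) = ishift j (cindex c).
Proof. by case: c. Qed.

(** No increment leads to the root: in the infinite tree the label of a spine vertex
    is available for the increment of the spine. *)
Lemma root_free t : inr [::] \notin map cindex (constraints t).
Proof.
case: t => s; rewrite constraintsE /= inE /=.
elim: s 0%N => //= p s IH i; rewrite inE /= map_cat mem_cat negb_or IH andbT.
by apply/mapP => -[_ /mapP[c _ ->]]; rewrite cindex_down; case: (cindex c).
Qed.

Lemma fconstraints_head i s a : a \in map cindex (fconstraints i s) ->
  exists j w, cword a = j :: w /\ (i <= j < i + size s)%N.
Proof.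
elim: s i => //= p s IH i; rewrite inE map_cat mem_cat => /or3P[/eqP ->|/mapP[_ /mapP[c _ ->] ->]|].
- by exists i, [::]; split => //; lia.
- by exists i, (cword (cindex c)); rewrite cindex_down; split; [case: (cindex c)|lia].
- by move=> /IH[j [w [-> ij]]]; exists j, w; split => //; lia.
Qed.

Lemma uniq_fconstraints i s :
  (forall p, p \in s -> uniq (map cindex (constraints p.2))) ->
  uniq (map cindex (fconstraints i s)).
Proof.
elim: s i => //= p s IHs i IH.
have headi c : cword (cindex (cdown i c)) = i :: cword (cindex c).
  by rewrite cindex_down; case: (cindex c).
rewrite map_cat cat_uniq IHs ?andbT; last by move=> q qs; rewrite IH// inE qs orbT.
have e : map cindex (map (cdown i) (constraints p.2)) =
         map (ishift i) (map cindex (constraints p.2)).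
  by rewrite -!map_comp; apply: eq_map => c /=; rewrite cindex_down.
apply/and3P; split.
- rewrite mem_cat e negb_or; apply/andP; split.
    apply/mapP => -[[w|w]//= wp [w0]].
    by move: wp; rewrite -w0; exact/negP/root_free.
  by apply/negP => /fconstraints_head[j [w [[<- _]]]]; lia.
- rewrite e map_inj_uniq ?IH ?mem_head//.
  by move=> [w|w] [w'|w'] //= [->].
- apply/hasPn => a /fconstraints_head[j [w [aw ij]]].
  apply/mapP => -[_ /mapP[c _ ->] ac]; move: aw; rewrite ac headi => -[ji _]; lia.
Qed.

Lemma uniq_constraints t : uniq (map cindex (constraints t)).
Proof.
elim/(@ltree_ind_in V): t => s IH; rewrite constraintsE /= uniq_fconstraints// andbT.
by apply/negP => /fconstraints_head[j [w []]].
Qed.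

Section constraint_weight.
Context {R : realType} (m : nat -> \bar R) (th : V -> \bar R).

Definition cweight (c : constr) : \bar R :=
  match c with inl a => m a.2 | inr a => th a.2 end.

Lemma fconstraints_weight i s :
  (forall p, p \in s -> (\prod_(c <- constraints p.2) cweight c = weight m th p.2)%E) ->
  (\prod_(c <- fconstraints i s) cweight c = fweight m th s)%E.
Proof.
rewrite /fweight; elim: s i => [|p s IHs] i IH /=; first by rewrite !big_nil.
rewrite !big_cons big_cat /= IHs; last by move=> q qs; rewrite IH// inE qs orbT.
rewrite big_map -(IH p (mem_head _ _)) muleA; congr (_ * _ * _)%E.
by apply: eq_bigr => -[].
Qed.

Lemma constraints_weight t : (\prod_(c <- constraints t) cweight c = weight m th t)%E.
Proof.
elim/(@ltree_ind_in V): t => s IH.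
by rewrite constraintsE big_cons fconstraints_weight// weightE.
Qed.

End constraint_weight.

End realization.

(** * The infinite tree seen from its marked vertex *)

Section spine.
Context {V : countZmodType}.
Implicit Types (t : ltree V) (s l r : seq (V * ltree V)) (w : seq nat).
Implicit Types (N J : nat -> nat) (k : vertex -> nat) (x : vertex -> V).
Implicit Types (fs : seq (frame (V := V))) (z : zipper (V := V)).
Local Notation tree_of := Defs.tree_of.

(** Requirements on a spine vertex, its offspring number together with the rank of
    its child on the spine, or on a vertex reached from the spine at a given
    height. *)
Definition sconstr : Type := ((nat * (nat * nat)) + (nat * constr (V := V)))%type.

Definition sindex (c : sconstr) : nat + (vertex + vertex) :=
  match c with
  | inl a => inl a.1
  | inr a => inr (match cindex a.2 with inl w => inl (a.1, w) | inr w => inr (a.1, w) end)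
  end.

Definition ssat N J k x (c : sconstr) : bool :=
  match c with
  | inl a => (N a.1.+1, J a.1.+1) == a.2
  | inr a => csat (fun w => k (a.1, w)) (fun w => x (a.1, w)) a.2
  end.

Definition slice (j : nat) (cs : seq (constr (V := V))) : seq sconstr :=
  map (fun c => inr (j, c)) cs.

(** The requirements on the spine and its bushes, from height [j] upwards. *)
Fixpoint spine_constraints (j : nat) fs : seq sconstr :=
  if fs is fr :: fs' then
    inl (j, ((size fr.1.1 + size fr.2).+1, size fr.1.1)) ::
    inr (j, inr ([::], fr.1.2)) ::
    slice j.+1 (fconstraints 0 fr.1.1 ++ fconstraints (size fr.1.1).+1 fr.2) ++
    spine_constraints j.+1 fs'
  else [::].

(** The requirements for the part of the infinite tree below the spine vertex at
    height [size z.1], marked at [c0], to be [z]. *)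
Definition zconstraints z : seq sconstr :=
  slice 0 (constraints z.2) ++ spine_constraints 0 z.1.

Definition zrealizes N J k x z : bool := all (ssat N J k x) (zconstraints z).

Definition srealizes N J k x j fs : bool := all (ssat N J k x) (spine_constraints j fs).

Lemma srealizes_cons N J k x j fr fs : srealizes N J k x j (fr :: fs) =
  [&& N j.+1 == (size fr.1.1 + size fr.2).+1, J j.+1 == size fr.1.1,
      x (j, [::]) == fr.1.2,
      frealizes (fun w => k (j.+1, w)) (fun w => x (j.+1, w)) 0 fr.1.1,
      frealizes (fun w => k (j.+1, w)) (fun w => x (j.+1, w)) (size fr.1.1).+1 fr.2 &
      srealizes N J k x j.+1 fs].
Proof.
rewrite /srealizes /= all_cat all_map all_cat xpair_eqE -!andbA.
by congr [&& _, _, _, _, _ & _].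
Qed.

Lemma zrealizesE N J k x z : zrealizes N J k x z =
  realizes (fun w => k (0%N, w)) (fun w => x (0%N, w)) z.2 &&
  srealizes N J k x 0 z.1.
Proof. by rewrite /zrealizes all_cat all_map. Qed.

Lemma frealizes_inj_size (k : seq nat -> nat) (x : seq nat -> V) i s s' :
  size s = size s' -> frealizes k x i s -> frealizes k x i s' -> s = s'.
Proof. by apply: frealizes_inj => p _ k' x' t'; exact: realizes_inj. Qed.

Lemma srealizes_inj N J k x j fs fs' : size fs = size fs' ->
  srealizes N J k x j fs -> srealizes N J k x j fs' -> fs = fs'.
Proof.
elim: fs fs' j => [|[[l y] r] fs IH] [|[[l' y'] r'] fs'] j //= [ss].
rewrite !srealizes_cons /=.
move=> /and5P[/eqP Ne /eqP Je /eqP ye rl /andP[rr rs]].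
move=> /and5P[/eqP Ne' /eqP Je' /eqP ye' rl' /andP[rr' rs']].
have ll : size l = size l' by rewrite -Je -Je'.
have rr0 : size r = size r' by move: Ne Ne'; rewrite ll => -> [] /addnI.
rewrite (IH _ _ ss rs rs') -ye -ye' (frealizes_inj_size ll rl rl').
by rewrite -ll in rr'; rewrite (frealizes_inj_size rr0 rr rr').
Qed.

Lemma zrealizes_inj N J k x z z' : size z.1 = size z'.1 ->
  zrealizes N J k x z -> zrealizes N J k x z' -> z = z'.
Proof.
case: z z' => [fs t] [fs' t'] /= ss; rewrite !zrealizesE /=.
move=> /andP[rt rs] /andP[rt' rs'].
by rewrite (realizes_inj rt rt') (srealizes_inj ss rs rs').
Qed.

(** Labels available to the constraints at heights [j] and above. *)
Definition above (j : nat) (i : nat + (vertex + vertex)) : bool :=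
  match i with
  | inl m => (j <= m)%N
  | inr (inl v) => (j < v.1)%N && (v.2 != [::])
  | inr (inr v) => if v.2 == [::] then (j <= v.1)%N else (j < v.1)%N
  end.

Lemma above_spine j fs a : a \in map sindex (spine_constraints j fs) -> above j a.
Proof.
elim: fs j => //= -[[l y] r] fs IH j; rewrite !inE map_cat mem_cat.
case/or4P => [/eqP ->|/eqP ->|/mapP[_ /mapP[c cs ->] ->]|/IH] /=.
- exact: leqnn.
- exact: leqnn.
- have {cs} : cindex c \in map cindex (fconstraints 0 l ++ fconstraints (size l).+1 r).
    exact: map_f.
  rewrite map_cat mem_cat => /orP[] /fconstraints_head[i [w [cw _]]].
    by case: (cindex c) cw => ? /= ->; rewrite ltnSn.
  by case: (cindex c) cw => ? /= ->; rewrite ltnSn.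
- case: a {IH} => [m|[[m w]|[m w]]] /=; first exact: ltnW.
    by move=> /andP[jm ->]; rewrite (ltnW jm).
  by case: ifP => _ jm; exact: ltnW.
Qed.

Lemma slice_index j cs a : a \in map sindex (slice j cs) ->
  exists2 i, i \in map cindex cs &
    a = inr (match i with inl w => inl (j, w) | inr w => inr (j, w) end).
Proof.
by case/mapP => _ /mapP[c cs0 ->] ->; exists (cindex c) => //; exact: map_f.
Qed.

Lemma uniq_slice j cs : uniq (map cindex cs) -> uniq (map sindex (slice j cs)).
Proof.
rewrite /slice -map_comp; set f := fun i : seq nat + seq nat => inr (match i with
  inl w => inl (j, w) | inr w => inr (j, w) end) : nat + (vertex + vertex).
rewrite (eq_map (g := f \o cindex))//.
have f_inj : injective f by move=> [w|w] [w'|w'] // [->].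
by move=> cs0; rewrite map_comp (map_inj_uniq f_inj).
Qed.

Lemma uniq_spine j fs : uniq (map sindex (spine_constraints j fs)).
Proof.
elim: fs j => //= -[[l y] r] fs IH j; rewrite inE map_cat /=.
have A a : a \in map sindex (slice j.+1 (fconstraints 0 l ++ fconstraints (size l).+1 r)) ->
    exists v, [/\ v.1 = j.+1, v.2 != [::] & a = inr (inl v) \/ a = inr (inr v)].
  case/slice_index => i; rewrite map_cat mem_cat => il ->.
  have [b [w cw]] : exists b w, cword i = b :: w.
    by case/orP: il => /fconstraints_head[b [w [cw _]]]; exists b, w.
  by exists (j.+1, cword i); rewrite cw; split => //; case: i cw {il} => ? /= ->; [left|right].
have B a : a \in map sindex (spine_constraints j.+1 fs) -> above j.+1 a.
  exact: above_spine.
apply/and3P; split.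
- rewrite mem_cat negb_or; apply/andP; split; apply/negP.
    by case/A => v [_ _ []].
  by move/B => /=; rewrite ltnn.
- rewrite mem_cat negb_or; apply/andP; split; apply/negP.
    by case/A => v [_ v2 [//|[v0]]]; move: v2; rewrite -v0.
  by move/B => /=; rewrite ltnn.
- rewrite cat_uniq IH andbT; apply/andP; split.
    apply: uniq_slice; rewrite map_cat cat_uniq !uniq_fconstraints ?andbT /=; last 2 first.
    + by move=> p _; exact: uniq_constraints.
    + by move=> p _; exact: uniq_constraints.
    apply/hasPn => a /fconstraints_head[i [w [aw ij]]]; apply/negP.
    by case/fconstraints_head => i' [w' []]; rewrite aw => -[<- _]; lia.
  apply/hasPn => a /B Ba; apply/negP => /A[v [v1 v2 av]].
  by case: av Ba => -> /=; rewrite ?(negbTE v2) v1 ltnn.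
Qed.

Lemma uniq_zconstraints z : uniq (map sindex (zconstraints z)).
Proof.
rewrite map_cat cat_uniq uniq_spine andbT uniq_slice ?uniq_constraints//=.
apply/hasPn => a /above_spine Ba; apply/negP => /slice_index[i it ai].
move: Ba; rewrite ai; case: i it {ai} => w wt //=.
case: eqP => // w0 _.
by move: wt; rewrite w0 (negbTE (root_free _)).
Qed.

Section spine_weight.
Context {R : realType} (m : nat -> \bar R) (th : V -> \bar R).
Hypothesis m_ge0 : forall n, (0 <= m n)%E.
Hypothesis th_ge0 : forall y, (0 <= th y)%E.

Definition sweight (c : sconstr) : \bar R :=
  match c with inl a => m a.2.1 | inr a => cweight m th a.2 end.

Lemma spine_constraints_weight j fs :
  (\prod_(c <- spine_constraints j fs) sweight c = \prod_(fr <- fs) frame_weight m th fr)%E.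
Proof.
elim: fs j => [|[[l y] r] fs IH] j /=; first by rewrite !big_nil.
rewrite !big_cons big_cat /= IH big_map big_cat /=.
rewrite !fconstraints_weight; last 2 first.
- by move=> p _; exact: constraints_weight.
- by move=> p _; exact: constraints_weight.
by rewrite /frame_weight /= -!muleA.
Qed.

(** A spine vertex weighs as much as a vertex of a finite tree, so that a marked tree
    has the same weight in both models. *)
Lemma zconstraints_weight z :
  (\prod_(c <- zconstraints z) sweight c = weight m th (plug z.1 z.2))%E.
Proof.
rewrite big_cat big_map /= spine_constraints_weight weight_plug// muleC; congr (_ * _)%E.
exact: constraints_weight.
Qed.

End spine_weight.

(** A vertex below a younger sibling of a spine vertex comes after [c0]. *)
Lemma later_up_label N J k x j fs y : srealizes N J k x j fs -> y \in later_up fs ->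
  exists m i w, [/\ (j < m)%N, (J m < i)%N,
    tree_of (fun v => nchild N k (m, v)) (i :: w) &
    y = walk (fun v => x (m, v)) (i :: w) - \sum_(j <= a < m) x (a, [::])].
Proof.
elim: fs j y => //= -[[l u] r] fs IH j y; rewrite srealizes_cons /=.
move=> /and5P[/eqP Ne /eqP Je /eqP ue rl /andP[rr rs]] /mapP[y0 + ->].
rewrite mem_cat => /orP[|/(IH _ _ rs)[m [i [w [jm Ji kw ->]]]]]; last first.
  exists m, i, w; split => //; first exact: ltnW.
  by rewrite [in RHS]big_ltn ?(ltnW jm)// -ue opprD addrA addrAC.
rewrite -(flabels_walk (fun p _ f g => @labels_walk _ f g p.2) rr).
case/mapP => w0 /(mem_flabels _ (fun p _ f g w => @mem_labels _ f g p.2 w) rr).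
move=> [i [w [-> li kw]]] ->.
exists j.+1, i, w; split => //; first by rewrite Je; case/andP: li.
  by apply/tree_of_cons; rewrite /nchild /= Ne; split => //; move: li; lia.
by rewrite big_nat1 ue.
Qed.

Lemma iter_parent_word n m w : size w = n -> iter n parent (m, w) = (m, [::]).
Proof.
elim: n w => [|n IH] w; first by move/size0nil ->.
case: (lastP w) => // w' a; rewrite size_rcons => -[wn].
rewrite iterSr -(IH _ wn) /parent /=.
by rewrite size_rcons /= -cats1 take_size_cat//; case: {wn}w'.
Qed.

Lemma iter_parent_spine n : iter n parent c0 = (n, [::]).
Proof. by elim: n => //= n ->. Qed.

(** The vertices coming after the mark are vertices of the right-hand part of the
    infinite tree. *)
Lemma later_vertex N J k x z y : zrealizes N J k x z -> y \in later z ->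
  exists2 v, Tplus N J k v & walk_inf x v = y.
Proof.
rewrite zrealizesE => /andP[rt rs]; rewrite /later mem_cat => /orP[|/(later_up_label rs)].
  rewrite -(labels_walk rt) behead_map => /mapP[w wt ->].
  have kw : tree_of (fun w => k (0%N, w)) w by apply/(mem_labels _ rt)/mem_behead.
  have w0 : w != [::].
    apply: contraTneq wt => ->; have := uniq_labels z.2.
    by case: (z.2) => s /=; case/andP.
  exists (0%N, w); last by rewrite /walk_inf big_geq// oppr0 add0r.
  split; [by split|by left; exists (size w); exact: iter_parent_word|].
  by move=> -[w00]; rewrite w00 eqxx in w0.
move=> [m [i [w [m0 Ji kw ->]]]]; exists (m, i :: w); last first.
  by rewrite /walk_inf addrC.
split => //; first by split => //= _ _; rewrite gtn_eqF.
right; exists (m.-1, [::]), (m, [:: i]); split.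
- by rewrite /parent /= prednK.
- by rewrite /sib_rank /= prednK.
- by exists m.-1; exact: iter_parent_spine.
exists (size w) => /=.
elim/last_ind: w {kw} => // w a IH.
by rewrite size_rcons iterSr -[RHS]IH /parent /= size_rcons /= -cats1 take_size_cat.
Qed.

End spine.


(** * Independent constraints *)

Section constraint_events.
Context {R : realType} {d0 : measure_display} {Om : measurableType d0}.
Context (P : probability Om R).

Lemma uniq_map_inj (A B : eqType) (f : A -> B) (s : seq A) :
  uniq (map f s) -> {in s &, injective f}.
Proof.
elim: s => //= a s IH /andP[fa us] x y; rewrite !inE.
case/predU1P => [->|xs] /predU1P[->|ys] // fxy; last exact: IH.
  by rewrite fxy map_f in fa.
by rewrite -fxy map_f in fa.
Qed.

(** The indices being distinct, each requirement is the whole of what is asked from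
    the sigma-algebra attached to its index. *)
Lemma independent_constraints (I : eqType) (E : I -> set (set Om)) (C : eqType)
    (idx : C -> I) (sat : C -> Om -> bool) (cs : seq C) :
  mutually_independent P E -> uniq (map idx cs) ->
  (forall c, c \in cs -> E (idx c) [set o | sat c o]) ->
  P [set o | all (sat^~ o) cs] = (\prod_(c <- cs) P [set o | sat c o])%E.
Proof.
move=> indep ucs Ecs.
pose A i := [set o | all (fun c => (idx c == i) ==> sat c o) cs].
have Ac c : c \in cs -> A (idx c) = [set o | sat c o].
  move=> ccs; apply/seteqP; split => o /=; first by move/allP/(_ c ccs); rewrite eqxx.
  move=> co; apply/allP => c' c'cs; apply/implyP => /eqP cc'.
  by rewrite (uniq_map_inj ucs c'cs ccs cc').
transitivity (P (\bigcap_(i in [set` map idx cs]) A i)).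
  congr (P _); apply/seteqP; split => o /= H.
    by move=> ? _; apply/allP => c ccs; rewrite (allP H) ?implybT.
  by apply/allP => c ccs; have := H _ (map_f idx ccs); rewrite Ac.
rewrite indep//; last by move=> _ /mapP[c ccs ->]; rewrite Ac//; exact: Ecs.
by rewrite big_map; apply: eq_big_seq => c ccs; rewrite Ac.
Qed.

Lemma measurable_constraints (C : eqType) (sat : C -> Om -> bool) (cs : seq C) :
  (forall c, measurable [set o | sat c o]) -> measurable [set o | all (sat^~ o) cs].
Proof.
move=> mc; elim: cs => [|c cs IH]; first by rewrite [X in measurable X](_ : _ = setT)//; apply/seteqP; split.
rewrite [X in measurable X](_ : _ = [set o | sat c o] `&` [set o | all (sat^~ o) cs]).
  exact: measurableI.
by apply/seteqP; split => o /= => [/andP[]|[-> ->]].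
Qed.

End constraint_events.

(** * Recurrence on finite trees *)

Lemma preimage_event {R : realType} {d0 : measure_display} {Om : measurableType d0}
    {P : probability Om R} {d1 : measure_display} {T : measurableType d1}
    (Y : {RV P >-> T}) (B : set T) :
  measurable B -> g_sigma_algebra_preimage Y (Y @^-1` B).
Proof. by move=> mB; exists B => //; rewrite setTI. Qed.

Section finite_tree_walk.
Context {R : realType} {d : nat} (alpha : R) (mu : probability nat R).
Context (theta : probability (Zd d) R).
Hypothesis alpha_itv : 1 < alpha <= 2.
Hypothesis mu_crit : critical mu.
Hypothesis mu_dom : in_dom alpha mu.
Hypothesis theta_jump : jump_distribution theta.
Hypothesis d_lt : d%:R < 2 * alpha / (alpha - 1).
Context {d0 : measure_display} {Om : measurableType d0} (P : probability Om R).
Context (K : seq nat -> {RV P >-> nat}) (X : seq nat -> {RV P >-> Zd d}).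
Hypothesis KX : branching_walk mu theta K X.

Local Notation m := (offs mu).
Local Notation th := (atom theta).

Definition csat_at (c : constr (V := Zd d)) (o : Om) : bool :=
  csat (fun w => K w o) (fun w => X w o) c.

Definition realized (t : ltree (Zd d)) : set Om :=
  [set o | realizes (fun w => K w o) (fun w => X w o) t].

Lemma csat_preimage c : [set o | csat_at c o] =
  match c with inl a => K a.1 @^-1` [set a.2] | inr a => X a.1 @^-1` [set a.2] end.
Proof. by case: c => a; apply/seteqP; split => o /= /eqP. Qed.

Lemma measurable_csat c : measurable [set o | csat_at c o].
Proof.
by rewrite csat_preimage; case: c => a; exact: measurable_funPTI.
Qed.

Lemma measurable_realized t : measurable (realized t).
Proof. exact/measurable_constraints/measurable_csat. Qed.

Lemma prob_realized t : P (realized t) = weight m th t.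
Proof.
have [Kmu Xth indep] := KX.
rewrite -(constraints_weight m th t).
rewrite (independent_constraints (sat := csat_at) indep (uniq_constraints t)) => [|c _].
  apply: eq_bigr => -[a|a] _; rewrite csat_preimage /=.
    by rewrite /offs -(Kmu a.1).
  by rewrite /atom -(Xth a.1).
by rewrite csat_preimage; case: c => a; exact: preimage_event.
Qed.

Lemma prob_realized_in (Q : pred (ltree (Zd d))) :
  P (\bigcup_(t in [set t | Q t]) realized t) =
  tot (fun t => if Q t then weight m th t else 0%E).
Proof.
have [t|t t' _ _ [om [rt rt']]|_ ->] := measure_tot P (Q := Q) (E := realized).
- exact: measurable_realized.
- exact: realizes_inj rt rt'.
- by apply: eq_tot => t; case: ifP => // _; exact: prob_realized.
Qed.

Lemma tree_size_realized n :
  tree_size_event K n = \bigcup_(t in [set t | nvert t == n.+1]) realized t.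
Proof.
apply/seteqP; split => o /=.
  move=> kn; have [t rt] := finite_realized (fun w => X w o) (ex_intro _ n.+1 kn).
  exists t => //=; apply/eqP/card_eq_II; apply: card_eq_trans kn.
  by rewrite card_eq_sym; exact: realizes_card rt.
by move=> [t /= /eqP tn rt]; rewrite /tree_size_event /= -tn; exact: realizes_card rt.
Qed.

Lemma range_gt_realized n eps : range_gt K X n eps `&` tree_size_event K n =
  \bigcup_(t in [set t | (nvert t == n.+1) &&
      (eps < (size (undup (disp t)))%:R / n%:R)]) realized t.
Proof.
rewrite tree_size_realized; apply/seteqP; split => o /=.
  move=> [ro [t /= tn rt]]; exists t => //=; rewrite tn /=.
  by move: ro; rewrite /range_gt /= (realizes_range rt).
move=> [t /= /andP[tn te] rt]; split; last by exists t.
by rewrite /range_gt /= (realizes_range rt).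
Qed.

(** The event [eps < R / n] on trees with [n.+1] vertices is covered by
    [eps / 2 * n.+1 < R]. *)
Theorem finite_recurrence : recurrent_walk K X.
Proof.
move=> eps eps0; apply/cvgrPdist_le => del del0; rewrite near_withinE.
have eps20 : 0 < eps / 2 by rewrite divr_gt0.
have [N _ HN] := lattice_range_small alpha_itv mu_crit mu_dom theta_jump d_lt eps20 del0.
exists N.+1 => // n /= Nn; rewrite /cond_prob range_gt_realized tree_size_realized.
rewrite !prob_realized_in sub0r normrN.
have th0 := atom_ge0 theta.
have -> : tot (fun t => if nvert t == n.+1 then weight m th t else 0%E) =
    (size_prob mu th n.+1)%:E.
  exact: (size_probE mu_crit mu_dom th0 (atom_mass theta)).
rewrite lte_fin => p0.
set q := tot _.
have q0 : (0 <= q)%E by apply: tot_ge0 => t; case: ifP => // _; exact: weight_ge0.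
have qle : (q <= (del * size_prob mu th n.+1)%:E)%E.
  apply: le_trans (HN n.+1 _ p0); last by rewrite /=; lia.
  apply: le_tot => t; case: ifPn => [/andP[-> te]|_].
    rewrite ifT//=; move: te; rewrite ltr_pdivlMr ?ltr0n; last by lia.
    apply: le_lt_trans; rewrite -mulrA ler_pM2l//.
    have : (1 : R) <= n%:R by rewrite ler1n; lia.
    rewrite -[n.+1%:R]natr1; lra.
  by case: ifP => // _; exact: weight_ge0.
have qfin : q \is a fin_num by rewrite ge0_fin_numE//; apply: le_lt_trans qle _; rewrite ltry.
rewrite /= ger0_norm; last by apply: divr_ge0; [exact: fine_ge0|exact: ltW].
by rewrite ler_pdivrMr// -lee_fin fineK.
Qed.

End finite_tree_walk.


(** * Escape from the infinite tree *)

Section countable_events.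
Context {d0 : measure_display} {Om : measurableType d0}.

Lemma measurable_const (Q : Prop) : measurable [set _ : Om | Q].
Proof.
have [q|q] := pselect Q.
  by rewrite [X in measurable X](_ : _ = setT)//; apply/seteqP; split.
by rewrite [X in measurable X](_ : _ = set0)//; apply/seteqP; split.
Qed.

Lemma measurable_or (A B : Om -> Prop) :
  measurable [set o | A o] -> measurable [set o | B o] ->
  measurable [set o | A o \/ B o].
Proof. exact: measurableU. Qed.

Lemma measurable_and (A B : Om -> Prop) :
  measurable [set o | A o] -> measurable [set o | B o] ->
  measurable [set o | A o /\ B o].
Proof. exact: measurableI. Qed.

Lemma measurable_not (A : Om -> Prop) :
  measurable [set o | A o] -> measurable [set o | ~ A o].
Proof. exact: measurableC. Qed.

Lemma measurable_imply (A B : Om -> Prop) :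
  measurable [set o | A o] -> measurable [set o | B o] ->
  measurable [set o | A o -> B o].
Proof.
move=> mA mB; rewrite [X in measurable X](_ : _ = [set o | ~ A o \/ B o]).
  exact/measurable_or/mB/measurable_not.
by apply/seteqP; split => o /=; [case: (pselect (A o)); tauto|tauto].
Qed.

Lemma measurable_exists (T : countType) (A : T -> Om -> Prop) :
  (forall t, measurable [set o | A t o]) -> measurable [set o | exists t, A t o].
Proof.
move=> mA.
rewrite [X in measurable X](_ : _ =
  \bigcup_n [set o | if @pickle_inv T n is Some t then A t o else False]).
  apply: bigcup_measurable => n _; case: pickle_inv => [t|]; first exact: mA.
  exact: measurable_const.
apply/seteqP; split => o /= => [[t At]|[n _ /=]].
  by exists (pickle t) => //=; rewrite pickleK_inv.
by case: pickle_inv => // t At; exists t.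
Qed.

Lemma measurable_forall (T : countType) (A : T -> Om -> Prop) :
  (forall t, measurable [set o | A t o]) -> measurable [set o | forall t, A t o].
Proof.
move=> mA; rewrite [X in measurable X](_ : _ = [set o | ~ exists t, ~ A t o]).
  by apply/measurable_not/measurable_exists => t; exact: measurable_not.
by apply/seteqP; split => o /= => [H [t]|/forallNP H t]; [exact|exact: contrapT].
Qed.

Definition discrete_rv (T : Type) (f : Om -> T) : Prop :=
  forall a, measurable [set o | f o = a].

Lemma discrete_event (T : countType) (f : Om -> T) (Q : T -> Prop) :
  discrete_rv f -> measurable [set o | Q (f o)].
Proof.
move=> mf; rewrite [X in measurable X](_ : _ = [set o | exists a, f o = a /\ Q a]).
  apply: measurable_exists => a; apply: measurable_and; first exact: mf.
  exact: measurable_const.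
by apply/seteqP; split => o /= => [|[a [-> ]]]; [exists (f o)|].
Qed.

Lemma discrete_cst (T : Type) (c : T) : discrete_rv (fun=> c).
Proof. by move=> a; exact: measurable_const. Qed.

Lemma discrete_pair (T U : Type) (f : Om -> T) (g : Om -> U) :
  discrete_rv f -> discrete_rv g -> discrete_rv (fun o => (f o, g o)).
Proof.
move=> mf mg [a b].
rewrite [X in measurable X](_ : _ = [set o | f o = a /\ g o = b]).
  exact: measurable_and.
by apply/seteqP; split => o /= [-> ->].
Qed.

Lemma discrete_comp (T : countType) (U : Type) (f : Om -> T) (g : T -> U) :
  discrete_rv f -> discrete_rv (fun o => g (f o)).
Proof. by move=> mf a; exact: (discrete_event (fun t => g t = a)). Qed.

Lemma discrete_sum (V : countZmodType) (I : Type) (r : seq I) (f : I -> Om -> V) :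
  (forall i, discrete_rv (f i)) -> discrete_rv (fun o => \sum_(i <- r) f i o).
Proof.
move=> mf; elim: r => [|i r IH].
  by under eq_fun do rewrite big_nil; exact: discrete_cst.
under eq_fun do rewrite big_cons.
exact: (discrete_comp (fun p => p.1 + p.2)) (discrete_pair (mf i) IH).
Qed.

End countable_events.

Section infinite_tree_recurrence.
Context {R : realType} {d : nat} (alpha : R) (mu : probability nat R).
Context (theta : probability (Zd d) R).
Hypothesis alpha_itv : 1 < alpha <= 2.
Hypothesis mu_crit : critical mu.
Hypothesis mu_dom : in_dom alpha mu.
Hypothesis theta_jump : jump_distribution theta.
Hypothesis d_gt0 : (0 < d)%N.
Hypothesis d_lt : d%:R < 2 * alpha / (alpha - 1).
Context {d0 : measure_display} {Om : measurableType d0} (P : probability Om R).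
Context (N J : nat -> {RV P >-> nat}) (K : vertex -> {RV P >-> nat}).
Context (X : vertex -> {RV P >-> Zd d}).
Hypothesis NJKX : infinite_tree_walk mu theta N J K X.

Local Notation m := (offs mu).
Local Notation th := (atom theta).

Lemma discrete_mfun {d1 : measure_display} {T : measurableType d1} (Y : {RV P >-> T}) :
  (forall a : T, measurable [set a]) -> discrete_rv (Y : Om -> T).
Proof. by move=> m1 a; have := measurable_funPTI Y (m1 a). Qed.

Lemma discrete_N j : discrete_rv (N j : Om -> nat).
Proof. exact: discrete_mfun. Qed.
Lemma discrete_J j : discrete_rv (J j : Om -> nat).
Proof. exact: discrete_mfun. Qed.
Lemma discrete_K v : discrete_rv (K v : Om -> nat).
Proof. exact: discrete_mfun. Qed.
Lemma discrete_X v : discrete_rv (X v : Om -> Zd d).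
Proof. exact: discrete_mfun. Qed.

Lemma discrete_walk_inf v : discrete_rv (fun o => walk_inf (fun v => X v o) v).
Proof.
have back : discrete_rv (fun o => \sum_(0 <= i < v.1) X (i, [::]) o).
  by apply: discrete_sum => i; exact: discrete_X.
have down : discrete_rv (fun o => \sum_(1 <= i < (size v.2).+1) X (v.1, take i v.2) o).
  by apply: discrete_sum => i; exact: discrete_X.
exact: (discrete_comp (fun p => - p.1 + p.2) (discrete_pair back down)).
Qed.

Lemma discrete_nchild v :
  discrete_rv (fun o => nchild (fun j => N j o) (fun v => K v o) v).
Proof. by rewrite /nchild; case: (_ && _); [exact: discrete_N|exact: discrete_K]. Qed.

Lemma measurable_Tinf v : measurable
  [set o | Tinf (fun j => N j o) (fun j => J j o) (fun v => K v o) v].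
Proof.
apply: measurable_and.
  apply: measurable_forall => i; apply: measurable_imply; first exact: measurable_const.
  exact: (discrete_event (fun n => is_true (nth 0%N v.2 i < n)%N) (discrete_nchild _)).
do 2!(apply: measurable_imply; first exact: measurable_const).
exact: (discrete_event (fun n => is_true (head 0%N v.2 != n)) (discrete_J _)).
Qed.

Lemma discrete_rank v : discrete_rv (fun o => sib_rank (fun j => J j o) v).
Proof. by rewrite /sib_rank; case: v.2 => *; [exact: discrete_J|exact: discrete_cst]. Qed.

Lemma measurable_Tplus v : measurable
  [set o | Tplus (fun j => N j o) (fun j => J j o) (fun v => K v o) v].
Proof.
rewrite [X in measurable X](_ : _ =
  [set o | Tinf (fun j => N j o) (fun j => J j o) (fun v => K v o) v /\
           (dfs_le (fun j => J j o) c0 v /\ v <> c0)]); last first.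
  by apply/seteqP; split => o /= => [[? ? ?]|[? [? ?]]].
apply: measurable_and; first exact: measurable_Tinf.
apply: measurable_and; last exact: measurable_const.
apply: measurable_or; first exact: measurable_const.
apply: measurable_exists => a; apply: measurable_exists => b.
rewrite [X in measurable X](_ : _ =
  [set o | (sib_rank (fun j => J j o) a < sib_rank (fun j => J j o) b)%N /\
           [/\ parent a = parent b, ancestor_eq a c0 & ancestor_eq b v]]); last first.
  by apply/seteqP; split => o /= => [[? ? ? ?]|[? [? ? ?]]].
apply: measurable_and; last exact: measurable_const.
exact: (discrete_event (fun p => is_true (p.1 < p.2)%N)
  (discrete_pair (discrete_rank a) (discrete_rank b))).
Qed.

Lemma measurable_avoid v : measurable [set o | walk_inf (fun v => X v o) v <> 0].
Proof. exact: (discrete_event (fun y => y <> 0) (discrete_walk_inf v)). Qed.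

Lemma measurable_Esc : measurable (Esc N J K X).
Proof.
apply: measurable_forall => v; apply: measurable_imply; first exact: measurable_Tinf.
by apply: measurable_imply; [exact: measurable_const|exact: measurable_avoid].
Qed.

Lemma measurable_Esc_plus : measurable (Esc_plus N J K X).
Proof.
apply: measurable_forall => v; apply: measurable_imply; first exact: measurable_Tplus.
exact: measurable_avoid.
Qed.

Definition ssat_at (c : sconstr (V := Zd d)) (o : Om) : bool :=
  ssat (fun j => N j o) (fun j => J j o) (fun v => K v o) (fun v => X v o) c.

Definition zrealized (z : zipper (V := Zd d)) : set Om :=
  [set o | zrealizes (fun j => N j o) (fun j => J j o) (fun v => K v o) (fun v => X v o) z].

Lemma ssat_preimage c : [set o | ssat_at c o] =
  match c with
  | inl a => (fun o => (N a.1.+1 o, J a.1.+1 o)) @^-1` [set a.2]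
  | inr (j, inl a) => K (j, a.1) @^-1` [set a.2]
  | inr (j, inr a) => X (j, a.1) @^-1` [set a.2]
  end.
Proof. by case: c => [a|[j [a|a]]]; apply/seteqP; split => o /= /eqP. Qed.

Lemma measurable_ssat c : measurable [set o | ssat_at c o].
Proof.
rewrite ssat_preimage; case: c => [[j a]|[j [a|a]]].
- exact: (discrete_pair (discrete_N j.+1) (discrete_J j.+1)).
- exact: measurable_funPTI.
- exact: measurable_funPTI.
Qed.

Lemma measurable_zrealized z : measurable (zrealized z).
Proof. exact/measurable_constraints/measurable_ssat. Qed.

(** The size-biased law and the uniform rank combine into the offspring law:
    the weight of a spine vertex with a given rank is that of a vertex of a
    finite tree. *)
Lemma spine_prob j a b : (b < a)%N ->
  P [set o | (N j.+1 o, J j.+1 o) == (a, b)] = m a.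
Proof.
have [Nmu Junif _ _ _] := NJKX; move=> ba.
rewrite [X in P X](_ : _ = N j.+1 @^-1` [set a] `&` J j.+1 @^-1` [set b]); last first.
  by apply/seteqP; split => o /= => [/eqP[-> ->]|[-> ->]].
rewrite Junif// Nmu// muleA -EFinM mulVf ?mul1e// pnatr_eq0.
by case: a ba.
Qed.

Definition ranked (c : sconstr (V := Zd d)) : bool :=
  if c is inl a then (a.2.2 < a.2.1)%N else true.

Lemma zconstraints_ranked z c : c \in zconstraints z -> ranked c.
Proof.
rewrite mem_cat => /orP[/mapP[? _ ->]//|].
elim: (z.1) 0%N => //= -[[l y] r] fs IH j; rewrite !inE mem_cat.
case/or4P => [/eqP ->|/eqP ->|/mapP[? _ ->]|/IH] //=.
by rewrite ltnS leq_addr.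
Qed.

Lemma prob_zrealized z : P (zrealized z) = weight m th (plug z.1 z.2).
Proof.
have [_ _ Kmu Xth indep] := NJKX.
rewrite -(zconstraints_weight m th z).
rewrite (independent_constraints (sat := ssat_at) indep (uniq_zconstraints z)).
  apply: eq_big_seq => c /zconstraints_ranked.
  case: c => [[j [a b]] /= ab|[j [a|a]] _]; first exact: spine_prob.
    by rewrite ssat_preimage /= /offs -(Kmu (j, a.1)).
  by rewrite ssat_preimage /= /atom -(Xth (j, a.1)).
move=> c _; rewrite ssat_preimage; case: c => [[j [a b]]|[j [a|a]]] /=.
- exists [set (a, b)]; rewrite ?setTI// (_ : [set (a, b)] = [set a] `*` [set b]).
    exact: measurableX.
  by apply/seteqP; split => -[? ?] /= [-> ->].
- exact: preimage_event.
- exact: preimage_event.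
Qed.

Lemma prob_zrealized_in h (Q : pred (zipper (V := Zd d))) :
  let U := \bigcup_(z in [set z | (size z.1 == h) && Q z]) zrealized z in
  measurable U /\ P U = tot (fun z => if (size z.1 == h) && Q z then
                                        weight m th (plug z.1 z.2) else 0%E).
Proof.
move=> U; rewrite {}/U.
have [z|z z' /andP[/eqP zh _] /andP[/eqP zh' _] [om [rz rz']]|mU ->] :=
  measure_tot P (Q := fun z => (size z.1 == h) && Q z) (E := zrealized).
- exact: measurable_zrealized.
- by apply: zrealizes_inj rz rz'; rewrite zh zh'.
- split => //; apply: eq_tot => z; case: ifP => // _; exact: prob_zrealized.
Qed.

(** Almost surely the part of the tree below the spine vertex at height [h] is
    finite, and on the event of escape [c0] is then the last visit to the origin in
    this marked tree. *)
Lemma Esc_plus_le h : (P (Esc_plus N J K X) <= tot (fun z : zipper (V := Zd d) =>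
  if size z.1 == h then weight m th (plug z.1 z.2) * (0%R \notin later z)%:R%:E else 0))%E.
Proof.
have mE := measurable_Esc_plus.
have [mU PU] := prob_zrealized_in h xpredT; set U := \bigcup_(_ in _) _ in mU PU.
have [mW PW] := prob_zrealized_in h (fun z => 0 \notin later z).
set W := \bigcup_(_ in _) _ in mW PW.
have {}PU : P U = 1%E.
  rewrite PU -(zipper_mass theta mu_crit mu_dom h).
  by apply: eq_tot => z; rewrite andbT.
suff /le_trans : (P (Esc_plus N J K X) <= P W)%E.
  apply; rewrite PW; apply: le_tot => z; case: (size z.1 == h) => //=.
  by case: (0 \notin later z); rewrite ?mule1 ?mule0.
have EUW : Esc_plus N J K X `&` U `<=` W.
  move=> o [Eo [z /= /andP[zh _] rz]]; exists z => //=; rewrite zh /=.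
  apply/negP => /(later_vertex rz)[v Tv]; exact: Eo.
have -> : P (Esc_plus N J K X) = P (Esc_plus N J K X `&` U).
  have PC : P (~` U) = 0%E by rewrite probability_setC// PU subee.
  rewrite -[in LHS](setIT (Esc_plus N J K X)) -(setUv U) setIUr measureU0//.
  - exact: measurableI.
  - by apply: measurableI => //; exact: measurableC.
  - apply: subset_measure0 PC => //; last exact: measurableC.
    by apply: measurableI => //; exact: measurableC.
by apply: le_measure; rewrite ?inE//; exact: measurableI.
Qed.

(** The bound of [Esc_plus_le] holds at every height, so that the probability of
    escape satisfies the hypothesis of [escape_zero]. *)
Theorem no_escape : P (Esc_plus N J K X) = 0%E /\ P (Esc N J K X) = 0%E.
Proof.
have mE := measurable_Esc_plus.
have E0 : P (Esc_plus N J K X) = 0%E.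
  have fE : P (Esc_plus N J K X) \is a fin_num by exact: fin_num_measure.
  apply/eqP; rewrite eq_le measure_ge0 andbT -(fineK fE) lee_fin.
  apply: (lattice_escape_zero alpha_itv mu_crit mu_dom theta_jump d_gt0 d_lt) => H.
  elim: H => [|H IH]; first by rewrite mul0r big_ord0.
  rewrite big_ord_recr/= -natr1 mulrDl mul1r EFinD; apply: leeD => //.
  by rewrite fineK//; exact: Esc_plus_le.
split => //; apply: subset_measure0 E0 => //; first exact: measurable_Esc.
by move=> o Eo v [Tv _ v0]; exact: Eo.
Qed.

End infinite_tree_recurrence.

Theorem corollary1p4 (R : realType) (alpha : R) (mu : probability nat R)
    (d : nat) (theta : probability (Zd d) R)
    (alpha_itv : 1 < alpha <= 2)
    (mu_critical : critical mu)
    (mu_dom : in_dom alpha mu)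
    (d_gt0 : (0 < d)%N)
    (theta_jump : jump_distribution theta)
    (theta_moments : forall delta : R, 0 < delta ->
       delta < 2 * alpha / (alpha - 1) -> finite_moment theta delta)
    (d_lt : d%:R < 2 * alpha / (alpha - 1)) :
  (forall (d0 : measure_display) (Om : measurableType d0)
      (P : probability Om R) (K : seq nat -> {RV P >-> nat})
      (X : seq nat -> {RV P >-> Zd d}),
    branching_walk mu theta K X -> recurrent_walk K X)
  /\
  (forall (d0 : measure_display) (Om : measurableType d0)
      (P : probability Om R) (N J : nat -> {RV P >-> nat})
      (K : vertex -> {RV P >-> nat}) (X : vertex -> {RV P >-> Zd d}),
    infinite_tree_walk mu theta N J K X ->
    P (Esc_plus N J K X) = 0%E /\ P (Esc N J K X) = 0%E).
Proof.
split=> [d0 Om P K X KX|d0 Om P N J K X NJKX].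
  exact: (finite_recurrence alpha_itv mu_critical mu_dom theta_jump d_lt KX).
exact: (no_escape alpha_itv mu_critical mu_dom theta_jump d_gt0 d_lt NJKX).
Qed.
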